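(* Let $1<p<3$ and let $q,s$ satisfy $$\max\left\{1,\frac{3p}{5p-3}\right\}<q<3,\qquad \max\left\{1,\frac{(q^*-1)p}{q^*}\right\}<s<\frac{(q^*-1)p^*}{q^*},$$ where $p^*=\frac{3p}{3-p}$ and $q^*=\frac{3q}{3-q}$. Then for every $u\in W^{1,p}(\mathbb{R}^3)$ there exists a unique $\phi_u\in D^{1,q}(\mathbb{R}^3)$ solving $$-\Delta_q\phi=|u|^s\quad\text{in }\mathbb{R}^3.$$
   Context: All functions are real-valued. $\Delta_q\phi=\operatorname{div}(|\nabla\phi|^{q-2}\nabla\phi)$. $W^{1,p}(\mathbb{R}^3)$ is the usual Sobolev space. $D^{1,q}(\mathbb{R}^3)$ is the completion of $C_0^\infty(\mathbb{R}^3)$ with respect to the norm $\|u\|_{D^{1,q}}=\left(\int_{\mathbb{R}^3}|\nabla u|^q\,dx\right)^{1/q}$; by the Sobolev inequality it is regarded as a space of functions in $L^{q^*}(\mathbb{R}^3)$. The equation is understood weakly: $\int_{\mathbb{R}^3}|\nabla\phi|^{q-2}\nabla\phi\cdot\nabla w\,dx=\int_{\mathbb{R}^3}|u|^sw\,dx$ for all $w\in D^{1,q}(\mathbb{R}^3)$, with $|\nabla\phi|^{q-2}\nabla\phi=0$ where $\nabla\phi=0$. *)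

(* Defs.v *)
From HB Require Import structures.
From mathcomp Require Import all_boot all_order all_algebra.
From mathcomp Require Import all_classical all_reals all_analysis.

Set Implicit Arguments.
Unset Strict Implicit.
Unset Printing Implicit Defensive.

Import Order.TTheory GRing.Theory Num.Theory.
Import numFieldNormedType.Exports.

Local Open Scope classical_set_scope.
Local Open Scope ring_scope.

(* [measurableTypeR R] is R with its Borel sigma-algebra, the carrier of
   [lebesgue_measure]. The topology on the product is the usual one of R^3. *)
Notation R3 R :=
  (measurableTypeR R * measurableTypeR R * measurableTypeR R)%type.

Section SobolevSpaces.
Context (R : realType).

Definition mu3 : {measure set (R3 R) -> \bar R} :=
  (lebesgue_measure \x lebesgue_measure \x lebesgue_measure)%E.

(* Elements of L^p, W^{1,p} and D^{1,q} are represented by Borel functions;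
   two functions represent the same element when they agree mu3-a.e. *)

Definition sobolev_exp (p : R) : R := 3 * p / (3 - p).

Definition basis3 (i : 'I_3) : R3 R :=
  ((i == 0%N :> nat)%:R, (i == 1%N :> nat)%:R, (i == 2%N :> nat)%:R).

Definition grad (f : R3 R -> R) (i : 'I_3) : R3 R -> R :=
  fun x => 'D_(basis3 i) f x.

Fixpoint Ck (k : nat) (f : R3 R -> R) : Prop :=
  match k with
  | 0%N => continuous f
  | k'.+1 => continuous f /\
      forall i, (forall x, derivable f x (basis3 i)) /\ Ck k' (grad f i)
  end.

Definition test_function (f : R3 R -> R) : Prop :=
  (forall k, Ck k f) /\ compact (closure [set x | f x != 0]).

Definition loc_integrable (f : R3 R -> R) : Prop :=
  measurable_fun setT f /\
  forall K : set (R3 R), compact K -> mu3.-integrable K (EFin \o f).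

Definition weak_gradient (f : R3 R -> R) (G : 'I_3 -> R3 R -> R) : Prop :=
  [/\ loc_integrable f, forall i, loc_integrable (G i) &
      forall i psi, test_function psi ->
        \int[mu3]_x (f x * grad psi i x) = - \int[mu3]_x (G i x * psi x)].

Definition W1 (p : R) (f : R3 R -> R) : Prop :=
  f \in Lfun mu3 p%:E /\
  exists2 G, weak_gradient f G & forall i, G i \in Lfun mu3 p%:E.

Definition dot3 (G H : 'I_3 -> R3 R -> R) : R3 R -> R :=
  fun x => \sum_(i < 3) G i x * H i x.

Definition norm3 (G : 'I_3 -> R3 R -> R) : R3 R -> R :=
  fun x => Num.sqrt (dot3 G G x).

Definition D1norm (q : R) (f : R3 R -> R) : \bar R :=
  'N[mu3]_q%:E [EFin \o norm3 (grad f)].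

(* The completion of the test functions for [D1norm], realised inside L^{q*}:
   an element is the L^{q*}-limit of a [D1norm]-Cauchy sequence of test
   functions. *)
Definition D1 (q : R) (f : R3 R -> R) : Prop :=
  f \in Lfun mu3 (sobolev_exp q)%:E /\
  exists g : nat -> R3 R -> R,
    [/\ forall n, test_function (g n),
        forall eps : R, 0 < eps -> exists N : nat, forall m n : nat,
          (N <= m)%N -> (N <= n)%N ->
          (D1norm q (g m \- g n)%R < eps%:E)%E &
        'N[mu3]_(sobolev_exp q)%:E [EFin \o (g n \- f)%R]%E
          @[n --> \oo] --> 0%E].

(* |G|^{q-2} G; it vanishes where G does, whatever the value of 0 `^ (q - 2). *)
Definition qflux (q : R) (G : 'I_3 -> R3 R -> R) : 'I_3 -> R3 R -> R :=
  fun i x => norm3 G x `^ (q - 2) * G i x.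

(* Weak form of - Delta_q f = h, tested against all of D^{1,q}. The real-valued
   integral is a total function, so the integrability that gives both sides
   their meaning is stated explicitly. *)
Definition q_poisson_solution (q : R) (h f : R3 R -> R) : Prop :=
  exists2 G, weak_gradient f G &
    forall w H, D1 q w -> weak_gradient w H ->
      [/\ mu3.-integrable setT (EFin \o dot3 (qflux q G) H),
          mu3.-integrable setT (fun x => (h x * w x)%:E) &
          \int[mu3]_x dot3 (qflux q G) H x = \int[mu3]_x (h x * w x)].

End SobolevSpaces.
Arguments mu3 {R}.

(* Main.v *)
Require Import Defs.
From HB Require Import structures.
From mathcomp Require Import all_boot all_order all_algebra.
From mathcomp Require Import all_classical all_reals all_analysis.
Set Implicit Arguments.
Unset Strict Implicit.
Unset Printing Implicit Defensive.
From mathcomp Require Import measurable_realfun ring lra.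
Import Order.TTheory GRing.Theory Num.Theory.
Import numFieldNormedType.Exports.
Local Open Scope classical_set_scope.
Local Open Scope ring_scope.

(* Existence is by the direct method: phi minimises
   (1/q) \int |grad g|^q - \int h g with h = |u|^s over the closure of the test
   functions. The condition on s puts h in the dual of L^{q*}, because u lies in
   L^t for p <= t < p*; with the Sobolev inequality this makes the functional
   coercive, a uniform convexity estimate for |.|^q makes minimising sequences
   Cauchy, and the minimiser satisfies the weak equation. Uniqueness is the
   strict monotonicity of the flux |G|^{q-2} G.
   Both the embedding of W^{1,p} and the Sobolev inequality come from one
   weak-type estimate: if \int |f(x + h e_i) - f(x)|^p <= K h^p (only needed in
   its Chebyshev form), then averaging over translations by a small cube gives
   mu{|f| >= lam} <= C lam^{-(p + r p / 3)} (\int |f|^r)^{p/3} K. Summing it over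
   dyadic levels raises the integrability exponent of a W^{1,p} function, and
   applying it to smooth truncations of a test function at dyadic heights, whose
   gradients have disjoint supports, gives the Sobolev inequality at the critical
   exponent. *)

(** * Lebesgue measure on R^3 *)

(** A function of W^{1,p} is given only through a weak gradient and is never approximated by smooth
    functions here: the bound on its differences comes by duality, from testing the weak gradient
    against window averages of product test functions. In the weak-type estimate the averaging cube
    needs a volume comparable to that of {|f| >= lam/2}, which the L^r norm controls by lam^{-r}; a
    cube of side eps costs (eps / lam)^p, and this produces the exponent p + r p / 3. The map r -> p
    + r p / 3 has the fixed point p*, so iteration gains integrability up to p* but not at p*. The
    strict upper bound on s asks for no more of u. D^{1,q} does need q* itself, where the dyadic sum
    has no geometric decay left. Minimising sequences consist of test functions, for which the
    Sobolev inequality is available; limits are kept as pairs of a function and its L^q gradient,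
    and uniqueness of weak gradients ties these pairs to the definitions of D^{1,q} and of
    solutions. *)

Section countable_bases.
Context {R : realType}.

(** Open subsets of R^3 have to be shown to lie in the product sigma-algebra, which follows from
    second countability. It is phrased with neighbourhood filters [nb] instead of a topology on [T],
    so that it passes to products. *)
Definition measurable_base d (T : measurableType d) (nb : T -> set_system T) :=
  exists B : nat -> set T, (forall n, measurable (B n)) /\
    forall x V, nb x V -> exists n, B n x /\ B n `<=` V.

Lemma measurable_baseR : @measurable_base _ (measurableTypeR R) (fun x => nbhs (x : R)).
Proof.
pose B n : set R := if (unpickle n : option (rat * rat)) is Some ab then
  `]ratr ab.1, ratr ab.2[%classic else set0.
exists B; split.
  move=> n; rewrite /B; case: unpickle => [ab|]; last exact: measurable0.
  exact: measurable_itv.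
move=> x V /nbhs_ballP[e /= e0 xV].
have [a /andP[a1 a2]] : exists a, (x - e < ratr a < x)%R.
  have [|a] := @rat_in_itvoo R (x - e) x; first by rewrite ltrBlDr ltrDl.
  by rewrite in_itv /=; exists a.
have [b /andP[b1 b2]] : exists a, (x < ratr a < x + e)%R.
  have [|b] := @rat_in_itvoo R x (x + e); first by rewrite ltrDl.
  by rewrite in_itv /=; exists b.
exists (pickle (a, b)); rewrite /B pickleK /=; split; first by rewrite /= in_itv /= a2.
move=> y /=; rewrite in_itv /= => /andP[y1 y2]; apply: xV.
rewrite /ball /= ltr_norml; apply/andP; split; lra.
Qed.

Lemma measurable_base_prod d1 d2 (T1 : measurableType d1) (T2 : measurableType d2) nb1 nb2 :
  @measurable_base d1 T1 nb1 -> @measurable_base d2 T2 nb2 ->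
  measurable_base (fun x : T1 * T2 => filter_prod (nb1 x.1) (nb2 x.2)).
Proof.
move=> [B [mB hB]] [C [mC hC]].
exists (fun n => if (unpickle n : option (nat * nat)) is Some ij then
  B ij.1 `*` C ij.2 else set0); split.
  move=> n; case: unpickle => [ij|]; last exact: measurable0.
  exact: measurableX.
move=> [x y] V [[V1 V2] /= [xV1 yV2] V12].
have [i [Bx BV]] := hB _ _ xV1; have [j [Cy CV]] := hC _ _ yV2.
exists (pickle (i, j)); rewrite pickleK /=; split=> //.
by move=> [x' y'] [/= /BV ? /CV ?]; apply: V12.
Qed.

Lemma measurable_base_open d (T : measurableType d) nb : @measurable_base d T nb ->
  forall U : set T, (forall x, U x -> nb x U) -> measurable U.
Proof.
move=> [B [mB hB]] U oU.
have -> : U = \bigcup_n (if `[< B n `<=` U >] then B n else set0).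
  apply/seteqP; split=> x.
    by move=> Ux; have [n [Bx BU]] := hB _ _ (oU _ Ux); exists n => //; case: asboolP.
  by move=> [n _]; case: asboolP => // BU /BU.
apply: bigcupT_measurable => n; case: ifP => // _; exact: measurable0.
Qed.

Lemma open3_measurable (U : set (R3 R)) : open U -> measurable U.
Proof.
move=> oU; apply: (measurable_base_open (measurable_base_prod
  (measurable_base_prod measurable_baseR measurable_baseR) measurable_baseR)).
by move=> x Ux; move: oU; rewrite openE => /(_ _ Ux).
Qed.

Lemma continuous3_measurable (f : R3 R -> R) : continuous f -> measurable_fun setT f.
Proof.
move=> /continuousP cf.
apply: (measurability _ (RGenOpens.measurableE R)).
move=> _ [_ [a [b ->] <-]]; rewrite setTI; apply: open3_measurable; apply: cf.
exact: interval_open.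
Qed.

Lemma compact3_measurable (K : set (R3 R)) : compact K -> measurable K.
Proof.
move=> cK; rewrite -(setCK K); apply: measurableC; apply: open3_measurable.
by apply: closed_openC; apply: compact_closed.
Qed.

Definition box (M : R) : set (R3 R) :=
  (`[-M, M]%classic `*` `[-M, M]%classic) `*` `[-M, M]%classic.

Lemma measurable_box M : measurable (box M).
Proof. by apply: measurableX; [apply: measurableX|]; exact: measurable_itv. Qed.

Lemma mu3_rect (A B C : set (measurableTypeR R)) : measurable A -> measurable B -> measurable C ->
  mu3 ((A `*` B) `*` C) =
  (lebesgue_measure A * lebesgue_measure B * lebesgue_measure C)%E.
Proof.
move=> mA mB mC; rewrite /mu3 /= product_measure1E//; last exact: measurableX.
by rewrite /= product_measure1E.
Qed.

Lemma mu3_box_lty M : (mu3 (box M) < +oo)%E.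
Proof.
rewrite mu3_rect; [|exact: measurable_itv..].
by rewrite /= !lebesgue_measure_itv /=; case: ifP => _; rewrite ?mule0// -!EFinB -!EFinM ltry.
Qed.

Lemma compact_subset_box (K : set (R3 R)) : compact K -> exists2 M, 0 <= M & K `<=` box M.
Proof.
move=> /compact_bounded[M [Mr KM]].
exists (`|M| + 1); first by rewrite addr_ge0.
move=> [[x y] z] /(KM (`|M| + 1)) => /(_ (le_lt_trans (ler_norm M) _)).
rewrite ltrDl => /(_ ltr01).
rewrite /= !prod_normE /= !ge_max => /andP[/andP[]].
rewrite !ler_norml => hx hy hz; split=> /=; [split=> /=|]; by rewrite in_itv.
Qed.

End countable_bases.

Lemma itv_cover {R : realType} (x y z : R) : exists n : nat,
  [/\ x \in `[- n%:R, n%:R], y \in `[- n%:R, n%:R] & z \in `[- n%:R, n%:R]].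
Proof.
pose m := `|x| + `|y| + `|z|; exists (Num.truncn m).+1.
have hm : m < (Num.truncn m).+1%:R by exact: truncnS_gt.
have := normr_ge0 x; have := normr_ge0 y; have := normr_ge0 z.
by rewrite !in_itv /= -!ler_norml; split; rewrite /m in hm; lra.
Qed.

(** A name for the plane measure to which sigma-finiteness can be attached, as uniqueness of product
    measures requires. [mu3s] does the same for [mu3], for the sake of Tonelli's theorem. *)
Definition leb2 {R : realType} : set (measurableTypeR R * measurableTypeR R) -> \bar R :=
  (lebesgue_measure \x lebesgue_measure)%E.

HB.instance Definition _ (R : realType) := Measure.on (@leb2 R).

Lemma leb2_sigma_finite (R : realType) : sigma_finite setT (@leb2 R).
Proof.
exists (fun n => `[- n%:R, n%:R]%classic `*` `[- n%:R, n%:R]%classic).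
  apply/esym/seteqP; split=> // -[x y] _.
  by have [n [? ? _]] := itv_cover x y 0; exists n.
move=> n; split; first by apply: measurableX; exact: measurable_itv.
rewrite /leb2 product_measure1E; [|exact: measurable_itv..].
by rewrite /= !lebesgue_measure_itv /=; case: ifP => _; rewrite ?mule0// -!EFinB -!EFinM ltry.
Qed.

HB.instance Definition _ (R : realType) :=
  @Measure_isSigmaFinite.Build _ _ _ (@leb2 R) (@leb2_sigma_finite R).

Definition mu3s {R : realType} : set (R3 R) -> \bar R := mu3.

HB.instance Definition _ (R : realType) := Measure.on (@mu3s R).

Lemma mu3_sigma_finite (R : realType) : sigma_finite setT (@mu3s R).
Proof.
exists (fun n => box n%:R).
  apply/esym/seteqP; split=> // -[[x y] z] _.
  by have [n [? ? ?]] := itv_cover x y z; exists n.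
by move=> n; split; [exact: measurable_box|exact: mu3_box_lty].
Qed.

HB.instance Definition _ (R : realType) :=
  @Measure_isSigmaFinite.Build _ _ _ (@mu3s R) (@mu3_sigma_finite R).

(** * Translation invariance of the measure and of integrals *)

Section translation.
Context {R : realType}.
Implicit Type a : R.

Lemma pushforward_measure d1 d2 (T1 : measurableType d1) (T2 : measurableType d2)
    (m : {measure set T1 -> \bar R}) (f : T1 -> T2) : measurable_fun setT f ->
  exists m' : {measure set T2 -> \bar R}, forall X, m' X = m (f @^-1` X).
Proof.
move=> mf.
have mu := (@measure_function_pushforward__canonical__measure_function_Measure _ _ _ _ R m f mf).
by unshelve eexists (pushforward m f : {measure set T2 -> \bar R}).
Qed.

Lemma measurable_shift1 a :
  measurable_fun setT (fun x : measurableTypeR R => (x + a : measurableTypeR R)).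
Proof. by apply: measurable_funD => //; exact: measurable_cst. Qed.

Lemma lebesgue_measure_shift a (A : set (measurableTypeR R)) : measurable A ->
  lebesgue_measure ((fun x : measurableTypeR R => (x + a : measurableTypeR R)) @^-1` A)
  = lebesgue_measure A.
Proof.
move=> mA; apply/esym.
have mS := measurable_shift1 a.
rewrite (@lebesgue_measure_unique R (pushforward lebesgue_measure (fun x : measurableTypeR R => (x + a : measurableTypeR R)))) //.
move=> _ [[b c]] _ <- /=; rewrite /pushforward.
have -> : (fun x => x + a) @^-1` `]b, c] = `]b - a, c - a]%classic.
  by apply/seteqP; split=> x /=; rewrite !in_itv /=; lra.
rewrite !lebesgue_measure_itv /= !lte_fin ltrD2r; case: ifPn => // _.
by rewrite -!EFinB; congr EFin; lra.
Qed.

Definition shift3 (v x : R3 R) : R3 R := x + v.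

Lemma shift3E (v : R3 R) :
  shift3 v = (fun x : R3 R => ((x.1.1 + v.1.1, x.1.2 + v.1.2), x.2 + v.2) : R3 R).
Proof. by apply/funext => -[[x y] z]; case: v => [[]]. Qed.

Lemma measurable_fun3 d (T : measurableType d) (f g h : T -> R) :
  measurable_fun setT f -> measurable_fun setT g -> measurable_fun setT h ->
  measurable_fun setT (fun x => ((f x, g x), h x) : R3 R).
Proof. by move=> mf mg mh; apply: measurable_fun_pair => //; apply: measurable_fun_pair. Qed.

Lemma measurable_coord1 : measurable_fun setT (fun x : R3 R => x.1.1 : R).
Proof. exact: (measurableT_comp measurable_fst measurable_fst). Qed.

Lemma measurable_coord2 : measurable_fun setT (fun x : R3 R => x.1.2 : R).
Proof. exact: (measurableT_comp measurable_snd measurable_fst). Qed.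

Lemma measurable_coord3 : measurable_fun setT (fun x : R3 R => x.2 : R).
Proof. exact: measurable_snd. Qed.

Lemma measurable_add3 d (T : measurableType d) (f g : T -> R3 R) :
  measurable_fun setT f -> measurable_fun setT g ->
  measurable_fun setT (fun x => f x + g x : R3 R).
Proof.
move=> mf mg.
rewrite (_ : (fun x => _) = (fun x => (((f x).1.1 + (g x).1.1, (f x).1.2 + (g x).1.2),
  (f x).2 + (g x).2) : R3 R)); last first.
  by apply/funext => x; case: (f x) => [[]]; case: (g x) => [[]].
apply: measurable_fun3; apply: measurable_funD.
- exact: measurableT_comp measurable_coord1 mf.
- exact: measurableT_comp measurable_coord1 mg.
- exact: measurableT_comp measurable_coord2 mf.
- exact: measurableT_comp measurable_coord2 mg.
- exact: measurableT_comp measurable_coord3 mf.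
- exact: measurableT_comp measurable_coord3 mg.
Qed.

Lemma measurable_shift3 v : measurable_fun setT (shift3 v).
Proof. by apply: measurable_add3; [exact: measurable_id|exact: measurable_cst]. Qed.

(** The shifted and the original measure agree on rectangles. Uniqueness of product measures is
    applied twice: on the plane ([h2]), then with the third coordinate. *)
Lemma mu3_shift (v : R3 R) (A : set (R3 R)) : measurable A ->
  mu3 (shift3 v @^-1` A) = mu3 A.
Proof.
move=> mA; apply/esym.
have mv := measurable_shift3 v.
have m2 : measurable_fun setT (fun x : measurableTypeR R * measurableTypeR R => (x.1 + v.1.1, x.2 + v.1.2) : measurableTypeR R * measurableTypeR R).
  by apply: measurable_fun_pair; apply: measurable_funD.
have h2 : forall X : set (measurableTypeR R * measurableTypeR R), measurable X ->
    (lebesgue_measure \x lebesgue_measure)%E ((fun x => (x.1 + v.1.1, x.2 + v.1.2)) @^-1` X) =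
    (lebesgue_measure \x lebesgue_measure)%E X.
  move=> X mX; apply/esym.
  rewrite (@product_measure_unique _ _ _ _ _ _ _ (pushforward (lebesgue_measure \x lebesgue_measure)%E (fun x : measurableTypeR R * measurableTypeR R => (x.1 + v.1.1, x.2 + v.1.2) : measurableTypeR R * measurableTypeR R))) //.
  move=> B C mB mC; rewrite /pushforward.
  transitivity ((lebesgue_measure \x lebesgue_measure)%E
    (((fun x : measurableTypeR R => x + v.1.1 : measurableTypeR R) @^-1` B) `*`
     ((fun x : measurableTypeR R => x + v.1.2 : measurableTypeR R) @^-1` C))) => //.
  rewrite product_measure1E.
  - by congr (_ * _)%E; exact: lebesgue_measure_shift.
  - rewrite -[X in measurable X]setTI; exact: measurable_shift1.
  - rewrite -[X in measurable X]setTI; exact: measurable_shift1.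
have [m' m'E] := pushforward_measure mu3 mv.
suff H (B : set (measurableTypeR R * measurableTypeR R)) (C : set (measurableTypeR R)) :
    measurable B -> measurable C -> m' (B `*` C) =
    ((lebesgue_measure \x lebesgue_measure) B * lebesgue_measure C)%E.
  rewrite -m'E.
  exact: (@product_measure_unique _ _ _ _ R (@leb2 R) lebesgue_measure m' H A mA).
move=> mB mC; rewrite m'E shift3E.
transitivity (mu3 (((fun x => (x.1 + v.1.1, x.2 + v.1.2)) @^-1` B) `*`
     ((fun x : measurableTypeR R => x + v.2 : measurableTypeR R) @^-1` C))) => //.
rewrite /mu3 /= product_measure1E.
- by congr (_ * _)%E; [exact: h2|exact: lebesgue_measure_shift].
- rewrite -[X in measurable X]setTI; exact: m2.
- rewrite -[X in measurable X]setTI; exact: measurable_shift1.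
Qed.

Lemma ge0_integral_shift3 (v : R3 R) (f : R3 R -> \bar R) :
  measurable_fun setT f -> (forall x, (0 <= f x)%E) ->
  (\int[mu3]_x f (shift3 v x) = \int[mu3]_x f x)%E.
Proof.
move=> mf f0; have mv := measurable_shift3 v.
have := @ge0_integral_pushforward _ _ _ _ _ (shift3 v) mv mu3 setT f measurableT mf (fun x _ => f0 x).
rewrite preimage_setT => <-.
by apply: eq_measure_integral => A mA _; exact: mu3_shift.
Qed.

Lemma integrable_shift3 (v : R3 R) (f : R3 R -> \bar R) :
  mu3.-integrable setT f -> mu3.-integrable setT (f \o shift3 v).
Proof.
move=> /integrableP[mf fi]; apply/integrableP; split.
  exact: (measurableT_comp mf (measurable_shift3 v)).
rewrite /= (ge0_integral_shift3 v (f := fun x => `|f x|%E)) //.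
exact: measurableT_comp.
Qed.

Lemma Rintegral_shift3 (v : R3 R) (f : R3 R -> R) :
  mu3.-integrable setT (EFin \o f) ->
  \int[mu3]_x f (shift3 v x) = \int[mu3]_x f x.
Proof.
move=> fi; have mv := measurable_shift3 v; rewrite /Rintegral; congr fine.
have /integrableP[mf _] := fi.
have fs := integrable_shift3 v fi.
have := @integral_pushforward _ _ _ _ _ (shift3 v) mv mu3 setT (EFin \o f) mf.
rewrite preimage_setT => /(_ fs measurableT) <-.
by apply: eq_measure_integral => A mA _; exact: mu3_shift.
Qed.

Lemma tonelli3 d (T : measurableType d) (m : {sigma_finite_measure set T -> \bar R})
    (f : R3 R * T -> \bar R) : measurable_fun setT f -> (forall z, (0 <= f z)%E) ->
  (\int[mu3]_x \int[m]_t f (x, t) = \int[m]_t \int[mu3]_x f (x, t))%E.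
Proof. by move=> mf f0; exact: (@fubini_tonelli _ _ _ _ R (@mu3s R) m f mf f0). Qed.

End translation.

(** * Smooth functions and test functions *)

Section smoothness.
Context {R : realType} (V : normedModType R) (I : Type) (e : I -> V).
Implicit Types f g : V -> R.

(** The definition of [Ck] for an arbitrary family of directions, so that functions of one variable
    and functions on R^3 share the same sum and product rules. *)
Fixpoint smoothk k f : Prop :=
  match k with
  | 0%N => continuous f
  | k'.+1 => continuous f /\
      forall i, (forall x, derivable f x (e i)) /\ smoothk k' (fun x => 'D_(e i) f x)
  end.

Lemma smoothk_continuous k f : smoothk k f -> continuous f.
Proof. by case: k => [|k] //= []. Qed.

Lemma smoothkS k f : smoothk k.+1 f -> smoothk k f.
Proof.
elim: k f => [f []//|k IH f [cf h]]; split=> // i.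
by have [df sf] := h i; split=> //; exact: IH.
Qed.

Lemma smoothk_cst k c : smoothk k (cst c).
Proof.
elim: k c => [c|k IH c]; first exact: cst_continuous.
split; first exact: cst_continuous.
move=> i; split=> [x|]; first exact: derivable_cst.
rewrite (_ : (fun x => _) = cst 0); first exact: IH.
by apply/funext => x; rewrite derive_cst.
Qed.

Lemma smoothkD k f g : smoothk k f -> smoothk k g -> smoothk k (fun x => f x + g x).
Proof.
elim: k f g => [f g cf cg x|k IH f g [cf hf] [cg hg]].
  by apply: continuousD; [exact: cf|exact: cg].
split=> [x|i]; first by apply: continuousD; [exact: cf|exact: cg].
have [df sf] := hf i; have [dg sg] := hg i; split=> [x|].
  exact: (@derivableD _ _ _ f g).
rewrite (_ : (fun x => _) = (fun x => 'D_(e i) f x + 'D_(e i) g x)); first exact: IH.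
by apply/funext => x; rewrite (@deriveD _ _ _ f g).
Qed.

Lemma smoothkM k f g : smoothk k f -> smoothk k g -> smoothk k (fun x => f x * g x).
Proof.
elim: k f g => [f g cf cg x|k IH f g sf0 sg0].
  by apply: continuousM; [exact: cf|exact: cg].
have [cf hf] := sf0; have [cg hg] := sg0.
split=> [x|i]; first by apply: continuousM; [exact: cf|exact: cg].
have [df sf] := hf i; have [dg sg] := hg i; split=> [x|].
  exact: (@derivableM _ _ f g).
rewrite (_ : (fun x => _) = (fun x => f x * 'D_(e i) g x + g x * 'D_(e i) f x)).
  by apply: smoothkD; apply: IH => //; exact: smoothkS.
by apply/funext => x; rewrite (@deriveM _ _ f g).
Qed.

Lemma smoothkZ k c f : smoothk k f -> smoothk k (fun x => c * f x).
Proof. by move=> sf; apply: smoothkM => //; exact: smoothk_cst. Qed.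

End smoothness.

(** * Directional derivatives as derivatives along lines *)

Section lines.
Context {R : realType} (V : normedModType R).

Let growth_line (f : V -> R) (x v : V) (t : R) :
  (fun h => h^-1 *: (f (h *: v + (x + t *: v)) - f (x + t *: v))) =
  (fun h : R => h^-1 *: (f (x + (h *: 1 + t) *: v) - f (x + t *: v))).
Proof.
apply/funext => h; congr (_ *: (f _ - _)).
by rewrite scalerDl [h *: 1]mulr1 addrCA.
Qed.

Lemma derivable_line (f : V -> R) (x v : V) (t : R) :
  derivable f (x + t *: v) v <-> derivable (fun s : R => f (x + s *: v)) t 1.
Proof. by rewrite /derivable growth_line. Qed.

Lemma derive_line (f : V -> R) (x v : V) (t : R) :
  'D_v f (x + t *: v) = 'D_1 (fun s : R => f (x + s *: v)) t.
Proof. by rewrite /derive growth_line. Qed.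

Lemma is_derive_line (f : V -> R) (x v : V) (t : R) : derivable f (x + t *: v) v ->
  is_derive t 1 (fun s : R => f (x + s *: v)) ('D_v f (x + t *: v)).
Proof. by move=> df; apply: DeriveDef; [exact/derivable_line|rewrite -derive_line]. Qed.

Lemma is_derive_line0 (f : V -> R) (x v : V) (l : R) :
  is_derive (0 : R) 1 (fun s : R => f (x + s *: v)) l -> is_derive x v f l.
Proof.
move=> [dl <-]; have := derivable_line f x v 0; rewrite scale0r addr0 => -[_ h].
by apply: DeriveDef; [exact: h|rewrite -derive_line scale0r addr0].
Qed.

End lines.

(** * Smooth bump functions of one variable *)

Section flat.
Context {R : realType}.

Definition smooth1 (f : R -> R) := forall k, smoothk (fun _ : unit => (1 : R)) k f.

(** The derivative of x^{-n} e^{-1/x} is a combination of functions of the same family. Treating all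
    [n] together turns smoothness into a plain induction on the order of differentiation. *)
Definition flat n (x : R) : R := if 0 < x then x^-1 ^+ n * expR (- x^-1) else 0.

Lemma flat_ge0 n x : 0 <= flat n x.
Proof.
by rewrite /flat; case: ifP => // x0; rewrite mulr_ge0 ?expR_ge0 ?exprn_ge0 ?invr_ge0 ?ltW.
Qed.

(** A quadratic bound at 0 suffices for the derivative there to exist and vanish. It comes from
    e^{1/x} = (e^{1/((n+2)x)})^{n+2} >= ((n+2)x)^{-(n+2)}. *)
Lemma flat_le n x : flat n x <= n.+2%:R ^+ n.+2 * x ^+ 2.
Proof.
rewrite /flat; case: ifPn => [x0|_]; last by rewrite mulr_ge0 ?sqr_ge0 ?exprn_ge0.
have h : expR (- x^-1) <= (n.+2%:R * x) ^+ n.+2.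
  have nx : 0 < n.+2%:R * x by rewrite mulr_gt0.
  rewrite expRN -[leRHS]invrK lef_pV2 ?posrE ?expR_gt0 ?invr_gt0 ?exprn_gt0 //.
  have -> : x^-1 = n.+2%:R * (n.+2%:R * x)^-1 by rewrite invfM mulrA mulfV ?mul1r // pnatr_eq0.
  rewrite expRM_natl -exprVn lerXn2r ?nnegrE ?expR_ge0 ?invr_ge0 ?ltW //.
  by apply: lt_le_trans (expR_ge1Dx _); rewrite ltrDr.
apply: le_trans (ler_wpM2l _ h) _; first by rewrite exprn_ge0 // invr_ge0 ltW.
rewrite exprMn mulrCA ler_wpM2l ?exprn_ge0 //.
by rewrite -addn2 exprD mulrA -exprMn mulVf ?gt_eqF // expr1n mul1r.
Qed.

Lemma is_derive0_quad (f : R -> R) C : (forall h, `|f h| <= C * h ^+ 2) ->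
  is_derive (0 : R) 1 f 0.
Proof.
move=> fC.
have f0 : f 0 = 0.
  by apply/eqP; rewrite -normr_le0; have := fC 0; rewrite expr0n /= mulr0.
have C0 : 0 <= C by have := fC 1; rewrite expr1n mulr1; apply: le_trans.
have H : (fun h => h^-1 *: ((f \o shift 0) (h *: 1) - f 0)) @ (0:R)^' --> (0:R).
  apply/cvgr0Pnorm_le => eps eps0; near=> h.
  have h0 : h != 0 by near: h; exact: nbhs_dnbhs_neq.
  rewrite /= f0 subr0 addr0 [h *: 1]mulr1 normrZ.
  apply: (@le_trans _ _ (`|h^-1| * (C * h ^+ 2))); first by rewrite ler_wpM2l.
  rewrite -real_normK ?num_real // normfV mulrCA expr2 mulKf ?normr_eq0 //.
  have : `|h| <= eps / (C + 1).
    near: h; apply: dnbhs0_le; rewrite divr_gt0 //; lra.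
  rewrite ler_pdivlMr; last lra.
  have := normr_ge0 h; nra.
by apply: DeriveDef; [exact: (cvgP _ H)|exact: (cvg_lim _ H)].
Unshelve. all: by end_near. Qed.

Lemma is_derive_flat n (x : R) :
  is_derive x 1 (flat n) (flat n.+2 x - n%:R * flat n.+1 x).
Proof.
have [x0|x0|->] := ltgtP x 0.
- rewrite /flat !ltNge (ltW x0) /= mulr0 subr0.
  apply: (@near_eq_is_derive _ _ _ (cst 0)).
  near=> y; rewrite /flat ltNge; suff -> : y <= 0 by [].
  by apply: ltW; near: y; exact: lt_nbhsl.
- rewrite [flat n.+2 x]/flat [flat n.+1 x]/flat x0.
  have xn0 : x != 0 by rewrite gt_eqF.
  have dV : is_derive x 1 (fun y : R => y^-1) (- x ^- 2 *: 1) := is_deriveV xn0 (is_derive_id x 1).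
  have dX := is_deriveX n dV.
  have dE := @is_derive1_comp _ expR (- (fun y : R => y^-1)) x _ _ (is_derive_expR _) (is_deriveN dV).
  have dM := is_deriveM dX dE.
  apply: (@near_eq_is_derive _ R R (fun y : R => y^-1 ^+ n * expR (- y^-1))).
    near=> y; rewrite /flat; suff -> : 0 < y by [].
    by near: y; exact: lt_nbhsr.
  rewrite (_ : (fun y => _) = ((fun y : R => y^-1) ^+ n) * (expR \o (- (fun y : R => y^-1)))); last first.
    by apply/funext => y; rewrite /= -[RHS]/((_ ^+ n) y * _) exprfctE.
  apply: is_derive_eq; rewrite !exprfctE /= ![_ *: 1]mulr1 -exprVn.
  rewrite /GRing.scale /= -[(- _) x]/(- x^-1).
  by set y := x^-1; set E := expR _; case: n {dX dM} => [|n] /=; rewrite ?exprS; ring.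
- have f0 k : flat k 0 = 0 by rewrite /flat ltxx.
  rewrite !f0 mulr0 subr0; apply: (@is_derive0_quad _ (n.+2%:R ^+ n.+2)) => h.
  by rewrite ger0_norm ?flat_ge0 // flat_le.
Unshelve. all: by end_near. Qed.

Lemma smooth1_flat n : smooth1 (flat n).
Proof.
move=> k; have cf m : continuous (flat m).
  by move=> x; apply: differentiable_continuous; apply/derivable1_diffP; have [] := is_derive_flat m x.
elim: k n => [|k IH] n; first exact: cf.
split=> [|_]; first exact: cf.
split=> [x|]; first by have [] := is_derive_flat n x.
rewrite (_ : (fun x => _) = (fun x => flat n.+2 x + (- n%:R) * flat n.+1 x)).
  by apply: smoothkD => //; exact: smoothkZ.
by apply/funext => x; rewrite mulNr; have [_ ->] := is_derive_flat n x.
Qed.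

Lemma smooth1_affine (f : R -> R) (m c : R) : smooth1 f -> smooth1 (fun x => f (m * x + c)).
Proof.
move=> sf k; move: f {sf}(sf k).
have ca (f : R -> R) : continuous f -> continuous (fun x => f (m * x + c)).
  move=> cf x; apply: (@continuous_comp _ _ _ (fun x => m * x + c) f); last exact: cf.
  apply: continuousD; last exact: cst_continuous.
  by apply: continuousM; [exact: cst_continuous|].
elim: k => [|k IH] f; first exact: ca.
move=> [/ca cf /(_ tt)[df sf]]; split=> // _.
have dfa (x : R) : is_derive x 1 (fun x : R => f (m * x + c)) ('D_1 f (m * x + c) * m).
  apply: (@is_derive1_comp _ f (fun x => m * x + c)); first exact: derivableP.
  rewrite (_ : (fun x => _) = (m *: (id : R -> R)) + cst c) //.
  refine (is_derive_eq (is_deriveD (is_deriveZ m (is_derive_id x 1)) (is_derive_cst c x 1)) _).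
  by rewrite /GRing.scale /= mulr1 addr0.
split=> [x|]; first by have [] := dfa x.
rewrite (_ : (fun x => _) = (fun x => m * 'D_1 f (m * x + c))).
  by apply: smoothkZ; exact: (IH _ sf).
by apply/funext => x; have [_ ->] := dfa x; rewrite mulrC.
Qed.

(** For y > 0 the value [flat 0 (m * y)] is e^{-1/(m y)}, which increases to 1 with m: plateaus
    approximate the indicator of an open interval from below. *)
Definition plateau (a b m : R) (x : R) := flat 0 (m * (x - a)) * flat 0 (m * (b - x)).

Lemma smooth1_plateau a b m : smooth1 (plateau a b m).
Proof.
move=> k; apply: smoothkM.
  rewrite (_ : (fun x => _) = (fun x => flat 0 (m * x + (- m * a)))); last first.
    by apply/funext => x; congr flat; ring.
  exact: smooth1_affine (smooth1_flat 0) k.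
rewrite (_ : (fun x => _) = (fun x => flat 0 ((- m) * x + (m * b)))); last first.
  by apply/funext => x; congr flat; ring.
exact: smooth1_affine (smooth1_flat 0) k.
Qed.

Lemma flat0_le1 x : flat 0 x <= 1.
Proof.
rewrite /flat; case: ifP => // x0; rewrite expr0 mul1r expR_le1 oppr_le0 invr_ge0.
exact: ltW.
Qed.

Lemma plateau_ge0 a b m x : 0 <= plateau a b m x.
Proof. by rewrite mulr_ge0 ?flat_ge0. Qed.

Lemma plateau_le1 a b m x : plateau a b m x <= 1.
Proof. by rewrite mulr_ile1 ?flat_ge0 ?flat0_le1. Qed.

Lemma plateau_out a b m x : 0 < m -> x \notin `]a, b[ -> plateau a b m x = 0.
Proof.
move=> m0; rewrite in_itv /= negb_and -!leNgt /plateau /flat => /orP[h|h].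
  by rewrite ltNge pmulr_rle0 // subr_le0 h /= mul0r.
by rewrite [X in _ * X]ifF ?mulr0 //; apply/negbTE; rewrite -leNgt pmulr_rle0 // subr_le0.
Qed.

Lemma plateau_cvg a b x :
  plateau a b n.+1%:R x @[n --> \oo] --> (\1_(`]a, b[%classic) x : R).
Proof.
rewrite indicE; have [xab|xab] := boolP (x \in _); last first.
  rewrite (_ : (fun n => _) = cst 0); first exact: cvg_cst.
  apply/funext => n; rewrite plateau_out //; apply/negP => h; move/negP: xab; apply.
  by rewrite inE.
have flat1 y : 0 < y -> flat 0 (n.+1%:R * y) @[n --> \oo] --> (1:R).
  move=> y0; rewrite (_ : (fun n => _) = (fun n : nat => expR (- (y^-1 * n.+1%:R^-1)))); last first.
    by apply/funext => n; rewrite /flat mulr_gt0 // expr0 mul1r invfM mulrC.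
  rewrite -[X in _ --> X]expR0; apply: continuous_cvg; first exact: continuous_expR.
  rewrite -[X in _ --> X]oppr0; apply: cvgN; rewrite -[X in _ --> X](mulr0 y^-1); apply: cvgM; first exact: cvg_cst.
  exact: cvg_harmonic.
move: xab; rewrite inE /= in_itv /= => /andP[ax xb].
rewrite -[1%:R](mulr1 (1:R)); apply: cvgM; apply: flat1; lra.
Qed.

End flat.

(** * Product test functions *)

Section tensors.
Context {R : realType}.

Definition tensor (a b c : R -> R) : R3 R -> R := fun x => a x.1.1 * b x.1.2 * c x.2.

Lemma is_derive_tensor (a b c : R -> R) (x : R3 R) i :
  smooth1 a -> smooth1 b -> smooth1 c ->
  is_derive x (basis3 R i) (tensor a b c)
    (tensor (if i == 0%N :> nat then 'D_1 a else a) (if i == 1%N :> nat then 'D_1 b else b)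
      (if i == 2%N :> nat then 'D_1 c else c) x).
Proof.
move=> sa sb sc; apply: is_derive_line0.
have dl (f : R -> R) y : smooth1 f ->
    is_derive (0 : R) 1 (fun s : R => f (y + s * 1)) ('D_1 f y).
  move=> sf; have [_ /(_ tt)[df _]] := sf 1%N.
  have := @is_derive_line R R f y 1 0; rewrite scale0r addr0; apply; exact: df.
case: x => [[x y] z]; case: i => [[|[|[|//]]]] hi; rewrite /= /tensor /=.
- rewrite (_ : (fun s => _) = (fun s => (b y * c z) * a (x + s * 1))); last first.
    by apply/funext => s; rewrite !scaler0 !addr0 -[s *: 1]/(s * 1); ring.
  have h := dl a x sa; refine (is_derive_eq (is_deriveZ _ h) _).
  by rewrite /GRing.scale /=; ring.
- rewrite (_ : (fun s => _) = (fun s => (a x * c z) * b (y + s * 1))); last first.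
    by apply/funext => s; rewrite !scaler0 !addr0 -[s *: 1]/(s * 1); ring.
  have h := dl b y sb; refine (is_derive_eq (is_deriveZ _ h) _).
  by rewrite /GRing.scale /=; ring.
- rewrite (_ : (fun s => _) = (fun s => (a x * b y) * c (z + s * 1))); last first.
    by apply/funext => s; rewrite !scaler0 !addr0 -[s *: 1]/(s * 1); ring.
  have h := dl c z sc; refine (is_derive_eq (is_deriveZ _ h) _).
  by rewrite /GRing.scale /=; ring.
Qed.

Lemma smooth1D (f : R -> R) : smooth1 f -> smooth1 ('D_1 f).
Proof. by move=> sf k; have [_ /(_ tt)[]] := sf k.+1. Qed.

Lemma continuous_tensor (a b c : R -> R) :
  continuous a -> continuous b -> continuous c -> continuous (tensor a b c).
Proof.
move=> ca cb cc x; rewrite /tensor.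
have c1 : {for x, continuous (fun x : R3 R => x.1.1)}.
  apply: (@continuous_comp _ _ _ (fun x : R3 R => x.1) fst); [exact: cvg_fst|exact: cvg_fst].
have c2 : {for x, continuous (fun x : R3 R => x.1.2)}.
  apply: (@continuous_comp _ _ _ (fun x : R3 R => x.1) snd); [exact: cvg_fst|exact: cvg_snd].
have c3 : {for x, continuous (fun x : R3 R => x.2)} by exact: cvg_snd.
apply: cvgM; first apply: cvgM.
- by apply: (@continuous_comp _ _ _ (fun x : R3 R => x.1.1) a); [exact: c1|exact: ca].
- by apply: (@continuous_comp _ _ _ (fun x : R3 R => x.1.2) b); [exact: c2|exact: cb].
- by apply: (@continuous_comp _ _ _ (fun x : R3 R => x.2) c); [exact: c3|exact: cc].
Qed.

Lemma Ck_tensor k (a b c : R -> R) :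
  smooth1 a -> smooth1 b -> smooth1 c -> Ck k (tensor a b c).
Proof.
elim: k a b c => [|k IH] a b c sa sb sc.
  by apply: continuous_tensor; [exact: (sa 0%N)|exact: (sb 0%N)|exact: (sc 0%N)].
split; first by apply: continuous_tensor; [exact: (sa 0%N)|exact: (sb 0%N)|exact: (sc 0%N)].
move=> i; split=> [x|]; first by have [] := is_derive_tensor x i sa sb sc.
rewrite (_ : grad _ i = tensor (if i == 0%N :> nat then 'D_1 a else a)
  (if i == 1%N :> nat then 'D_1 b else b) (if i == 2%N :> nat then 'D_1 c else c)).
  by apply: IH; case: ifP => _ //; exact: smooth1D.
by apply/funext => x; have [_] := is_derive_tensor x i sa sb sc.
Qed.

Lemma compact_box (M : R) : compact (box M : set (R3 R)).
Proof.
apply: compact_setX; last exact: segment_compact.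
by apply: compact_setX; exact: segment_compact.
Qed.

Lemma closed_box (M : R) : closed (box M : set (R3 R)).
Proof. by apply: compact_closed => //; exact: compact_box. Qed.

Lemma compact_support (f : R3 R -> R) M : (forall x, f x != 0 -> box M x) ->
  compact (closure [set x | f x != 0]).
Proof.
move=> fM; apply: (subclosed_compact _ (@compact_box M)); first exact: closed_closure.
by rewrite closureE; apply: smallest_sub; [exact: closed_box|exact: fM].
Qed.

Lemma test_tensor (a b c : R -> R) M : smooth1 a -> smooth1 b -> smooth1 c ->
  (forall x, a x != 0 -> `|x| <= M) -> (forall x, b x != 0 -> `|x| <= M) ->
  (forall x, c x != 0 -> `|x| <= M) -> test_function (tensor a b c).
Proof.
move=> sa sb sc hA hB hC; split=> [k|]; first exact: Ck_tensor.
apply: (@compact_support _ M) => -[[x y] z].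
rewrite /tensor /= !mulf_eq0 !negb_or => /andP[/andP[/hA ? /hB ?] /hC ?].
by split=> /=; [split=> /=|]; rewrite in_itv /= -ler_norml.
Qed.

End tensors.

(** * The algebra of test functions *)

Section test_functions.
Context {R : realType}.
Implicit Types f g : R3 R -> R.

Lemma CkE k f : Ck k f = smoothk (basis3 R) k f.
Proof.
by elim: k f => [//|k IH] f /=; congr (_ /\ _); apply: eq_forall => i; rewrite IH.
Qed.

Lemma test_continuous f : test_function f -> continuous f.
Proof. by move=> [/(_ 0%N)]. Qed.

Lemma test_derivable f x i : test_function f -> derivable f x (basis3 R i).
Proof. by move=> [/(_ 1%N)[_ /(_ i)[]]]. Qed.

Lemma test_support f : test_function f -> exists2 M, 0 <= M & forall x, ~ box M x -> f x = 0.
Proof.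
move=> [_ /compact_subset_box[M M0 fM]]; exists M => // x; apply: contra_notP => /eqP fx.
by apply: fM; exact: subset_closure.
Qed.

Lemma test_functionP f : test_function f <->
  (forall k, Ck k f) /\ exists M, forall x, ~ box M x -> f x = 0.
Proof.
split=> [tf|[sf [M fM]]].
  by split; [case: tf|have [M _ ?] := test_support tf; exists M].
split=> //; apply: (@compact_support _ _ M) => x; apply: contraPP => nx.
by rewrite (fM _ nx) eqxx.
Qed.

Lemma boxS (M N : R) : M <= N -> box M `<=` (box N : set (R3 R)).
Proof.
move=> MN [[x y] z] /= [[/=]]; rewrite /box /= !in_itv /= => hx hy hz.
by split=> /=; [split=> /=|]; lra.
Qed.

Lemma test_cst0 : test_function (cst 0 : R3 R -> R).
Proof.
apply/test_functionP; split=> [k|]; first by rewrite CkE; exact: smoothk_cst.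
by exists 0.
Qed.

Lemma testD f g : test_function f -> test_function g -> test_function (fun x => f x + g x).
Proof.
move=> /test_functionP[sf [M fM]] /test_functionP[sg [N gN]]; apply/test_functionP; split=> [k|].
  by rewrite CkE; apply: smoothkD; rewrite -CkE.
exists (Num.max M N) => x nx; rewrite fM ?gN ?addr0 //; apply: contra_not nx; apply: boxS.
  by rewrite le_max lexx orbT.
by rewrite le_max lexx.
Qed.

Lemma testM f g : test_function f -> test_function g -> test_function (fun x => f x * g x).
Proof.
move=> /test_functionP[sf [M fM]] /test_functionP[sg _]; apply/test_functionP; split=> [k|].
  by rewrite CkE; apply: smoothkM; rewrite -CkE.
by exists M => x nx; rewrite fM ?mul0r.
Qed.

Lemma testZ c f : test_function f -> test_function (fun x => c * f x).
Proof.
move=> /test_functionP[sf [M fM]]; apply/test_functionP; split=> [k|].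
  by rewrite CkE; apply: smoothkZ; rewrite -CkE.
by exists M => x nx; rewrite fM ?mulr0.
Qed.

Lemma testB f g : test_function f -> test_function g -> test_function (fun x => f x - g x).
Proof.
move=> tf tg; rewrite (_ : (fun x => _) = (fun x => f x + (-1) * g x)).
  by apply: testD => //; exact: testZ.
by apply/funext => x; rewrite mulN1r.
Qed.

Lemma gradD f g i : test_function f -> test_function g ->
  grad (fun x => f x + g x) i = (fun x => grad f i x + grad g i x).
Proof.
move=> tf tg; apply/funext => x; rewrite /grad (@deriveD _ _ _ f g) //; exact: test_derivable.
Qed.

Lemma gradZ c f i : test_function f -> grad (fun x => c * f x) i = (fun x => c * grad f i x).
Proof.
move=> tf; apply/funext => x; rewrite /grad (@deriveZ _ _ _ f) //; exact: test_derivable.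
Qed.

Lemma gradB f g i : test_function f -> test_function g ->
  grad (fun x => f x - g x) i = (fun x => grad f i x - grad g i x).
Proof.
move=> tf tg; apply/funext => x; rewrite /grad (@deriveB _ _ _ f g) //; exact: test_derivable.
Qed.

Lemma gradM f g i : test_function f -> test_function g ->
  grad (fun x => f x * g x) i = (fun x => f x * grad g i x + g x * grad f i x).
Proof.
move=> tf tg; apply/funext => x; rewrite /grad (@deriveM _ _ f g) //; exact: test_derivable.
Qed.

Lemma test_grad f i : test_function f -> test_function (grad f i).
Proof.
move=> tf; have [M _ fM] := test_support tf; apply/test_functionP; split=> [k|].
  by have [/(_ k.+1)[_ /(_ i)[]]] := tf.
exists M => x nx; rewrite /grad (@near_eq_derive _ _ _ f (cst 0)) ?derive_cst //.
have : nbhs x (~` box M) by apply: open_nbhs_nbhs; split=> //; apply: closed_openC; exact: closed_box.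
by apply: filterS => y /fM.
Qed.

(** The factors by which a locally integrable function may be multiplied: the class contains test
    functions and indicators of rectangles. A single constant bounds both the values and the
    support. *)
Definition bounded_compact f := measurable_fun setT f /\
  exists M, forall x, `|f x| <= M * \1_(box M) x.

Lemma bounded_compact_test f : test_function f -> bounded_compact f.
Proof.
move=> tf; split; first exact: continuous3_measurable (test_continuous tf).
have [M M0 fM] := test_support tf.
have [N [Nr hN]] : bounded_set (f @` box M).
  apply: compact_bounded; apply: continuous_compact; last exact: compact_box.
  by apply: continuous_subspaceT; exact: test_continuous.
exists (Num.max M (`|N| + 1)) => x.
have [bx|nbx] := pselect (box M x).
  rewrite indicE mem_set ?mulr1; last by apply: boxS bx; rewrite le_max lexx.
  rewrite le_max; apply/orP; right; apply: hN; last by exists x.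
  by rewrite (le_lt_trans (ler_norm _)) // ltrDl.
by rewrite fM // normr0 mulr_ge0 // le_max M0.
Qed.

End test_functions.

(** * Weak gradients *)

Section tonelli_on_sets.
Context {R : realType}.
Local Notation leb := (@lebesgue_measure R).
Context (D : set (measurableTypeR R)) (mD : measurable D).

(** Moving the set into the integrand reduces Tonelli on a subset to the version on the whole
    line. *)
Let integral_cut (F : measurableTypeR R -> \bar R) :
  (\int[leb]_(t in D) F t = \int[leb]_t (F t * (\1_D t)%:E))%E.
Proof.
rewrite integral_mkcond; apply: eq_integral => t _; rewrite patchE indicE.
by case: ifP => _; rewrite ?mule1 ?mule0.
Qed.

Let measurable_cut (F : R3 R * measurableTypeR R -> \bar R) : measurable_fun setT F ->
  measurable_fun setT (fun z => (F z * (\1_D z.2)%:E)%E).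
Proof.
move=> mF; apply: emeasurable_funM => //; apply/measurable_EFinP.
exact: measurableT_comp (measurable_indic mD) (measurable_snd).
Qed.

Lemma measurable_tonelli_on (F : R3 R * measurableTypeR R -> \bar R) :
  measurable_fun setT F -> (forall z, 0 <= F z)%E ->
  measurable_fun setT (fun x => \int[leb]_(t in D) F (x, t))%E.
Proof.
move=> mF F0; under eq_fun do rewrite integral_cut.
apply: (@measurable_fun_fubini_tonelli_F _ _ _ _ R leb (fun z => (F z * (\1_D z.2)%:E)%E)).
  exact: measurable_cut.
by move=> z; rewrite mule_ge0 // lee_fin.
Qed.

Lemma tonelli_on (F : R3 R * measurableTypeR R -> \bar R) :
  measurable_fun setT F -> (forall z, 0 <= F z)%E ->
  (\int[mu3]_x \int[leb]_(t in D) F (x, t) = \int[leb]_(t in D) \int[mu3]_x F (x, t))%E.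
Proof.
move=> mF F0; under eq_integral do rewrite integral_cut.
rewrite (@tonelli3 R _ _ leb (fun z => (F z * (\1_D z.2)%:E)%E)); [|exact: measurable_cut|].
  rewrite integral_cut; apply: eq_integral => t _ /=; rewrite indicE.
  by case: (_ \in _); rewrite ?mule1 ?mule0; under eq_integral do rewrite ?mule1 ?mule0; rewrite ?integral0.
by move=> z; rewrite mule_ge0 // lee_fin.
Qed.

End tonelli_on_sets.

(** * Shifts along the coordinate axes *)

Section line_shift.
Context {R : realType}.
Implicit Types (f g : R3 R -> R).

(** The point and the time form one argument because Tonelli's theorem needs joint measurability. *)
Definition line (i : 'I_3) (z : R3 R * measurableTypeR R) : R3 R := z.1 + (z.2 : R) *: basis3 R i.

Lemma measurable_line i : measurable_fun setT (line i).
Proof.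
apply: measurable_add3; first exact: measurable_fst.
rewrite (_ : (fun x => _) = (fun z : R3 R * measurableTypeR R =>
   (((z.2 : R) * (basis3 R i).1.1, (z.2 : R) * (basis3 R i).1.2), (z.2 : R) * (basis3 R i).2) : R3 R)) //.
have m2 : measurable_fun setT (fun z : R3 R * measurableTypeR R => (z.2 : R)) := measurable_snd.
by apply: measurable_fun3; apply: measurable_funM => //; exact: measurable_cst.
Qed.

Lemma ge0_integral_line i t (F : R3 R -> \bar R) : measurable_fun setT F -> (forall x, 0 <= F x)%E ->
  (\int[mu3]_x F (line i (x, t)) = \int[mu3]_x F x)%E.
Proof. by move=> mF F0; exact: (ge0_integral_shift3 ((t : R) *: basis3 R i) mF F0). Qed.

Lemma box_line i t x (M : R) : 0 <= t <= 1 -> box M (line i (x, t)) -> box (M + 1) x.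
Proof.
move=> t01; case: x => [[x y] z]; rewrite /box /line /= => -[[/=]].
case: i => [[|[|[|//]]]] hi /=; rewrite !scaler0 ?[t *: 1]mulr1 ?addr0 !in_itv /= => h1 h2 h3.
- by split=> /=; [split=> /=|]; lra.
- by split=> /=; [split=> /=|]; lra.
- by split=> /=; [split=> /=|]; lra.
Qed.

End line_shift.

(** * Integration by parts for test functions *)

Section bounded_compact_integrals.
Context {R : realType}.
Implicit Types (f g : R3 R -> R).

Lemma integrable_box (M c : R) : mu3.-integrable setT (fun x : R3 R => (c * \1_(box M) x)%:E).
Proof.
under eq_fun do rewrite EFinM.
apply: integrableZl => //; have mb := @measurable_box R M.
apply/integrableP; split; first by apply/measurable_EFinP; exact: measurable_indic.
under eq_integral do rewrite gee0_abs ?lee_fin //.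
by rewrite integral_indic // setIT mu3_box_lty.
Qed.

Lemma bounded_compact_integrable f : bounded_compact f -> mu3.-integrable setT (EFin \o f).
Proof.
move=> [mf [M fM]]; apply: le_integrable (integrable_box M M) => //.
  exact/measurable_EFinP.
by move=> x _ /=; rewrite lee_fin (le_trans (fM x)) ?ler_norm.
Qed.

Lemma EFin_Rintegral f : mu3.-integrable setT (EFin \o f) ->
  (\int[mu3]_x f x)%:E = (\int[mu3]_x (f x)%:E)%E.
Proof. by move=> fi; rewrite /Rintegral fineK //; exact: integrable_fin_num. Qed.

Lemma loc_integrableM f g : loc_integrable f -> bounded_compact g ->
  mu3.-integrable setT (fun x => (f x * g x)%:E).
Proof.
move=> [mf fi] [mg [M gM]].
have /integrable_mkcond := fi _ (@compact_box R M) => /(_ (measurable_box M)) => h.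
apply: (@le_integrable _ _ _ _ _ _ _ (fun x => (M%:E * ((EFin \o f) \_ (box M)) x)%E)) => //.
- by apply/measurable_EFinP; exact: measurable_funM.
- move=> x _; rewrite patchE /=; have := gM x; rewrite indicE.
  case: ifP => _; rewrite ?mulr1 ?mulr0 ?mule0 /= lee_fin.
    by move=> gx; rewrite mulrC !normrM ler_wpM2r // (le_trans gx) // ler_norm.
  by rewrite normr_le0 => /eqP ->; rewrite mulr0 normr0.
- exact: integrableZl.
Qed.

Lemma loc_integrable_test f : test_function f -> loc_integrable f.
Proof.
move=> tf; split; first exact: (continuous3_measurable (test_continuous tf)).
move=> K cK; apply: (@integrableS _ _ _ _ setT) => //; first exact: compact3_measurable.
exact: bounded_compact_integrable (bounded_compact_test tf).
Qed.

Lemma line_MVT f x i (h : R) : test_function f -> 0 < h ->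
  exists2 c, 0 < c < h & f (line i (x, h)) - f x = grad f i (line i (x, c)) * h.
Proof.
move=> tf h0.
have df (t : R) : is_derive t (1 : R) (fun s : R => f (x + s *: basis3 R i)) (grad f i (x + t *: basis3 R i)).
  by apply: is_derive_line; exact: test_derivable.
have [|c] := MVT h0 (fun t _ => df t).
  apply: continuous_subspaceT => t; apply: differentiable_continuous.
  by apply/derivable1_diffP; have [] := df t.
rewrite in_itv /= => ch; rewrite scale0r addr0 subr0 => e; exists c => //.
Qed.

Lemma harmonic_cvg0' : (n.+1%:R^-1 : R) @[n --> \oo] --> (0:R)^'.
Proof.
move=> A /= [e /= e0 eA].
have /cvgrPdist_lt /(_ e e0) : (n.+1%:R^-1 : R) @[n --> \oo] --> (0:R) by exact: cvg_harmonic.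
by apply: filterS => n hn; apply: eA => //; rewrite invr_eq0 pnatr_eq0.
Qed.

(** Difference quotients have integral zero by translation invariance. The mean value theorem
    dominates them by a multiple of the indicator of a box, so the limit is taken by dominated
    convergence. *)
Lemma integral_grad f i : test_function f -> \int[mu3]_x grad f i x = 0.
Proof.
move=> tf; have tg := test_grad i tf.
have [mg [C gC]] := bounded_compact_test tg.
have [M M0 fM] := test_support tf.
have gM x : ~ box M x -> grad f i x = 0.
  move=> nx; rewrite /grad (@near_eq_derive _ _ _ f (cst 0)) ?derive_cst //.
  have : nbhs x (~` box M) by apply: open_nbhs_nbhs; split=> //; apply: closed_openC; exact: closed_box.
  by apply: filterS => y /fM.
have mf : measurable_fun setT f := continuous3_measurable (test_continuous tf).
pose F (n : nat) x := n.+1%:R * (f (line i (x, n.+1%:R^-1)) - f x).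
have Fcvg x : (F n x)%:E @[n --> \oo] --> (grad f i x)%:E.
  apply/cvg_EFin; first exact: nearW.
  have df := @test_derivable R f x i tf.
  have dfl : h^-1 *: ((f \o shift x) (h *: basis3 R i) - f x) @[h --> (0:R)^'] --> grad f i x := df.
  have := @cvg_comp _ _ _ (fun n : nat => n.+1%:R^-1 : R) _ _ _ _ harmonic_cvg0' dfl.
  rewrite /F /line /grad /derive; apply: cvg_trans; apply: near_eq_cvg; apply: nearW => n /=.
  by rewrite invrK; congr (_ * (f _ - _)); exact: addrC.
(* The steps 1/(n+1) are at most 1, so enlarging the support box by 1 serves all [n]. *)
have FC n x : `|F n x| <= `|C| * \1_(box (M + 1)) x.
  have n0 : 0 < n.+1%:R^-1 :> R by rewrite invr_gt0.
  have n1 : n.+1%:R^-1 <= 1 :> R by rewrite invf_le1 // ler1n.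
  have [c c01 ->] : exists2 c : R, 0 <= c <= 1 & F n x = grad f i (line i (x, c)).
    have [c /andP[c0 cn] e] := line_MVT x i tf n0; exists c; first by rewrite (ltW c0) (le_trans (ltW cn)).
    by rewrite /F e mulrCA divff ?mulr1 // pnatr_eq0.
  have [bx|nbx] := pselect (box (M + 1) x).
    rewrite indicE mem_set // mulr1 (le_trans (gC _)) // indicE.
    by case: (_ \in _); rewrite ?mulr1 ?mulr0 ?ler_norm.
  by rewrite gM ?normr0 ?mulr_ge0 // => /box_line - /(_ c01).
have fi := bounded_compact_integrable (bounded_compact_test tf).
have F0 n : (\int[mu3]_x (F n x)%:E = 0)%E.
  have fs := integrable_shift3 ((n.+1%:R^-1 : R) *: basis3 R i) fi.
  transitivity (n.+1%:R%:E * (\int[mu3]_x ((f (line i (x, n.+1%:R^-1)))%:E - (f x)%:E)))%E.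
    by rewrite -integralZl //; exact: integrableB.
  rewrite integralB //.
  have -> : (\int[mu3]_x (f (line i (x, n.+1%:R^-1)))%:E = \int[mu3]_x (f x)%:E)%E.
    have e := Rintegral_shift3 ((n.+1%:R^-1 : R) *: basis3 R i) fi.
    by have := congr1 EFin e; rewrite !EFin_Rintegral.
  by rewrite subee ?mule0 //; exact: integrable_fin_num.
have [|||||_ _] := @dominated_convergence _ _ _ mu3 setT measurableT (fun n x => (F n x)%:E) (EFin \o grad f i)
   (fun x => (`|C| * \1_(box (M + 1)) x)%:E).
- move=> n; apply/measurable_EFinP; apply: measurable_funM => //; apply: measurable_funB => //.
  exact: (measurableT_comp mf (measurable_shift3 ((n.+1%:R^-1 : R) *: basis3 R i))).
- exact/measurable_EFinP.
- by apply: aeW => x _; exact: Fcvg.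
- exact: integrable_box.
- by apply: aeW => x n _ /=; rewrite lee_fin.
under eq_fun do rewrite F0.
move=> L; have e := cvg_unique (@ereal_hausdorff R) L (@cvg_cst _ (0 : \bar R)%E _ _ _).
by rewrite /Rintegral [X in fine X]e.
Qed.

Lemma weak_gradient_test f : test_function f -> weak_gradient f (grad f).
Proof.
move=> tf; split; first exact: loc_integrable_test.
  by move=> i; apply: loc_integrable_test; exact: test_grad.
move=> i psi tp; have := integral_grad i (testM tf tp); rewrite gradM //.
rewrite RintegralD //.
- move=> /eqP; rewrite addr_eq0 => /eqP ->; congr (- _); apply: eq_Rintegral => x _; exact: mulrC.
- exact: (loc_integrableM (loc_integrable_test tf) (bounded_compact_test (test_grad i tp))).
- exact: (loc_integrableM (loc_integrable_test tp) (bounded_compact_test (test_grad i tf))).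
Qed.

End bounded_compact_integrals.

(** * The fundamental lemma of the calculus of variations *)

Section fundamental_lemma.
Context {R : realType}.
Implicit Types (f g : R3 R -> R) (a b : R3 R).

Definition rect a b : set (R3 R) :=
  (`]a.1.1, b.1.1[%classic `*` `]a.1.2, b.1.2[%classic) `*` `]a.2, b.2[%classic.

Lemma measurable_rect a b : measurable (rect a b).
Proof. by apply: measurableX; [apply: measurableX|]; exact: measurable_itv. Qed.

Definition diag3 (n : nat) : R3 R := ((n%:R, n%:R), n%:R).

Lemma rect_cover (A : set (R3 R)) : A `<=` \bigcup_n (rect (- diag3 n) (diag3 n)).
Proof.
move=> [[x y] z] _; have [n [hx hy hz]] := itv_cover x y z.
exists n.+1 => //; rewrite /rect /=; move: hx hy hz; rewrite !in_itv /= -natr1.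
by move=> hx hy hz; split=> /=; [split=> /=|]; lra.
Qed.

Lemma rectI a b c d : rect a b `&` rect c d =
  rect ((Num.max a.1.1 c.1.1, Num.max a.1.2 c.1.2), Num.max a.2 c.2)
       ((Num.min b.1.1 d.1.1, Num.min b.1.2 d.1.2), Num.min b.2 d.2).
Proof.
apply/seteqP; split=> -[[x y] z]; rewrite /rect /= !in_itv /= !gt_max !lt_min.
  by move=> [[[/andP[-> ->] /andP[-> ->]] /andP[-> ->]] [[/andP[-> ->] /andP[-> ->]] /andP[-> ->]]].
by move=> [[/andP[/andP[-> ->] /andP[-> ->]] /andP[/andP[-> ->] /andP[-> ->]]] /andP[/andP[-> ->] /andP[-> ->]]].
Qed.

Definition rects : set (set (R3 R)) := [set A | exists a b, A = rect a b].

(** The nontrivial inclusion: each coordinate is measurable for the sigma-algebra generated by open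
    boxes, since a slab is a countable union of boxes; hence so is the identity into the product. *)
Lemma rects_measurableE : @measurable _ (R3 R) = <<s rects >>.
Proof.
apply/seteqP; split; last first.
  apply: smallest_sub; first exact: sigma_algebra_measurable.
  by move=> _ [a [b ->]]; exact: measurable_rect.
pose X := g_sigma_algebraType rects.
have mr a b : measurable (rect a b : set X) by apply: sub_sigma_algebra; exists a, b.
have m1 : measurable_fun setT (fun x : X => (x : R3 R).1.1 : R).
  apply: (measurability _ (RGenOpens.measurableE R)) => _ [_ [a [b ->] <-]]; rewrite setTI.
  rewrite (_ : _ @^-1` _ = \bigcup_n rect ((a, - n%:R), - n%:R) ((b, n%:R), n%:R)).
    exact: bigcupT_measurable.
  apply/seteqP; split=> [[[x y] z]|]; last by move=> [[x y] z] [n _ [[]]].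
  move=> xab; have [n _ [[/= _ hy] hz]] := @rect_cover setT ((x, y), z) Logic.I.
  by exists n.
have m2 : measurable_fun setT (fun x : X => (x : R3 R).1.2 : R).
  apply: (measurability _ (RGenOpens.measurableE R)) => _ [_ [a [b ->] <-]]; rewrite setTI.
  rewrite (_ : _ @^-1` _ = \bigcup_n rect ((- n%:R, a), - n%:R) ((n%:R, b), n%:R)).
    exact: bigcupT_measurable.
  apply/seteqP; split=> [[[x y] z]|]; last by move=> [[x y] z] [n _ [[]]].
  move=> xab; have [n _ [[/= hx _] hz]] := @rect_cover setT ((x, y), z) Logic.I.
  by exists n.
have m3 : measurable_fun setT (fun x : X => (x : R3 R).2 : R).
  apply: (measurability _ (RGenOpens.measurableE R)) => _ [_ [a [b ->] <-]]; rewrite setTI.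
  rewrite (_ : _ @^-1` _ = \bigcup_n rect ((- n%:R, - n%:R), a) ((n%:R, n%:R), b)).
    exact: bigcupT_measurable.
  apply/seteqP; split=> [[[x y] z]|]; last by move=> [[x y] z] [n _ [[]]].
  move=> xab; have [n _ [[/= hx hy] _]] := @rect_cover setT ((x, y), z) Logic.I.
  by exists n.
move=> A mA; have := measurable_fun3 m1 m2 m3 measurableT mA; rewrite setTI.
by rewrite (_ : _ @^-1` A = A) //; apply/seteqP; split=> -[[x y] z].
Qed.

Lemma density_measure d (T : measurableType d) (m : {measure set T -> \bar R}) (g : T -> \bar R) :
  measurable_fun setT g -> (forall x, 0 <= g x)%E ->
  exists m' : {measure set T -> \bar R}, forall A, m' A = (\int[m]_(x in A) g x)%E.
Proof.
move=> mg g0; pose nu A := (\int[m]_(x in A) g x)%E.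
have nu0 : nu set0 = 0%E by rewrite /nu integral_set0.
have nu_ge0 A : (0 <= nu A)%E by apply: integral_ge0.
have nu_add : semi_sigma_additive nu.
  move=> F mF tF mUF; rewrite /nu; apply: cvg_toP.
    by apply: ereal_nondecreasing_is_cvgn => k n kn; apply: lee_sum_nneg_natr => // j _ _; exact: nu_ge0.
  by rewrite ge0_integral_bigcup //; exact: measurable_funTS.
pose nuM := isMeasure.Build _ _ _ nu nu0 nu_ge0 nu_add.
by exists (HB.pack_for {measure set T -> \bar R} nu nuM).
Qed.

(** The measures with densities f^+ and f^- agree on boxes, a generating pi-system that exhausts the
    space, hence on all measurable sets. Their densities then agree almost everywhere. *)
Lemma ae0_rect f : mu3.-integrable setT (EFin \o f) ->
  (forall a b, \int[mu3]_(x in rect a b) (f x)%:E = 0)%E -> {ae mu3, forall x, f x = 0}.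
Proof.
move=> fi f0; have mf := measurable_int _ fi.
have ip := integrable_funepos measurableT fi; have im := integrable_funeneg measurableT fi.
have mp := measurable_int _ ip; have mm := measurable_int _ im.
have [m1 m1E] := density_measure mu3 mp (fun x => funepos_ge0 _ x).
have [m2 m2E] := density_measure mu3 mm (fun x => funeneg_ge0 _ x).
have fin (h : R3 R -> \bar R) A : mu3.-integrable setT h -> measurable A ->
    (\int[mu3]_(x in A) h x)%E \is a fin_num.
  by move=> hi mA; apply: integrable_fin_num => //; exact: integrableS hi.
have E A : measurable A -> m1 A = m2 A.
  apply: (measure_unique rects (fun n => rect (- diag3 n) (diag3 n))).
  - exact: rects_measurableE.
  - by move=> _ _ [a [b ->]] [c [d ->]]; rewrite rectI; eexists; eexists.
  - by move=> n; eexists; eexists.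
  - by apply/seteqP; split=> //; exact: rect_cover.
  - move=> _ [a [b ->]]; rewrite m1E m2E.
    have h := f0 a b; rewrite integralE in h; move/eqP: h.
    have F1 := fin _ _ ip (measurable_rect a b); have F2 := fin _ _ im (measurable_rect a b).
    by rewrite sube_eq ?add0e // => /eqP.
  - move=> n; rewrite m1E ltey_eq fin //; exact: measurable_rect.
have [|N [mN N0 hN]] := integral_ae_eq measurableT ip mm _.
  by move=> A _ mA; rewrite -m1E -m2E E.
exists N; split=> // x fx; apply: hN => /= /(_ Logic.I) h; apply: fx.
move: h; rewrite funeposE funenegE /= -!EFin_max => -[].
by rewrite !maxEle; case: ifP; case: ifP; lra.
Qed.

Lemma bounded_compact_rect n : bounded_compact (\1_(rect (- diag3 n) (diag3 n)) : R3 R -> R).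
Proof.
split; first by apply: measurable_indic; exact: measurable_rect.
exists n.+1%:R => x; rewrite !indicE; case: (boolP (x \in rect _ _)) => h; last first.
  by rewrite normr0 mulr_ge0.
rewrite mem_set ?mulr1 ?normr1 ?ler1n //.
move: h; rewrite inE; case: x => [[x y] z]; rewrite /rect /box /= !in_itv /= -natr1.
by move=> [[hx hy] hz]; split=> /=; [split=> /=|]; lra.
Qed.

(** Cutting f off by large boxes makes it integrable and preserves the hypothesis, because two boxes
    intersect in a box. *)
Lemma ae0_loc_rect f : loc_integrable f ->
  (forall a b, \int[mu3]_(x in rect a b) (f x)%:E = 0)%E -> {ae mu3, forall x, f x = 0}.
Proof.
move=> lf f0.
have h n : {ae mu3, forall x, f x * \1_(rect (- diag3 n) (diag3 n)) x = 0}.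
  apply: ae0_rect; first exact: (loc_integrableM lf (bounded_compact_rect n)).
  move=> a b; transitivity (\int[mu3]_(x in rect a b `&` rect (- diag3 n)%R (diag3 n)) (f x)%:E)%E.
    rewrite [LHS]integral_mkcond [RHS]integral_mkcond.
    apply: eq_integral => x _; rewrite !patchE indicE (in_setI x (rect a b)).
    by case: (x \in rect a b); case: (x \in rect _ _); rewrite ?mulr1 ?mulr0.
  by rewrite rectI f0.
have := ae_foralln h; apply: filterS => x hx.
have [n _ nx] := @rect_cover setT x Logic.I.
by have := hx n; rewrite indicE mem_set // mulr1.
Qed.

Definition plateau3 a b m : R3 R -> R :=
  tensor (plateau a.1.1 b.1.1 m) (plateau a.1.2 b.1.2 m) (plateau a.2 b.2 m).

Lemma plateau_support (a b m x : R) : 0 < m -> plateau a b m x != 0 -> `|x| <= `|a| + `|b|.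
Proof.
move=> m0 h; have : x \in `]a, b[ by apply: contraNT h => h; rewrite plateau_out.
rewrite in_itv /= ler_norml.
have := ler_norm a; have := ler_norm b; have := ler_norm (- a); have := ler_norm (- b).
by rewrite !normrN; lra.
Qed.

Lemma test_plateau3 a b m : 0 < m -> test_function (plateau3 a b m).
Proof.
move=> m0; apply: (@test_tensor _ _ _ _ (`|a.1.1| + `|b.1.1| + (`|a.1.2| + `|b.1.2|) + (`|a.2| + `|b.2|)));
  try exact: smooth1_plateau.
all: move=> x /(plateau_support m0) h; have p (u v : R) : 0 <= `|u| + `|v| by rewrite addr_ge0.
all: by have := p a.1.1 b.1.1; have := p a.1.2 b.1.2; have := p a.2 b.2; lra.
Qed.

(** Products of plateaus are dominated by the indicator of a box and converge to it, so the integral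
    of f over every box vanishes. Restricting the hypothesis to these products means that later only
    tensor test functions have to be integrated along a coordinate. *)
Theorem fundamental_lemma f : loc_integrable f ->
  (forall a b (m : R), 0 < m -> \int[mu3]_x (f x * plateau3 a b m x) = 0) ->
  {ae mu3, forall x, f x = 0}.
Proof.
move=> lf f0; apply: ae0_loc_rect => // a b; have mf := lf.1.
have mb (m : R) : 0 < m -> measurable_fun setT (plateau3 a b m).
  by move=> m0; exact: (continuous3_measurable (test_continuous (test_plateau3 a b m0))).
pose Q : R3 R -> R := \1_(rect a b).
(* The final 1 makes [M] a bound for the value 1 of the indicator as well as for its support, as
   [bounded_compact] demands. *)
pose M := `|a.1.1| + `|b.1.1| + (`|a.1.2| + `|b.1.2|) + (`|a.2| + `|b.2|) + 1.
have fb (m : R) x : 0 < m -> `|plateau3 a b m x| <= Q x.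
  move=> m0; have p0 : 0 <= plateau3 a b m x by apply: mulr_ge0; [apply: mulr_ge0|]; exact: plateau_ge0.
  rewrite (ger0_norm p0) /plateau3 /tensor /Q indicE.
  have [xr|xr] := boolP (x \in rect a b).
    apply: mulr_ile1; [|exact: plateau_ge0| |exact: plateau_le1].
      by apply: mulr_ge0; exact: plateau_ge0.
    by apply: mulr_ile1; [exact: plateau_ge0|exact: plateau_ge0|exact: plateau_le1|exact: plateau_le1].
  suff -> : plateau a.1.1 b.1.1 m x.1.1 * plateau a.1.2 b.1.2 m x.1.2 * plateau a.2 b.2 m x.2 = 0 by [].
  apply/eqP; apply: contraR xr => h.
  have pin (c d y : R) : plateau c d m y != 0 -> y \in `]c, d[.
    by apply: contraNT => hy; rewrite plateau_out.
  rewrite inE; split=> /=; [split=> /=|]; apply: pin; apply: contraNneq h => ->;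
    by rewrite ?(mulr0, mul0r).
have bcQ : bounded_compact Q.
  split; first by apply: measurable_indic; exact: measurable_rect.
  exists M => x; rewrite /Q indicE; case: (boolP (x \in rect a b)); last first.
    by move=> _; rewrite normr0 mulr_ge0 // /M !addr_ge0.
  rewrite inE indicE => xr; rewrite mem_set ?mulr1 ?normr1.
    by rewrite /M lerDr !addr_ge0.
  move: xr; case: x => [[x y] z]; rewrite /rect /box /= !in_itv /=.
  have h (u v w : R) : w < u < v -> `|u| <= `|w| + `|v|.
    rewrite ler_norml; have := ler_norm w; have := ler_norm v; have := ler_norm (- w); have := ler_norm (- v).
    by rewrite !normrN; lra.
  have p (u v : R) : 0 <= `|u| + `|v| by rewrite addr_ge0.
  have := p a.1.1 b.1.1; have := p a.1.2 b.1.2; have := p a.2 b.2.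
  by move=> p1 p2 p3 [[/h hx /h hy] /h hz]; split=> /=; [split=> /=|]; rewrite -ler_norml /M; lra.
have lim x : (f x * plateau3 a b n.+1%:R x)%:E @[n --> \oo] --> (f x * Q x)%:E.
  apply/cvg_EFin; first exact: nearW.
  apply: cvgM; first exact: cvg_cst.
  have -> : Q x = (\1_(`]a.1.1, b.1.1[%classic) x.1.1 : R) * \1_(`]a.1.2, b.1.2[%classic) x.1.2 * \1_(`]a.2, b.2[%classic) x.2.
    rewrite /Q !indicE -!natrM !mulnb; congr (nat_of_bool _)%:R.
    apply/idP/idP => [/set_mem[[h1 h2] h3]|/andP[/andP[/set_mem h1 /set_mem h2] /set_mem h3]].
      by apply/andP; split; [apply/andP; split|]; exact/mem_set.
    exact/mem_set.
  by apply: cvgM; [apply: cvgM|]; exact: plateau_cvg.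
have [|||||_ _] := @dominated_convergence _ _ _ mu3 setT measurableT (fun n x => (f x * plateau3 a b n.+1%:R x)%:E)
  (fun x => (f x * Q x)%:E) (fun x => (`|f x * Q x|)%:E).
- by move=> n; apply/measurable_EFinP; apply: measurable_funM => //; exact: mb.
- by apply/measurable_EFinP; apply: measurable_funM => //; exact: bcQ.1.
- by apply: aeW => x _; exact: lim.
- exact: (integrable_abse (loc_integrableM lf bcQ)).
- apply: aeW => x n _ /=; rewrite lee_fin (normrM (f x) (plateau3 _ _ _ _)) (normrM (f x) (Q x)).
  by apply: ler_wpM2l => //; apply: le_trans (ler_norm _); exact: fb.
have z n : (\int[mu3]_x (f x * plateau3 a b n.+1%:R x)%:E = 0)%E.
  have n0 : (0 : R) < n.+1%:R by [].
  have := congr1 EFin (f0 a b _ n0); rewrite EFin_Rintegral //.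
  exact: loc_integrableM lf (bounded_compact_test (test_plateau3 a b n0)).
under eq_fun do rewrite z.
move=> L; have e := cvg_unique (@ereal_hausdorff R) L (@cvg_cst _ (0 : \bar R)%E _ _ _).
transitivity (\int[mu3]_x (f x * Q x)%:E)%E; last exact: e.
rewrite integral_mkcond; apply: eq_integral => x _.
by rewrite patchE /Q indicE; case: ifP; rewrite ?mulr1 ?mulr0.
Qed.

End fundamental_lemma.

(** * Linearity and uniqueness *)

Section weak_gradients.
Context {R : realType}.
Implicit Types (f g : R3 R -> R) (G H : 'I_3 -> R3 R -> R).

Lemma loc_integrableD f g : loc_integrable f -> loc_integrable g ->
  loc_integrable (fun x => f x + g x).
Proof.
move=> [mf fi] [mg gi]; split; first exact: measurable_funD.
by move=> K cK; exact: (integrableD (compact3_measurable cK) (fi _ cK) (gi _ cK)).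
Qed.

Lemma loc_integrableZ c f : loc_integrable f -> loc_integrable (fun x => c * f x).
Proof.
move=> [mf fi]; split; first by apply: measurable_funM.
by move=> K cK; apply: (integrableZl (compact3_measurable cK) c (fi _ cK)).
Qed.

Lemma weak_gradient_uniq f g G H : weak_gradient f G -> weak_gradient g H ->
  f = g %[ae mu3] -> forall i, G i = H i %[ae mu3].
Proof.
move=> [lf lG fG] [lg lH gH] fg i.
have lGH : loc_integrable (fun x => G i x + (-1) * H i x).
  by apply: loc_integrableD => //; exact: loc_integrableZ.
have := fundamental_lemma lGH _; case.
  move=> a b m m0; have tp := test_plateau3 a b m0; have bp := bounded_compact_test tp.
  have J1 := loc_integrableM (lG i) bp; have J2 := loc_integrableM (lH i) bp.
  transitivity (\int[mu3]_x (G i x * plateau3 a b m x - H i x * plateau3 a b m x)).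
    by apply: eq_Rintegral => x _; ring.
  rewrite RintegralB //.
  have := fG i _ tp; have := gH i _ tp.
  have -> : \int[mu3]_x (f x * grad (plateau3 a b m) i x) = \int[mu3]_x (g x * grad (plateau3 a b m) i x).
    rewrite /Rintegral; congr fine; apply: ae_eq_integral => //.
    - by have /integrableP[] := loc_integrableM lf (bounded_compact_test (test_grad i tp)).
    - by have /integrableP[] := loc_integrableM lg (bounded_compact_test (test_grad i tp)).
    - by apply: filterS fg => x /= -> .
  by move=> -> /oppr_inj ->; rewrite subrr.
move=> N [mN N0 hN]; exists N; split=> // x /= h; apply: hN => /= h0; apply: h => _.
by apply/eqP; rewrite -subr_eq0; apply/eqP; rewrite -h0; ring.
Qed.

End weak_gradients.

(** * Window averages of test functions *)

Section antiderivative.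
Context {R : realType}.
Local Notation leb := (@lebesgue_measure R).

Lemma smooth1_antiderivative (a F : R -> R) : smooth1 a ->
  (forall x : R, is_derive x (1 : R) F (a x)) -> smooth1 F.
Proof.
move=> sa dF [|k].
  by move=> x; apply: differentiable_continuous; apply/derivable1_diffP; have [] := dF x.
split.
  by move=> x; apply: differentiable_continuous; apply/derivable1_diffP; have [] := dF x.
move=> _; split=> [x|]; first by have [] := dF x.
by rewrite (_ : (fun x => _) = a); [exact: sa|apply/funext => x; have [_] := dF x].
Qed.

Lemma smooth1D2 (f g : R -> R) : smooth1 f -> smooth1 g -> smooth1 (fun x => f x - g x).
Proof.
move=> sf sg k; rewrite (_ : (fun x => _) = (fun x => f x + (-1) * g x)).
  by apply: smoothkD => //; exact: smoothkZ.
by apply/funext => x; rewrite mulN1r.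
Qed.

(** [A] is the integral of [a] over a sliding window of length [h], that is P(y) - P(y - h) for an
    antiderivative P. P itself need not vanish at infinity; the difference has bounded support
    again. *)
Lemma moving_integral (a : R -> R) (M h : R) : smooth1 a -> 0 < h ->
  (forall x, a x != 0 -> `|x| <= M) ->
  exists A : R -> R, [/\ smooth1 A, forall y : R, 'D_1 A y = a y - a (y - h),
    (forall x, A x != 0 -> `|x| <= M + h) &
    forall y, (\int[leb]_(t in `[0%R, h]) (a (y - t))%:E = (A y)%:E)%E].
Proof.
move=> sa h0 aM; have ca : continuous a := smoothk_continuous (sa 0%N).
have ai : leb.-integrable setT (EFin \o a).
  have ma : measurable_fun setT a by exact: continuous_measurable_fun.
  have : leb.-integrable `[-M, M] (EFin \o a).
    apply: continuous_compact_integrable; first exact: segment_compact.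
    by apply: continuous_subspaceT => x; exact: ca.
  have mI : measurable (`[- M, M]%classic : set (measurableTypeR R)) by exact: measurable_itv.
  move=> H; have := (@integrable_mkcond _ _ _ leb _ (EFin \o a) mI).1 H.
  rewrite (_ : _ \_ _ = EFin \o a) //; apply/funext => x; rewrite patchE.
  case: ifPn => // /negP xM; rewrite /= [RHS](_ : _ = 0%E) //; congr EFin.
  apply/eqP/negPn/negP => /aM; rewrite ler_norml => h1; apply: xM.
  by apply/mem_set; rewrite /= in_itv.
pose P y : R := \int[leb]_(t in [set` Interval -oo%O (BRight y)]) a t.
have dP (y : R) : is_derive y (1 : R) P (a y).
  have [] := @continuous_FTC1 _ a -oo%O y (y + 1) _ _ _ (ca y).
  - by rewrite ltrDl.
  - by apply: integrableS ai => //; exact: measurable_itv.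
  - exact: ltNyr.
  by move=> d e; apply: (DeriveDef d); rewrite -derive1E; exact: e.
have sP : smooth1 P := smooth1_antiderivative sa dP.
pose A y := P y - P (y - h).
have sPh : smooth1 (fun y => P (y - h)).
  rewrite (_ : (fun y => _) = (fun y => P (1 * y + - h))); first exact: smooth1_affine.
  by apply/funext => y; rewrite mul1r.
have dPs (c y : R) : is_derive y (1 : R) (fun y => P (y - c)) (a (y - c)).
  have := @is_derive1_comp _ P (fun y => y - c) y (a (y - c)) 1 (dP _) _.
  rewrite mulr1; apply; exact: is_derive_shift.
have AE y : (\int[leb]_(t in `[0%R, h]) (a (y - t))%:E = (A y)%:E)%E.
  have dN (t : R) : is_derive t (1 : R) (fun t : R => - P (y - t)) (a (y - t)).
    have h1 : is_derive t (1 : R) (fun t : R => y - t) (-1).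
      by refine (is_derive_eq (is_deriveB (is_derive_cst y t 1) (is_derive_id t 1)) _); rewrite sub0r.
    have h2 := @is_derive1_comp _ P (fun t : R => y - t) t (a (y - t)) (-1) (dP _) h1.
    by refine (is_derive_eq (is_deriveN h2) _); rewrite mulrN1 opprK.
  have cN : continuous (fun t : R => - P (y - t)).
    by move=> t; apply: differentiable_continuous; apply/derivable1_diffP; have [] := dN t.
  rewrite (@continuous_FTC2 _ (fun t => a (y - t)) (fun t => - P (y - t)) 0 h) //.
  - by rewrite -EFinB /A subr0; congr EFin; ring.
  - apply: continuous_subspaceT => t; apply: (@continuous_comp _ _ _ (fun t => y - t) a); last exact: ca.
    by apply: continuousB; [exact: cst_continuous|].
  - split.
    + by move=> t _; have [] := dN t.
    + exact: cvg_at_right_filter (cN _).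
    + exact: cvg_at_left_filter (cN _).
  - by move=> t _; rewrite derive1E; have [_] := dN t.
exists A; split=> //.
- exact: smooth1D2.
- by move=> y; have [_] := is_deriveB (dP y) (dPs h y).
- move=> y; apply: contraNT; rewrite -ltNge => yM.
  suff : (A y)%:E = 0%E by move=> [->].
  rewrite -AE; apply: integral0_eq => t /=; rewrite in_itv /= => th; congr EFin.
  apply/eqP/negPn/negP => /aM h1.
  have : `|y| <= `|y - t| + `|t| by rewrite -[X in `|X| <= _](subrK t); exact: ler_normD.
  by rewrite (ger0_norm (_ : 0 <= t)); lra.
Qed.

(** Sliding the window along the i-th factor alone gives a test function whose i-th derivative is a
    translation difference of the original one. Testing a weak gradient against it therefore
    produces translation differences of f. *)
Lemma tensor_antiderivative i (a b c : R -> R) (M h : R) :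
  smooth1 a -> smooth1 b -> smooth1 c -> 0 < h ->
  (forall x, a x != 0 -> `|x| <= M) -> (forall x, b x != 0 -> `|x| <= M) ->
  (forall x, c x != 0 -> `|x| <= M) ->
  exists Psi : R3 R -> R, [/\ test_function Psi,
    forall x, grad Psi i x = tensor a b c x - tensor a b c (line i (x, - h)) &
    forall x, (\int[leb]_(t in `[0%R, h]) (tensor a b c (line i (x, (- t)%R)))%:E = (Psi x)%:E)%E].
Proof.
move=> sa sb sc h0 hA hB hC.
have wk (f : R -> R) : (forall x, f x != 0 -> `|x| <= M) -> forall x, f x != 0 -> `|x| <= M + h.
  by move=> hf x /hf H; rewrite (le_trans H) // lerDl ltW.
have Z (f : R -> R) (F : R -> R) k l y : continuous f ->
    (forall y, (\int[leb]_(t in `[0%R, h]) (f (y - t))%:E = (F y)%:E)%E) ->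
    (\int[leb]_(t in `[0%R, h]) (k * f (y + - t *: (1 : R)) * l)%:E = (k * F y * l)%:E)%E.
  move=> cf fF; transitivity (\int[leb]_(t in `[0%R, h]) ((k * l)%:E * (f (y - t))%:E))%E.
    by apply: eq_integral => t _; rewrite -EFinM [_ *: _]mulr1; congr EFin; ring.
  rewrite integralZl //.
    by rewrite fF -EFinM; congr EFin; ring.
  apply: continuous_compact_integrable; first exact: segment_compact.
  apply: continuous_subspaceT => t; apply: (@continuous_comp _ _ _ (fun t => y - t) f); last exact: cf.
  by apply: continuousB; [exact: cst_continuous|].
case: i => [[|[|[|//]]]] hi.
- have [A [sA dA AM AE]] := moving_integral sa h0 hA.
  exists (tensor A b c); split.
  + exact: (test_tensor sA sb sc AM (wk _ hB) (wk _ hC)).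
  + move=> x; have [_] := is_derive_tensor x (Ordinal hi) sA sb sc; rewrite /grad => -> /=.
    by case: x => [[x y] z]; rewrite /tensor /line /= dA !scaler0 !addr0 [_ *: 1]mulr1; ring.
  + move=> [[x y] z]; transitivity (\int[leb]_(t in `[0%R, h]) (1 * a (x + - t *: (1 : R)) * (b y * c z))%:E)%E.
      by apply: eq_integral => t _; rewrite /tensor /line /= !scaler0 !addr0; congr EFin; ring.
    by rewrite /tensor (Z _ _ _ _ _ (smoothk_continuous (sa 0%N)) AE) mul1r mulrA.
- have [A [sA dA AM AE]] := moving_integral sb h0 hB.
  exists (tensor a A c); split.
  + exact: (test_tensor sa sA sc (wk _ hA) AM (wk _ hC)).
  + move=> x; have [_] := is_derive_tensor x (Ordinal hi) sa sA sc; rewrite /grad => -> /=.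
    by case: x => [[x y] z]; rewrite /tensor /line /= dA !scaler0 !addr0 [_ *: 1]mulr1; ring.
  + move=> [[x y] z]; transitivity (\int[leb]_(t in `[0%R, h]) (a x * b (y + - t *: (1 : R)) * c z)%:E)%E.
      by apply: eq_integral => t _; rewrite /tensor /line /= !scaler0 !addr0.
    by rewrite /tensor (Z _ _ _ _ _ (smoothk_continuous (sb 0%N)) AE).
- have [A [sA dA AM AE]] := moving_integral sc h0 hC.
  exists (tensor a b A); split.
  + exact: (test_tensor sa sb sA (wk _ hA) (wk _ hB) AM).
  + move=> x; have [_] := is_derive_tensor x (Ordinal hi) sa sb sA; rewrite /grad => -> /=.
    by case: x => [[x y] z]; rewrite /tensor /line /= dA !scaler0 !addr0 [_ *: 1]mulr1; ring.
  + move=> [[x y] z]; transitivity (\int[leb]_(t in `[0%R, h]) (a x * b y * c (z + - t *: (1 : R)) * 1)%:E)%E.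
      by apply: eq_integral => t _; rewrite /tensor /line /= !scaler0 !addr0; congr EFin; ring.
    by rewrite /tensor (Z _ _ _ _ _ (smoothk_continuous (sc 0%N)) AE) mulr1.
Qed.

End antiderivative.

(** * Differences of functions with a weak gradient *)

Section translation_of_weak_gradients.
Context {R : realType}.
Local Notation leb := (@lebesgue_measure R).
Implicit Types (f g : R3 R -> R).

Lemma box_line_in i (t h : R) (x : R3 R) (M : R) : 0 <= t <= h -> box M x -> box (M + h) (line i (x, t)).
Proof.
move=> th; case: x => [[x y] z]; rewrite /box /line /= => -[[/=]].
case: i => [[|[|[|//]]]] hi /=; rewrite !scaler0 ?[t *: 1]mulr1 ?addr0 !in_itv /= => h1 h2 h3.
- by split=> /=; [split=> /=|]; lra.
- by split=> /=; [split=> /=|]; lra.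
- by split=> /=; [split=> /=|]; lra.
Qed.

Lemma lineK i t : cancel (fun x : R3 R => line i (x, t)) (fun x => line i (x, - t)).
Proof. by move=> x; rewrite /line /= scaleNr addrK. Qed.

Lemma measurable_line_comp d (T : measurableType d) i (F : R3 R -> T) : measurable_fun setT F ->
  measurable_fun setT (fun z => F (line i z)).
Proof. by move=> mF; exact: (measurableT_comp mF (measurable_line i)). Qed.

Definition line_integral i (h : R) (g : R3 R -> R) (x : R3 R) : \bar R :=
  (\int[leb]_(t in `[0%R, h]) (g (line i (x, t)))%:E)%E.

Lemma line_integral_ge0 i h g x : (forall x, 0 <= g x) -> (0 <= line_integral i h g x)%E.
Proof. by move=> g0; apply: integral_ge0 => t _; rewrite lee_fin. Qed.

Lemma measurable_line_integral i h g : measurable_fun setT g -> (forall x, 0 <= g x) ->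
  measurable_fun setT (line_integral i h g).
Proof.
move=> mg g0; apply: (@measurable_tonelli_on _ _ (measurable_itv _) (fun z => (g (line i z))%:E)).
  by apply/measurable_EFinP; exact: measurable_line_comp.
by move=> z; rewrite lee_fin.
Qed.

(** Tonelli and translation invariance move the window from [g] onto [psi], reversing its
    direction. *)
Lemma line_integral_adjoint i h g (psi : R3 R -> R) : measurable_fun setT g -> (forall x, 0 <= g x) ->
  measurable_fun setT psi -> (forall x, 0 <= psi x) ->
  (\int[mu3]_x (line_integral i h g x * (psi x)%:E) =
   \int[mu3]_x ((g x)%:E * \int[leb]_(t in `[0%R, h]) (psi (line i (x, - t)%R))%:E))%E.
Proof.
move=> mg g0 mp p0.
have mI : measurable (`[0, h]%classic : set (measurableTypeR R)) by exact: measurable_itv.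
have mN : measurable_fun setT (fun z : R3 R * measurableTypeR R => (z.1, - z.2) : R3 R * measurableTypeR R).
  apply: measurable_fun_pair; first exact: measurable_fst.
  have m2 : measurable_fun setT (fun z : R3 R * measurableTypeR R => (z.2 : R)) := measurable_snd.
  exact: measurable_funN.
have mpl : measurable_fun setT (fun z : R3 R * measurableTypeR R => psi (line i (z.1, - z.2))).
  exact: (measurableT_comp (measurable_line_comp i mp) mN).
transitivity (\int[mu3]_x \int[leb]_(t in `[0%R, h]) (g (line i (x, t)) * psi x)%:E)%E.
  apply: eq_integral => x _; rewrite /line_integral -ge0_integralZr //.
  - apply/measurable_EFinP; apply: measurable_funTS.
    exact: (measurableT_comp (measurable_line_comp i mg) (pair1_measurable x)).
  - by move=> t _; rewrite lee_fin.
  - by rewrite lee_fin.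
have T1 := @tonelli_on _ _ mI (fun z => (g (line i z) * psi z.1)%:E).
etransitivity; first apply: T1.
- apply/measurable_EFinP; apply: measurable_funM; first exact: measurable_line_comp.
  exact: (measurableT_comp mp measurable_fst).
- by move=> z; rewrite lee_fin mulr_ge0.
transitivity (\int[leb]_(t in `[0%R, h]) \int[mu3]_x (g x * psi (line i (x, (- t)%R)))%:E)%E.
  apply: eq_integral => t _.
  rewrite -(@ge0_integral_line _ i t (fun x => (g x * psi (line i (x, (- t)%R)))%:E)).
  - by apply: eq_integral => x _; rewrite lineK.
  - apply/measurable_EFinP; apply: measurable_funM => //.
    exact: (measurableT_comp mpl (pair2_measurable t)).
  - by move=> z; rewrite lee_fin mulr_ge0.
have T2 := @tonelli_on _ _ mI (fun z => (g z.1 * psi (line i (z.1, (- z.2)%R)))%:E).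
etransitivity; first (apply/esym; apply: T2).
- apply/measurable_EFinP; apply: measurable_funM => //.
  exact: (measurableT_comp mg measurable_fst).
- by move=> z; rewrite lee_fin mulr_ge0.
apply: eq_integral => x _; rewrite -ge0_integralZl //.
- apply/measurable_EFinP; apply: measurable_funTS.
  exact: (measurableT_comp mpl (pair1_measurable x)).
- by move=> t _; rewrite lee_fin.
- by rewrite lee_fin.
Qed.

(** By the adjoint formula with psi the indicator of the box: a point whose window meets [box M]
    lies in [box (M + h)], and the window has length [h]. *)
Lemma line_integral_box_lty i (h M : R) g : measurable_fun setT g -> (forall x, 0 <= g x) ->
  mu3.-integrable (box (M + h)) (EFin \o g) ->
  (\int[mu3]_(x in box M) line_integral i h g x < +oo)%E.
Proof.
move=> mg g0 gi.
have mI : measurable (`[0, h]%classic : set (measurableTypeR R)) by exact: measurable_itv.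
have mb N : measurable (box N : set (R3 R)) := measurable_box N.
have ib N : measurable_fun setT (\1_(box N) : R3 R -> R) by exact: measurable_indic.
have -> : (\int[mu3]_(x in box M) line_integral i h g x =
    \int[mu3]_x (line_integral i h g x * (\1_(box M) x)%:E))%E.
  rewrite integral_mkcond; apply: eq_integral => x _; rewrite patchE indicE.
  by case: ifP; rewrite ?mule1 ?mule0.
rewrite line_integral_adjoint //.
have gb : (\int[mu3]_(x in box (M + h)) (g x)%:E < +oo)%E.
  have /integrableP[_] := gi; rewrite /=; by under eq_integral do rewrite ger0_norm //.
have mgb : measurable_fun setT (fun x => g x * \1_(box (M + h)) x) by exact: measurable_funM.
have mL : measurable_fun setT (fun x => \int[leb]_(t in `[0%R, h]) (\1_(box M) (line i (x, - t)%R))%:E)%E.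
  have mN : measurable_fun setT (fun z : R3 R * measurableTypeR R => (z.1, - z.2) : R3 R * measurableTypeR R).
    apply: measurable_fun_pair; first exact: measurable_fst.
    have m2 : measurable_fun setT (fun z : R3 R * measurableTypeR R => (z.2 : R)) := measurable_snd.
    exact: measurable_funN.
  apply: (@measurable_tonelli_on _ _ mI (fun z => (\1_(box M) (line i (z.1, - z.2)))%:E)).
    apply/measurable_EFinP; exact: (measurableT_comp (measurable_line_comp i (ib M)) mN).
  by move=> z; rewrite lee_fin.
have [h0|h0] := ltP h 0.
  apply: (@le_lt_trans _ _ 0%E) => //; rewrite le_eqVlt; apply/orP; left; apply/eqP.
  apply: integral0_eq => x _; rewrite set_itv_ge ?integral_set0 ?mule0 //.
  by rewrite bnd_simp -ltNge.
apply: (@le_lt_trans _ _ (\int[mu3]_x ((h%:E * (g x * \1_(box (M + h)) x)%:E)))%E); last first.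
  rewrite ge0_integralZl //; last 2 first.
  - by apply/measurable_EFinP.
  - by move=> x _; rewrite lee_fin mulr_ge0.
  apply: lte_mul_pinfty => //.
  rewrite (_ : (\int[mu3]_x _)%E = (\int[mu3]_(x in box (M + h)) (g x)%:E)%E) //.
  rewrite [RHS]integral_mkcond; apply: eq_integral => x _; rewrite patchE indicE.
  by case: ifP; rewrite ?mulr1 ?mulr0.
apply: ge0_le_integral => //.
- by move=> x _; rewrite mule_ge0 ?lee_fin // integral_ge0 // => t _; rewrite lee_fin.
- by apply: emeasurable_funM => //; exact/measurable_EFinP.
- by apply: emeasurable_funM => //; exact/measurable_EFinP.
move=> x _; rewrite EFinM muleCA; apply: lee_wpmul2l; first by rewrite lee_fin.
apply: (@le_trans _ _ (\int[leb]_(t in `[0%R, h]) (\1_(box (M + h)) x)%:E)%E).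
  apply: ge0_le_integral => //.
  - apply/measurable_EFinP; apply: measurable_funTS.
    have mN : measurable_fun setT (fun t : measurableTypeR R => (- t : R)) by exact: measurable_funN.
    exact: (measurableT_comp (measurableT_comp (measurable_line_comp i (ib M)) (pair1_measurable x)) mN).
  move=> t /=; rewrite in_itv /= => th; rewrite lee_fin !indicE.
  case: (boolP (line i (x, - t) \in box M)) => // /set_mem h1; rewrite mem_set //.
  by have := @box_line_in i t h _ M th h1; rewrite -[X in line i (_, X)]opprK lineK.
have hl : leb `[0, h]%classic = h%:E.
  rewrite lebesgue_measure_itv /= lte_fin; case: ltP => hh; first by rewrite sube0.
  by congr EFin; apply/eqP; rewrite eq_le h0 hh.
by rewrite integral_cst //= hl muleC.
Qed.

(** The fundamental theorem of calculus along e_i, proved by duality. Tested against a plateau psi,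
    the difference of f and the line integral of [G i] both reduce to the pairing of [G i] with the
    window average [Psi]: the former by the weak gradient identity, the latter by the adjoint
    formula. *)
Theorem weak_gradient_shift i (h : R) f (G : 'I_3 -> R3 R -> R) : weak_gradient f G -> 0 < h ->
  {ae mu3, forall x, ((`|f (line i (x, h)) - f x|)%R%:E <=
     line_integral i h (fun x => `|G i x|%R) x)%E}.
Proof.
move=> [lf lG fG] h0; have [mf _] := lf; have [mg gi] := lG i.
set g := G i in mg gi *.
have mI : measurable (`[0, h]%classic : set (measurableTypeR R)) by exact: measurable_itv.
have mb N : measurable (box N : set (R3 R)) := measurable_box N.
(* The exchange of integrals is stated for nonnegative functions, so the two parts of g are averaged
   separately; both averages are finite almost everywhere. *)
pose gp := g^\+; pose gn := g^\-.
have gp0 x : 0 <= gp x by exact: funrpos_ge0.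
have gn0 x : 0 <= gn x by exact: funrneg_ge0.
have mgp : measurable_fun setT gp by exact: measurable_funrpos.
have mgn : measurable_fun setT gn by exact: measurable_funrneg.
have gE x : g x = gp x - gn x /\ `|g x| = gp x + gn x.
  rewrite /gp /gn /funrpos /funrneg /=; have [hx|hx] := leP 0 (g x).
    by rewrite max_r ?oppr_le0 // ger0_norm // subr0 addr0.
  by rewrite max_l ?oppr_ge0 ?(ltW hx) // ltr0_norm // sub0r opprK add0r.
pose P := line_integral i h gp; pose N := line_integral i h gn.
have mP : measurable_fun setT P by exact: measurable_line_integral.
have mN : measurable_fun setT N by exact: measurable_line_integral.
have P0 x : (0 <= P x)%E by exact: line_integral_ge0.
have N0 x : (0 <= N x)%E by exact: line_integral_ge0.
have Pb M : mu3.-integrable (box M) P.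
  apply/integrableP; split; first exact: measurable_funTS.
  under eq_integral do rewrite gee0_abs //.
  apply: line_integral_box_lty => //; apply: integrable_funrpos => //.
  exact: gi (@compact_box R _).
have Nb M : mu3.-integrable (box M) N.
  apply/integrableP; split; first exact: measurable_funTS.
  under eq_integral do rewrite gee0_abs //.
  apply: line_integral_box_lty => //; apply: integrable_funrneg => //.
  exact: gi (@compact_box R _).
have aefin (Q : R3 R -> \bar R) : (forall M, mu3.-integrable (box M) Q) -> {ae mu3, forall x, Q x \is a fin_num}.
  move=> Qb; have := ae_foralln (fun n : nat => integrable_ae (mb n%:R) (Qb n%:R)).
  apply: filterS => -[[x y] z] hx; have [n [h1 h2 h3]] := itv_cover x y z; exact: (hx n).
have Pf := aefin _ Pb; have Nf := aefin _ Nb.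
pose W x := fine (P x) - fine (N x).
have mW : measurable_fun setT W by apply: measurable_funB; exact: measurableT_comp.
have lfine (Q : R3 R -> \bar R) : measurable_fun setT Q -> (forall M, mu3.-integrable (box M) Q) -> loc_integrable (fine \o Q).
  move=> mQ Qb; split; first exact: measurableT_comp.
  move=> K cK; have [M M0 KM] := compact_subset_box cK.
  apply: (@integrableS _ _ _ _ (box M)) => //; first exact: compact3_measurable.
  apply: le_integrable (Qb M) => //; first by apply: measurable_funTS; apply/measurable_EFinP; exact: measurableT_comp.
  by move=> x _ /=; case: (Q x) => [r| |] //=; rewrite leey.
have lP := lfine _ mP Pb; have lN := lfine _ mN Nb.
have lW : loc_integrable W.
  rewrite (_ : W = (fun x => (fine \o P) x + (-1) * (fine \o N) x)); last first.
    by apply/funext => x; rewrite /W /=; ring.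
  by apply: loc_integrableD => //; exact: loc_integrableZ.
pose D x := f (line i (x, h)) - f x.
have lfh : loc_integrable (fun x => f (line i (x, h))).
  split; first exact: (measurableT_comp mf (measurable_shift3 (h *: basis3 R i))).
  move=> K cK; have [M M0 KM] := compact_subset_box cK.
  apply: (@integrableS _ _ _ _ (box M)) => //; first exact: compact3_measurable.
  apply/(integrable_mkcond _ (mb M)).
  have : mu3.-integrable setT (((EFin \o f) \_ (box (M + h))) \o shift3 (h *: basis3 R i)).
    by apply: integrable_shift3; apply/(integrable_mkcond _ (mb _)); exact: lf.2 (@compact_box R _).
  apply: le_integrable => //.
    apply/(measurable_restrictT _ (mb M)); apply: measurable_funTS; apply/measurable_EFinP.
    exact: (measurableT_comp mf (measurable_shift3 (h *: basis3 R i))).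
  move=> x _; rewrite /= !patchE; case: ifPn => [/set_mem bx|_]; last by rewrite abse0 abse_ge0.
  rewrite mem_set //; apply: (@box_line_in i h h x M) => //; by rewrite ltW //=.
have lD : loc_integrable D.
  rewrite (_ : D = (fun x => f (line i (x, h)) + (-1) * f x)); last by apply/funext => x; rewrite /D; ring.
  by apply: loc_integrableD => //; exact: loc_integrableZ.
have lDW : loc_integrable (fun x => D x + (-1) * W x).
  by apply: loc_integrableD => //; exact: loc_integrableZ.
have DW : {ae mu3, forall x, D x + (-1) * W x = 0}.
  apply: fundamental_lemma => // a b m m0.
  set psi := plateau3 a b m.
  have tp : test_function psi := test_plateau3 a b m0.
  have p0 x : 0 <= psi x by apply: mulr_ge0; [apply: mulr_ge0|]; exact: plateau_ge0.
  have mp : measurable_fun setT psi := continuous3_measurable (test_continuous tp).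
  have bp := bounded_compact_test tp.
  have [Psi [tP gP PE]] : exists Psi : R3 R -> R, [/\ test_function Psi,
      forall x, grad Psi i x = psi x - psi (line i (x, - h)) &
      forall x, (\int[leb]_(t in `[0%R, h]) (psi (line i (x, (- t)%R)))%:E = (Psi x)%:E)%E].
    pose C := `|a.1.1| + `|b.1.1| + (`|a.1.2| + `|b.1.2|) + (`|a.2| + `|b.2|).
    have pq (u v : R) : 0 <= `|u| + `|v| by rewrite addr_ge0.
    have q1 := pq a.1.1 b.1.1; have q2 := pq a.1.2 b.1.2; have q3 := pq a.2 b.2.
    have h1 (x : R) : plateau a.1.1 b.1.1 m x != 0 -> `|x| <= C.
      by move=> /(plateau_support m0) hx; rewrite (le_trans hx) // /C -addrA lerDl addr_ge0.
    have h2 (x : R) : plateau a.1.2 b.1.2 m x != 0 -> `|x| <= C.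
      by move=> /(plateau_support m0) hx; rewrite (le_trans hx) // /C addrAC lerDr addr_ge0.
    have h3 (x : R) : plateau a.2 b.2 m x != 0 -> `|x| <= C.
      by move=> /(plateau_support m0) hx; rewrite (le_trans hx) // /C lerDr addr_ge0.
    exact: (tensor_antiderivative i (smooth1_plateau _ _ m) (smooth1_plateau _ _ m) (smooth1_plateau _ _ m) h0 h1 h2 h3).
  clearbody psi.
  have bP := bounded_compact_test tP.
  have avg (r : R3 R -> R) : measurable_fun setT r -> (forall x, 0 <= r x) -> loc_integrable r ->
      (forall M, mu3.-integrable (box M) (line_integral i h r)) ->
      \int[mu3]_x (fine (line_integral i h r x) * psi x) = \int[mu3]_x (r x * Psi x).
    move=> mr r0 lr rb; rewrite /Rintegral; congr fine.
    have mL := measurable_line_integral i h mr r0.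
    transitivity (\int[mu3]_x (line_integral i h r x * (psi x)%:E))%E.
      apply: ae_eq_integral => //.
      - apply/measurable_EFinP; apply: measurable_funM => //; exact: measurableT_comp.
      - by apply: emeasurable_funM => //; exact/measurable_EFinP.
      - by have := aefin _ rb; apply: filterS => x hx _; rewrite EFinM fineK.
    by rewrite line_integral_adjoint //; apply: eq_integral => x _; rewrite EFinM -PE.
  have lgp : loc_integrable gp by split=> // K cK; apply: integrable_funrpos; [exact: compact3_measurable|exact: gi].
  have lgn : loc_integrable gn by split=> // K cK; apply: integrable_funrneg; [exact: compact3_measurable|exact: gi].
  have EW : \int[mu3]_x (W x * psi x) = \int[mu3]_x (g x * Psi x).
    transitivity (\int[mu3]_x (fine (P x) * psi x - fine (N x) * psi x)).
      by apply: eq_Rintegral => x _; rewrite /W; ring.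
    rewrite (RintegralB measurableT (loc_integrableM lP bp) (loc_integrableM lN bp)).
    rewrite (avg _ mgp gp0 lgp Pb) (avg _ mgn gn0 lgn Nb).
    rewrite -(RintegralB measurableT (loc_integrableM lgp bP) (loc_integrableM lgn bP)).
    apply: eq_Rintegral => x _; rewrite -mulrBl; congr (_ * _).
    by have [] := gE x.
  have ifs : mu3.-integrable setT (fun x => (f x * psi (line i (x, - h)))%:E).
    have := integrable_shift3 (- h *: basis3 R i) (loc_integrableM lfh bp).
    apply: eq_integrable => // x _ /=; congr (_ * _)%:E; congr f.
    by rewrite /line /shift3 /= scaleNr subrK.
  have e1 := Rintegral_shift3 (h *: basis3 R i) ifs.
  have e2 := fG i _ tP.
  transitivity (\int[mu3]_x ((f (line i (x, h)) * psi x - f x * psi x) - W x * psi x)).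
    by apply: eq_Rintegral => x _; rewrite /D; ring.
  have i1 := loc_integrableM lfh bp; have i2 := loc_integrableM lf bp; have i3 := loc_integrableM lW bp.
  rewrite (RintegralB measurableT (integrableB measurableT i1 i2) i3) (RintegralB measurableT i1 i2) EW.
  have -> : \int[mu3]_x (f (line i (x, h)) * psi x) = \int[mu3]_x (f x * psi (line i (x, - h))).
    rewrite -e1; apply: eq_Rintegral => x _; congr (_ * psi _).
    by rewrite -[LHS](lineK i h).
  have : \int[mu3]_x (f x * grad Psi i x) = \int[mu3]_x (f x * psi x) - \int[mu3]_x (f x * psi (line i (x, - h))).
    by rewrite -(RintegralB measurableT i2 ifs); apply: eq_Rintegral => x _; rewrite gP; exact: mulrBr.
  have k (A B X Y : R) : A = - B -> A = X - Y -> Y - X - B = 0 by move=> *; lra.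
  exact: (k _ _ _ _ e2).
move: Pf Nf DW; apply: filterS3 => x Px Nx DWx.
have -> : f (line i (x, h)) - f x = W x by rewrite -/(D x); lra.
have -> : (line_integral i h (fun x => `|g x|%R) x = P x + N x)%E.
  rewrite /P /N /line_integral -ge0_integralD //.
  - apply: eq_integral => t _; rewrite -EFinD; congr EFin.
    by have [] := gE (line i (x, t)).
  - by move=> t _; rewrite lee_fin.
  - apply/measurable_EFinP; apply: measurable_funTS.
    exact: (measurableT_comp (measurable_line_comp i mgp) (pair1_measurable x)).
  - by move=> t _; rewrite lee_fin.
  - apply/measurable_EFinP; apply: measurable_funTS.
    exact: (measurableT_comp (measurable_line_comp i mgn) (pair1_measurable x)).
rewrite -(fineK Px) -(fineK Nx) -EFinD lee_fin /W.
have := fine_ge0 (P0 x); have := fine_ge0 (N0 x).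
by rewrite ler_norml; lra.
Qed.

End translation_of_weak_gradients.

(** * Level sets and the Sobolev inequality *)

Section measure_helpers.
Context d (T : measurableType d) (R : realType) (m : {measure set T -> \bar R}).

Lemma measurable_ge (F : T -> R) c : measurable_fun setT F -> measurable [set x | c <= F x].
Proof.
move=> mF; have := mF measurableT _ (measurable_itv `[c, +oo[); rewrite setTI.
by rewrite (_ : _ @^-1` _ = [set x | c <= F x]) //; apply/seteqP; split=> x /=; rewrite in_itv /= andbT.
Qed.

Lemma le_measure_ae (A B : set T) : measurable A -> measurable B ->
  {ae m, forall x, A x -> B x} -> (m A <= m B)%E.
Proof.
move=> mA mB [N [mN N0 AB]].
apply: (@le_trans _ _ (m (B `|` N))).
  apply: le_measure; rewrite ?inE //; first exact: measurableU.
  move=> x Ax; have [|nB] := pselect (B x); first by left.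
  by right; apply: AB => /= h; apply: nB; exact: h.
apply: le_trans (measureU2 _ mB mN) _.
by rewrite [X in (_ + X)%E](_ : _ = 0%E) ?adde0.
Qed.

Lemma markov_ge0 (F : T -> \bar R) (c : R) : measurable_fun setT F -> (forall x, 0 <= F x)%E ->
  0 <= c -> (c%:E * m [set x | (c%:E <= F x)%E] <= \int[m]_x F x)%E.
Proof.
move=> mF F0 c0; set A := [set x | _].
have mA : measurable A by rewrite -[X in measurable X]setTI; apply: emeasurable_fun_c_infty.
rewrite -integral_cst //; apply: (@le_trans _ _ (\int[m]_(x in A) F x)%E).
  by apply: ge0_le_integral => //; exact: measurable_funTS.
exact: ge0_subset_integral.
Qed.

Lemma ge0_intZl (f : T -> R) (k : R) : measurable_fun setT f -> (forall x, 0 <= f x) -> 0 <= k ->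
  (\int[m]_x (k * f x)%:E = k%:E * \int[m]_x (f x)%:E)%E.
Proof.
move=> mf f0 k0; under eq_integral do rewrite EFinM.
apply: ge0_integralZl => //; first exact/measurable_EFinP.
by move=> x _; rewrite lee_fin.
Qed.

Lemma ge0_intD (f g : T -> R) : measurable_fun setT f -> measurable_fun setT g ->
  (forall x, 0 <= f x) -> (forall x, 0 <= g x) ->
  (\int[m]_x (f x + g x)%:E = \int[m]_x (f x)%:E + \int[m]_x (g x)%:E)%E.
Proof.
move=> mf mg f0 g0; under eq_integral do rewrite EFinD.
apply: ge0_integralD => //; try exact/measurable_EFinP.
  by move=> x _; rewrite lee_fin.
by move=> x _; rewrite lee_fin.
Qed.

Lemma ge0_le_int (f g : T -> R) : measurable_fun setT f -> measurable_fun setT g ->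
  (forall x, 0 <= f x) -> (forall x, f x <= g x) ->
  (\int[m]_x (f x)%:E <= \int[m]_x (g x)%:E)%E.
Proof.
move=> mf mg f0 fg; apply: ge0_le_integral => //; try exact/measurable_EFinP.
  by move=> x _; rewrite lee_fin.
by move=> x _; rewrite lee_fin.
Qed.

Lemma int_ge0 (f : T -> R) : (forall x, 0 <= f x) -> (0 <= \int[m]_x (f x)%:E)%E.
Proof. by move=> f0; apply: integral_ge0 => x _; rewrite lee_fin. Qed.

End measure_helpers.

(** * The weak-type estimate from translations *)

Section level_sets.
Context {R : realType}.
Local Notation leb := (@lebesgue_measure R).
Implicit Types (f g : R3 R -> R) (p r q : R).

(** Powers of norms are used in place of norms: they are additive over disjoint sets and scales, and
    a quasi-triangle inequality is enough for limits. *)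
Definition lpow p f : \bar R := (\int[mu3]_x (`|f x| `^ p)%:E)%E.

Lemma measurable_powR_norm p f : measurable_fun setT f -> measurable_fun setT (fun x => `|f x| `^ p).
Proof. by move=> mf; apply: (measurableT_comp (measurable_powR p)); exact: measurableT_comp. Qed.

(** Young's inequality for s and c^{p-1}, equivalently: s^p / p lies above its tangent at c. *)
Lemma young_tangent p s c : 1 < p -> 0 <= s -> 0 < c ->
  s * c `^ (p - 1) <= s `^ p / p + (1 - p^-1) * c `^ p.
Proof.
move=> p1 s0 c0; have p0 : 0 < p by lra.
have q0 : 0 < p / (p - 1) by rewrite divr_gt0 //; lra.
have pq : p^-1 + (p / (p - 1))^-1 = 1.
  by rewrite invf_div; field; rewrite gt_eqF.
have := conjugate_powR s0 (powR_ge0 c (p - 1)) p0 q0 pq.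
rewrite -powRrM (_ : (p - 1) * (p / (p - 1)) = p); last first.
  by field; rewrite gt_eqF // subr_gt0.
rewrite (_ : (p / (p - 1))^-1 = 1 - p^-1); last by lra.
by rewrite [(1 - _) * _]mulrC.
Qed.

(* Young's inequality plays the role of Jensen's, and only level sets are
   needed: [h * c^p <= \int_0^h g^p] as soon as [c * h <= \int_0^h g]. *)
Lemma shift_level p i (h kappa : R) f g : 1 < p -> 0 < h -> 0 < kappa ->
  measurable_fun setT f -> measurable_fun setT g -> (forall x, 0 <= g x) ->
  {ae mu3, forall x, (`|f (line i (x, h)) - f x|%R%:E <= line_integral i h g x)%E} ->
  (((kappa / h) `^ p)%:E * mu3 [set x | (kappa <= `|f (line i (x, h)) - f x|)%R] <= lpow p g)%E.
Proof.
move=> p1 h0 k0 mf mg g0 fg; set c := kappa / h.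
have c0 : 0 < c by rewrite divr_gt0.
have cp0 : 0 < c `^ p by exact: powR_gt0.
have p0 : 0 < p by lra.
have mI : measurable (`[0, h]%classic : set (measurableTypeR R)) by exact: measurable_itv.
have hl : leb `[0, h]%classic = h%:E by rewrite lebesgue_measure_itv /= lte_fin h0 sube0.
pose gp x := g x `^ p.
have gp0 x : 0 <= gp x by exact: powR_ge0.
have mgp : measurable_fun setT gp by exact: (measurableT_comp (measurable_powR p)).
pose Q := line_integral i h gp.
have mQ : measurable_fun setT Q by exact: measurable_line_integral.
have Q0 x : (0 <= Q x)%E by exact: line_integral_ge0.
have mgl (G : R3 R -> R) x : measurable_fun setT G ->
    measurable_fun `[0%R, h]%classic (fun t : measurableTypeR R => G (line i (x, t))).
  move=> mG; apply: measurable_funTS.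
  exact: (measurableT_comp (measurable_line_comp i mG) (pair1_measurable x)).
have key x : (kappa%:E <= line_integral i h g x)%E -> ((h * c `^ p)%:E <= Q x)%E.
  move=> kL.
  have Y : ((c `^ (p - 1))%:E * line_integral i h g x <= (p^-1)%:E * Q x + ((1 - p^-1) * c `^ p * h)%:E)%E.
    rewrite /line_integral -ge0_integralZl //; last 3 first.
    - by apply/measurable_EFinP; exact: mgl.
    - by move=> t _; rewrite lee_fin.
    - by rewrite lee_fin powR_ge0.
    have -> : (((1 - p^-1) * c `^ p * h)%:E = \int[leb]_(t in `[0%R, h]) ((1 - p^-1) * c `^ p)%:E)%E.
      by rewrite integral_cst //= hl EFinM.
    rewrite -ge0_integralZl //; last 3 first.
    - by apply/measurable_EFinP; exact: mgl.
    - by move=> t _; rewrite lee_fin.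
    - by rewrite lee_fin invr_ge0 ltW.
    have cst0 : 0 <= (1 - p^-1) * c `^ p.
      by rewrite mulr_ge0 ?powR_ge0 // subr_ge0 invf_le1 ?ltW.
    rewrite -ge0_integralD //; last 2 first.
    - by move=> t _; rewrite -EFinM lee_fin mulr_ge0 // invr_ge0 ltW.
    - by apply/measurable_EFinP; apply: measurable_funM => //; exact: mgl.
    apply: ge0_le_integral => //.
    - by move=> t _; rewrite -EFinM lee_fin mulr_ge0 // powR_ge0.
    - by apply/measurable_EFinP; apply: measurable_funM => //; exact: mgl.
    - apply/measurable_EFinP; apply: measurable_funD => //; apply: measurable_funM => //; exact: mgl.
    - move=> t _; rewrite -!EFinM -EFinD lee_fin mulrC (le_trans (young_tangent p1 _ c0)) //.
      by rewrite mulrC.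
  have : (((c `^ (p - 1)) * kappa)%:E <= (p^-1)%:E * Q x + ((1 - p^-1) * c `^ p * h)%:E)%E.
    by apply: le_trans Y; rewrite EFinM lee_wpmul2l // lee_fin powR_ge0.
  (* Since c = kappa / h, the left side equals c^p h. Subtracting the Young remainder (1 - 1/p) c^p
     h leaves exactly the fraction 1/p of the claim. *)
  have -> : c `^ (p - 1) * kappa = c `^ p * h.
    by rewrite -(mulr_powRB1 (ltW c0) p0) /c; field; rewrite gt_eqF.
  move: (Q0 x); case: (Q x) => [y| |] //=; rewrite ?leey // !lee_fin => y0.
  move=> hy; have {}hy : p^-1 * (h * c `^ p) <= p^-1 * y by lra.
  by rewrite ler_pM2l ?invr_gt0 in hy.
have mE : measurable [set x | kappa <= `|f (line i (x, h)) - f x|].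
  apply: measurable_ge; apply: measurableT_comp => //; apply: measurable_funB => //.
  exact: (measurableT_comp mf (measurable_shift3 (h *: basis3 R i))).
have mF : measurable [set x | ((h * c `^ p)%:E <= Q x)%E].
  by rewrite -[X in measurable X]setTI; apply: emeasurable_fun_c_infty.
have EF : (mu3 [set x | (kappa <= `|f (line i (x, h)) - f x|)%R] <= mu3 [set x | ((h * c `^ p)%:E <= Q x)%E])%E.
  apply: le_measure_ae => //; apply: filterS fg => x hx /= kx.
  by apply: key; apply: le_trans hx; rewrite lee_fin.
have hc0 : 0 <= h * c `^ p by rewrite mulr_ge0 // ltW.
have M := @markov_ge0 _ _ _ mu3 Q _ mQ Q0 hc0.
have IQ : (\int[mu3]_x Q x = h%:E * lpow p g)%E.
  transitivity (\int[mu3]_x (Q x * ((cst 1 : R3 R -> R) x)%:E))%E.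
    by apply: eq_integral => x _; rewrite mule1.
  rewrite line_integral_adjoint //.
  have hl0 : 0 <= h by exact: ltW.
  rewrite /lpow -(ge0_intZl mu3 (measurable_powR_norm p mg) (fun x => powR_ge0 _ _) hl0).
  by apply: eq_integral => x _ /=; rewrite integral_cst //= hl mul1e -EFinM mulrC ger0_norm.
have {M} : (h%:E * ((c `^ p)%:E * mu3 [set x | (kappa <= `|f (line i (x, h)) - f x|)%R]) <= h%:E * lpow p g)%E.
  rewrite -IQ muleA -EFinM; apply: le_trans M => /=.
  by apply: lee_wpmul2l EF; rewrite lee_fin.
by rewrite lee_pmul2l // lte_fin.
Qed.

Let o0 : 'I_3 := @Ordinal 3 0 isT.
Let o1 : 'I_3 := @Ordinal 3 1 isT.
Let o2 : 'I_3 := @Ordinal 3 2 isT.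

Let add3_lines (x y : R3 R) : x + y = line o2 (line o1 (line o0 (x, y.1.1), y.1.2), y.2).
Proof.
case: x => [[x1 x2] x3]; case: y => [[y1 y2] y3]; rewrite /line /=.
have e (a b c d1 d2 d3 : R) : (a, b, c) + (d1, d2, d3) = (a + d1, b + d2, c + d3) :> R3 R by [].
have z (t a b c : R) : t *: ((a, b, c) : R3 R) = (t * a, t * b, t * c) :> R3 R by [].
by rewrite /basis3 /= !z !e !mulr0 !mulr1 !addr0.
Qed.

Definition cube (e : R) : set (R3 R) := (`[0, e]%classic `*` `[0, e]%classic) `*` `[0, e]%classic.

Lemma measurable_cube e : measurable (cube e).
Proof. by apply: measurableX; [apply: measurableX|]; exact: measurable_itv. Qed.

Lemma mu3_cube e : 0 < e -> mu3 (cube e) = (e ^+ 3)%:E.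
Proof.
move=> e0; rewrite mu3_rect; [|exact: measurable_itv..].
by rewrite lebesgue_measure_itv /= lte_fin e0 sube0 -!EFinM !exprS expr0 mulr1 mulrA.
Qed.

(* For [y] in the cube of side [eps] and [lam <= |f x|], either
   [lam / 2 <= |f (x + y)|] or one of the three coordinate steps from [x] to
   [x + y] changes [f] by [lam / 6]. Averaging over [y], the first alternative
   accounts for at most half of the measure. *)
Lemma level_by_translation p f (lam K eps : R) :
  1 < p -> measurable_fun setT f -> 0 < lam -> 0 < eps -> 0 <= K ->
  (forall i (h kappa : R), 0 < h -> 0 < kappa ->
    (((kappa / h) `^ p)%:E * mu3 [set x | (kappa <= `|f (line i (x, h)) - f x|)%R] <= K%:E)%E) ->
  (mu3 [set x | (lam <= `|f x|)%R] < +oo)%E ->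
  (mu3 [set x | (lam / 2 <= `|f x|)%R] <= (eps ^+ 3 / 2)%:E)%E ->
  (mu3 [set x | (lam <= `|f x|)%R] <= (6 * (6 * eps / lam) `^ p * K)%:E)%E.
Proof.
move=> p1 mf lam0 eps0 K0 hK Efin Fle.
have p0 : 0 < p by lra.
have mfn : measurable_fun setT (fun x => `|f x|) by exact: measurableT_comp.
set E := [set x | lam <= `|f x|] in Efin *; set F := [set x | lam / 2 <= `|f x|] in Fle *.
have mE : measurable E by exact: measurable_ge.
have mF : measurable F by exact: measurable_ge.
pose B := (6 * eps / lam) `^ p * K.
have B0 : 0 <= B by rewrite mulr_ge0 ?powR_ge0.
pose A i h := [set x | lam / 6 <= `|f (line i (x, h)) - f x|].
have mA i h : measurable (A i h).
  apply: measurable_ge; apply: measurableT_comp => //; apply: measurable_funB => //.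
  exact: (measurableT_comp mf (measurable_shift3 (h *: basis3 R i))).
have lam6 : 0 < lam / 6 by rewrite divr_gt0.
have AB i h : 0 <= h <= eps -> (mu3 (A i h) <= B%:E)%E.
  move=> /andP[h0 he]; move: h0; rewrite le_eqVlt => /predU1P[h0|h0].
    rewrite -h0 (_ : A i 0 = set0) ?measure0 ?lee_fin //; apply/seteqP; split=> // x /=.
    by rewrite /A /line /= scale0r addr0 subrr normr0; move: lam6; lra.
  have := hK i h _ h0 lam6; rewrite -/(A i h) => H.
  have -> : (mu3 (A i h) = ((h / (lam / 6)) `^ p)%:E * (((lam / 6 / h) `^ p)%:E * mu3 (A i h)))%E.
    rewrite muleA -EFinM -powRM ?divr_ge0 ?ltW //.
    rewrite (_ : h / (lam / 6) * (lam / 6 / h) = 1) ?powR1 ?mul1e //.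
    by field; rewrite !gt_eqF.
  apply: (@le_trans _ _ (((h / (lam / 6)) `^ p)%:E * K%:E)%E).
    by rewrite lee_wpmul2l // lee_fin powR_ge0.
  have hl6 : h / (lam / 6) = 6 * h / lam by field; rewrite gt_eqF.
  have le6 : 6 * h / lam <= 6 * eps / lam by rewrite ler_pM2r ?invr_gt0 // ler_pM2l.
  rewrite -EFinM lee_fin ler_wpM2r // hl6 ge0_ler_powR ?nnegrE //; first exact: ltW.
    by rewrite divr_ge0 ?mulr_ge0 // ltW.
  by rewrite divr_ge0 ?mulr_ge0 // ltW.
(* [W] marks the pairs with x in E and x + y in F. Over all y its integral is the product of the two
   measures by translation invariance ([I2]); over y in the cube it bounds the measure of E up to 3
   B ([I1]). *)
pose W (z : R3 R * R3 R) : R := \1_E z.1 * \1_F (z.1 + z.2).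
have W0 z : 0 <= W z by rewrite mulr_ge0.
have mW : measurable_fun setT W.
  apply: measurable_funM; first exact: (measurableT_comp (measurable_indic mE) measurable_fst).
  have ma : measurable_fun setT (fun z : R3 R * R3 R => z.1 + z.2 : R3 R).
    by apply: measurable_add3; [exact: measurable_fst|exact: measurable_snd].
  exact: (measurableT_comp (measurable_indic mF) ma).
pose a y := (\int[mu3]_x (W (x, y))%:E)%E.
have a0 y : (0 <= a y)%E by apply: integral_ge0 => x _; rewrite lee_fin.
have ma : measurable_fun setT a.
  apply: (@measurable_fun_fubini_tonelli_G _ _ _ _ R (@mu3s R) (fun z => (W z)%:E)).
    by apply/measurable_EFinP.
  by move=> z; rewrite lee_fin.
have Ea y : cube eps y -> (mu3 E <= a y + (3 * B)%:E)%E.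
  case: y => [[y1 y2] y3]; rewrite /cube /= !in_itv /= => -[[hy1 hy2] hy3].
  set y := ((y1, y2), y3).
  pose s1 : R3 R := (y1 : R) *: basis3 R o0; pose s2 : R3 R := s1 + (y2 : R) *: basis3 R o1.
  pose Fy := E `&` shift3 y @^-1` F.
  have mFy : measurable Fy.
    apply: measurableI => //; rewrite -[X in measurable X]setTI; exact: measurable_shift3.
  have mS (v : R3 R) (C : set (R3 R)) : measurable C -> measurable (shift3 v @^-1` C).
    by move=> mC; rewrite -[X in measurable X]setTI; exact: measurable_shift3.
  have aE : a y = mu3 Fy.
    rewrite -(setIT Fy) -integral_indic //; apply: eq_integral => x _; congr EFin.
    rewrite /W !indicE /= /Fy in_setI -natrM mulnb; congr (nat_of_bool (_ && _))%:R.
  have sub : E `<=` Fy `|` (A o0 y1 `|` (shift3 s1 @^-1` (A o1 y2) `|` shift3 s2 @^-1` (A o2 y3))).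
    move=> x Ex.
    have [h1|h1] := leP (lam / 6) (`|f (line o0 (x, y1)) - f x|); first by right; left.
    have [h2|h2] := leP (lam / 6) (`|f (line o1 (line o0 (x, y1), y2)) - f (line o0 (x, y1))|).
      by right; right; left.
    have [h3|h3] := leP (lam / 6) (`|f (line o2 (line o1 (line o0 (x, y1), y2), y3)) - f (line o1 (line o0 (x, y1), y2))|).
      right; right; right; rewrite /A /shift3 /= /s2 addrA; exact: h3.
    left; split=> //; rewrite /F /shift3 /= add3_lines /=; move: Ex; rewrite /E /=.
    move: h1 h2 h3; set u1 := f (line o0 _); set u2 := f (line o1 _); set u3 := f (line o2 _).
    have t1 := ler_normD (f x - u1) u1; have t2 := ler_normD (u1 - u2) u2; have t3 := ler_normD (u2 - u3) u3.
    rewrite !subrK in t1 t2 t3; rewrite (distrC u1) (distrC u2) (distrC u3); lra.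
  apply: (@le_trans _ _ (mu3 (Fy `|` (A o0 y1 `|` (shift3 s1 @^-1` (A o1 y2) `|` shift3 s2 @^-1` (A o2 y3)))))).
    by apply: le_measure => //; rewrite inE //; apply: measurableU => //; apply: measurableU => //; apply: measurableU; exact: mS.
  apply: le_trans (measureU2 _ mFy _) _; first by apply: measurableU => //; apply: measurableU; exact: mS.
  rewrite aE; apply: leeD => //.
  apply: le_trans (measureU2 _ (mA _ _) _) _; first by apply: measurableU; exact: mS.
  rewrite (_ : 3 * B = B + (B + B)) ?EFinD; last lra.
  apply: leeD; first exact: AB.
  apply: le_trans (measureU2 mu3 (mS s1 _ (mA o1 y2)) (mS s2 _ (mA o2 y3))) _.
  have := AB o1 _ hy2; rewrite -(mu3_shift s1 (mA o1 y2)) => t1.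
  have := AB o2 _ hy3; rewrite -(mu3_shift s2 (mA o2 y3)) => t2.
  exact: leeD t1 t2.
have mQ := measurable_cube eps; have vQ := mu3_cube eps0.
have I1 : (mu3 E * (eps ^+ 3)%:E <= \int[mu3]_y a y + (3 * B * eps ^+ 3)%:E)%E.
  rewrite -vQ -integral_cst // EFinM -vQ -integral_cst //.
  apply: (@le_trans _ _ (\int[mu3]_(y in cube eps) (a y + (3 * B)%:E))%E).
    apply: ge0_le_integral => //.
    - by apply: emeasurable_funD => //; exact: measurable_funTS.
  rewrite ge0_integralD //; last 2 first.
  - exact: measurable_funTS.
  - by move=> y _; rewrite lee_fin mulr_ge0.
  by apply: leeD => //; apply: ge0_subset_integral.
have I2 : (\int[mu3]_y a y = mu3 E * mu3 F)%E.
  rewrite /a -(@tonelli3 R _ _ (@mu3s R) (fun z => (W z)%:E)); last 2 first.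
  - by apply/measurable_EFinP.
  - by move=> z; rewrite lee_fin.
  transitivity (\int[mu3]_x ((\1_E x)%:E * mu3 F))%E.
    apply: eq_integral => x _; rewrite /W /=.
    transitivity (\int[mu3]_t (\1_E x * \1_F (shift3 x t))%:E)%E.
      by apply: eq_integral => y _; rewrite /shift3 addrC.
    have mi : measurable_fun setT (fun t => \1_F (shift3 x t) : R).
      exact: (measurableT_comp (measurable_indic mF) (measurable_shift3 x)).
    rewrite (ge0_intZl _ mi) //; congr (_ * _)%E.
    rewrite (ge0_integral_shift3 x (f := fun y => (\1_F y)%:E)) //; last by apply/measurable_EFinP.
    by rewrite integral_indic // setIT.
  by rewrite ge0_integralZr // ?integral_indic ?setIT //; apply/measurable_EFinP.
move: I1; rewrite I2 => I1.
have Efn : mu3 E \is a fin_num by rewrite ge0_fin_numE.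
(* As F has measure at most eps^3 / 2, half of the left side is absorbed; this needs E to have
   finite measure and turns the factor 3 into 6. *)
have {I1} : (mu3 E * (eps ^+ 3)%:E <= mu3 E * (eps ^+ 3 / 2)%:E + (3 * B * eps ^+ 3)%:E)%E.
  by apply: le_trans I1 _; apply: leeD => //; apply: lee_wpmul2l.
rewrite -(fineK Efn) -!EFinM -EFinD !lee_fin -mulrA -/B.
have e3 : 0 < eps ^+ 3 by exact: exprn_gt0.
move=> H; have {}H : fine (mu3 E) * eps ^+ 3 <= 6 * B * eps ^+ 3 by lra.
by rewrite ler_pM2r // /B mulrA in H.
Qed.

End level_sets.

Ltac positivity :=
  repeat first [assumption | done | apply: mulr_gt0 | apply: powR_gt0 | rewrite invr_gt0].

Lemma int_indicE d (T : measurableType d) (R : realType) (m : {measure set T -> \bar R}) (f : T -> R) A :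
  (\int[m]_(x in A) (f x)%:E = \int[m]_x (f x * \1_A x)%:E)%E.
Proof.
rewrite integral_mkcond; apply: eq_integral => x _; rewrite patchE indicE.
by case: ifP => _; rewrite ?mulr1 ?mulr0.
Qed.

(** * The level estimate and the subcritical embedding *)

Section level_estimate.
Context {R : realType}.
Local Notation leb := (@lebesgue_measure R).
Implicit Types (f g : R3 R -> R) (p r q : R).

Definition lev f (c : R) : \bar R := mu3 [set x | c <= `|f x|].

Lemma lee_div (a M : R) (x : \bar R) : 0 < a -> (a%:E * x <= M%:E)%E -> (x <= (M / a)%:E)%E.
Proof.
move=> a0 h; have ai : (0 <= (a^-1)%:E)%E by rewrite lee_fin invr_ge0 ltW.
by have := lee_wpmul2l ai h; rewrite muleA -!EFinM mulVf ?gt_eqF // mul1e mulrC.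
Qed.

Lemma chebyshev_lpow r f c : 0 < r -> 0 < c -> measurable_fun setT f ->
  ((c `^ r)%:E * lev f c <= lpow r f)%E.
Proof.
move=> r0 c0 mf; have mp := measurable_powR_norm r mf.
have mE : measurable_fun setT (fun x => (`|f x| `^ r)%:E) by exact/measurable_EFinP.
have F0 x : (0 <= (`|f x| `^ r)%:E)%E by rewrite lee_fin powR_ge0.
apply: le_trans (markov_ge0 mu3 mE F0 (powR_ge0 c r)).
apply: lee_wpmul2l; first by rewrite lee_fin powR_ge0.
apply: le_measure; rewrite ?inE; first by apply: measurable_ge; exact: measurableT_comp.
  by rewrite -[X in measurable X]setTI; apply: emeasurable_fun_c_infty.
by move=> x /= cx; rewrite lee_fin ge0_ler_powR ?nnegrE // ltW.
Qed.

(** The factors of 6 (6 eps / lam)^p that do not depend on f: with eps^3 = 2 M / (lam/2)^r the power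
    eps^p contributes (2 * 2^r)^{p/3}. *)
Definition Clev p r : R := 6 * (6 `^ p * (2 * 2 `^ r) `^ (p / 3)).

Lemma level_estimate p r f (lam K M : R) : 1 < p -> 0 < r -> measurable_fun setT f ->
  0 < lam -> 0 <= K -> 0 < M ->
  (forall i (h kappa : R), 0 < h -> 0 < kappa ->
    (((kappa / h) `^ p)%:E * mu3 [set x | (kappa <= `|f (line i (x, h)) - f x|)%R] <= K%:E)%E) ->
  (lpow r f <= M%:E)%E ->
  (lev f lam <= (Clev p r * M `^ (p / 3) * lam `^ (- (p + r * p / 3)) * K)%:E)%E.
Proof.
move=> p1 r0 mf lam0 K0 M0 hK fM; have p0 : 0 < p by lra.
have lr : 0 < (lam / 2) `^ r by rewrite powR_gt0 // divr_gt0.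
(* The volume of the cube is twice the Chebyshev bound for {|f| >= lam/2}, the smallest choice that
   [level_by_translation] is sure to accept. *)
pose v := 2 * (M / (lam / 2) `^ r); pose eps := v `^ 3^-1.
have v0 : 0 < v by rewrite mulr_gt0 // divr_gt0.
have eps0 : 0 < eps by rewrite powR_gt0.
have e3 : eps ^+ 3 = v.
  by rewrite -powR_mulrn ?ltW // -powRrM mulVf // powRr1 // ltW.
have hE : (lev f lam < +oo)%E.
  have := le_trans (chebyshev_lpow r0 lam0 mf) fM => /(lee_div (powR_gt0 r lam0)) h.
  by apply: le_lt_trans h _; rewrite ltry.
have hF : (lev f (lam / 2) <= (eps ^+ 3 / 2)%:E)%E.
  have l2 : 0 < lam / 2 by rewrite divr_gt0.
  have := le_trans (chebyshev_lpow r0 l2 mf) fM => /(lee_div (powR_gt0 r l2)) h.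
  by apply: le_trans h _; rewrite lee_fin e3 /v mulrAC divff // mul1r.
apply: le_trans (level_by_translation p1 mf lam0 eps0 K0 hK hE hF) _.
rewrite lee_fin ler_wpM2r // le_eqVlt; apply/orP; left; apply/eqP.
have two0 : 0 < 2 `^ r :> R by rewrite powR_gt0.
apply: ln_inj; [by rewrite posrE; positivity..|].
rewrite /Clev /eps /v !(lnM, ln_powR, lnV) ?posrE; try positivity.
by field.
Qed.

Lemma nneseries_le (u : (\bar R)^nat) (x : \bar R) : (forall n, 0 <= u n)%E ->
  (forall n, \sum_(0 <= i < n) u i <= x)%E -> (\sum_(0 <= i <oo) u i <= x)%E.
Proof.
move=> u0 ux; apply: lime_le; first by apply: is_cvg_nneseries => n _ _.
by apply: nearW => n; exact: ux.
Qed.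

Lemma dyadic_scale (c y : R) : 0 < c -> c <= y -> exists k, 2 ^+ k * c <= y < 2 ^+ k.+1 * c.
Proof.
move=> c0 cy; have y0 : 0 < y by exact: lt_le_trans cy.
have ex : exists n, y < 2 ^+ n * c.
  have [n hn] : exists n : nat, y / c < n%:R.
    by exists (Num.truncn (y / c)).+1; exact: Num.Theory.truncnS_gt.
  exists n; rewrite -ltr_pdivrMr //; apply: lt_le_trans hn _.
  by rewrite -natrX ler_nat; exact: ltnW (ltn_expl _ _).
case: (ex_minnP ex) => -[|n]; first by rewrite expr0 mul1r ltNge cy.
move=> yn hmin; exists n; rewrite yn andbT leNgt; apply/negP => /hmin.
by rewrite ltnn.
Qed.

(** A dyadic layer-cake estimate: where 2^k c <= |f| < 2^{k+1} c, the k-th term alone already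
    dominates the integrand, and each shell lies in the level set at its lower end. *)
Lemma dyadic_bound s c f : 0 < s -> 0 < c -> measurable_fun setT f ->
  (\int[mu3]_(x in [set x | (c <= `|f x|)%R]) (`|f x| `^ s)%:E <=
   \sum_(0 <= k <oo) ((2 ^+ k.+1 * c) `^ s)%:E * lev f (2 ^+ k * c))%E.
Proof.
move=> s0 c0 mf; have mfn : measurable_fun setT (fun x => `|f x|) by exact: measurableT_comp.
pose E k := [set x | 2 ^+ k * c <= `|f x|].
have mE k : measurable (E k) by exact: measurable_ge.
pose u k x := (((2 ^+ k.+1 * c) `^ s) * \1_(E k) x)%:E.
have u0 k x : (0 <= u k x)%E by rewrite lee_fin mulr_ge0 // powR_ge0.
have mu k : measurable_fun setT (u k).
  by apply/measurable_EFinP; apply: measurable_funM => //; exact: measurable_indic.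
have Iu k : (\int[mu3]_x u k x = ((2 ^+ k.+1 * c) `^ s)%:E * lev f (2 ^+ k * c))%E.
  have mi : measurable_fun setT (\1_(E k) : R3 R -> R) by exact: measurable_indic.
  rewrite /u (ge0_intZl mu3 mi) ?powR_ge0 //.
  by rewrite (integral_indic mu3 measurableT (mE k)) setIT.
under eq_eseriesr do rewrite -Iu.
rewrite -integral_nneseries // int_indicE.
have mE0 : measurable [set x | c <= `|f x|] by exact: measurable_ge.
apply: ge0_le_integral => //.
- by apply/measurable_EFinP; apply: measurable_funM; [exact: measurable_powR_norm|exact: measurable_indic].
- by apply: ge0_emeasurable_sum.
- move=> x _; rewrite indicE; have [/set_mem /= cx|_] := boolP (x \in _); last first.
    by rewrite mulr0; apply: nneseries_ge0.
  rewrite mulr1.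
  have [k /andP[k1 k2]] := dyadic_scale c0 cx.
  apply: le_trans (nneseries_lim_ge k.+1 _) => //; rewrite big_nat_recr //=.
  rewrite -[leLHS]add0e; apply: leeD; first by apply: sume_ge0 => i _.
  rewrite lee_fin /u indicE mem_set // mulr1 ge0_ler_powR ?nnegrE //; [exact: ltW| |exact: ltW].
  by rewrite mulr_ge0 ?exprn_ge0 // ltW.
Qed.

Lemma geometric_sum_le (z : R) n : 0 <= z < 1 -> \sum_(0 <= i < n) z ^+ i <= (1 - z)^-1.
Proof.
move=> /andP[z0 z1]; have z1' : 0 < 1 - z by rewrite subr_gt0.
rewrite -(ler_pM2l z1') divff ?gt_eqF // big_mkord -opprB mulNr -subrX1 opprB.
by rewrite lerBlDr lerDl exprn_ge0.
Qed.

(* Dyadic summation of the level estimate: the exponent grows as long as it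
   stays below [p + r p / 3], whose fixed point is the Sobolev exponent. *)
Lemma lpow_improve p r r' f (K : R) : 1 < p -> 0 < r -> p <= r' < p + r * p / 3 ->
  measurable_fun setT f -> 0 <= K ->
  (forall i (h kappa : R), 0 < h -> 0 < kappa ->
    (((kappa / h) `^ p)%:E * mu3 [set x | (kappa <= `|f (line i (x, h)) - f x|)%R] <= K%:E)%E) ->
  (lpow p f < +oo)%E -> (lpow r f < +oo)%E -> (lpow r' f < +oo)%E.
Proof.
move=> p1 r0 /andP[pr' r'lt] mf K0 hK fp fr; have p0 : 0 < p by lra.
have r'0 : 0 < r' by lra.
pose M := fine (lpow r f) + 1.
have lr0 : (0 <= lpow r f)%E by apply: int_ge0 => x; exact: powR_ge0.
have M0 : 0 < M by rewrite ltr_wpDl // fine_ge0.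
have fM : (lpow r f <= M%:E)%E.
  rewrite -(fineK (x := lpow r f)) ?ge0_fin_numE // lee_fin /M; lra.
have mfn : measurable_fun setT (fun x => `|f x|) by exact: measurableT_comp.
pose E := [set x | 1 <= `|f x|].
have mE : measurable E by exact: measurable_ge.
(* Where |f| < 1 the larger exponent r' gives the smaller power, so only the set {|f| >= 1} needs
   level estimates. *)
have split1 : (lpow r' f <= lpow p f + \int[mu3]_(x in E) (`|f x| `^ r')%:E)%E.
  have mr' := measurable_powR_norm r' mf; have mp := measurable_powR_norm p mf.
  have mE1 : measurable_fun setT (\1_E : R3 R -> R) by exact: measurable_indic.
  have mrE : measurable_fun setT (fun x => `|f x| `^ r' * \1_E x) by exact: measurable_funM.
  have rE0 x : 0 <= `|f x| `^ r' * \1_E x by rewrite mulr_ge0 // powR_ge0.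
  rewrite int_indicE /lpow -ge0_intD //.
  apply: ge0_le_int => //; [exact: measurable_funD|move=> x].
  rewrite indicE; have [h|/negP h] := boolP (x \in E); first by rewrite mulr1 lerDr powR_ge0.
  rewrite mulr0 addr0; have f1 : `|f x| < 1.
    by rewrite ltNge; apply/negP => hh; apply: h; apply/mem_set.
  have [->|f0] := eqVneq (f x) 0; first by rewrite normr0 !powR0 ?gt_eqF.
  by rewrite ger_powR // normr_gt0 f0 ltW.
apply: le_lt_trans split1 _; apply: lte_add_pinfty; first exact: fp.
apply: le_lt_trans (dyadic_bound r'0 ltr01 mf) _.
pose z : R := 2 `^ (r' - (p + r * p / 3)).
have z0 : 0 <= z by exact: powR_ge0.
(* [z] is the ratio of the dyadic series; it is below 1 precisely because r' < p + r p / 3. *)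
have z1 : z < 1 by rewrite /z /powR pnatr_eq0 /= expR_lt1 nmulr_rlt0 ?ln_gt0 ?ltr1n // subr_lt0.
pose C := 2 `^ r' * (Clev p r * M `^ (p / 3) * K).
have C0 : 0 <= C by rewrite /C /Clev !mulr_ge0 ?powR_ge0.
apply: (@le_lt_trans _ _ (C * (1 - z)^-1)%:E); last exact: ltry.
apply: nneseries_le => [n|n]; first by rewrite mule_ge0 // lee_fin powR_ge0.
apply: (@le_trans _ _ (\sum_(0 <= k < n) (C * z ^+ k)%:E)%E).
  apply: lee_sum => k _; rewrite !mulr1.
  have l0 : 0 < (2 ^+ k : R) by rewrite exprn_gt0.
  have h := level_estimate p1 r0 mf l0 K0 M0 hK fM.
  apply: (le_trans (lee_wpmul2l _ h)); first by rewrite lee_fin powR_ge0.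
  rewrite -EFinM lee_fin le_eqVlt; apply/orP; left; apply/eqP.
  have <- : (2 ^+ k) `^ r' * (2 ^+ k) `^ (- (p + r * p / 3)) = z ^+ k.
    rewrite /z -!powR_mulrn ?powR_ge0 // -!powRrM -powRD; last by rewrite pnatr_eq0 implybT.
    by congr powR; ring.
  by rewrite /C exprS powRM ?(ltW l0) //; ring.
by rewrite sumEFin lee_fin -mulr_sumr ler_wpM2l // geometric_sum_le // z0.
Qed.

(** Iteration of [lpow_improve] in steps of [d]. For r <= t the available gain p + r p / 3 - r is at
    least p - t (1 - p/3) = 2 d, and d > 0 because t < p*; so t is reached after finitely many
    steps. *)
Lemma sobolev_embedding p t f (K : R) : 1 < p -> p < 3 -> p <= t < sobolev_exp p ->
  measurable_fun setT f -> 0 <= K ->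
  (forall i (h kappa : R), 0 < h -> 0 < kappa ->
    (((kappa / h) `^ p)%:E * mu3 [set x | (kappa <= `|f (line i (x, h)) - f x|)%R] <= K%:E)%E) ->
  (lpow p f < +oo)%E -> (lpow t f < +oo)%E.
Proof.
move=> p1 p3 /andP[pt tps] mf K0 hK fp.
have p30 : 0 < 3 - p by lra.
have tps' : t * (1 - p / 3) < p.
  move: tps; rewrite /sobolev_exp ltr_pdivlMr // => h.
  by rewrite -(ltr_pM2l (x := 3)) //; lra.
pose d := (p - t * (1 - p / 3)) / 2; have d0 : 0 < d by rewrite divr_gt0 // subr_gt0.
have step n : (lpow (Num.min t (p + n%:R * d))%R f < +oo)%E.
  elim: n => [|n IH]; first by rewrite mul0r addr0 (min_idPr pt).
  have [h|h] := leP t (p + n%:R * d).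
    move: IH; rewrite (min_idPl h) (min_idPl _) //; apply: le_trans h _.
    by rewrite lerD2l ler_pM2r // ler_nat.
  move: IH; rewrite (min_idPr (ltW h)) => IH.
  have nd : 0 <= n%:R * d by rewrite mulr_ge0 // ltW.
  have hr : 0 < p + n%:R * d by lra.
  apply: lpow_improve hK fp IH => //.
  rewrite -natr1 mulrDl mul1r addrA le_min pt /=; apply/andP; split; first by lra.
  rewrite gt_min; apply/orP; right; rewrite -addrA ltrD2l.
  move: h nd; rewrite /d; set y := n%:R * _ => h nd.
  have : (p + y) * (1 - p / 3) <= t * (1 - p / 3) by rewrite ler_wpM2r ?ltW //; lra.
  lra.
have [n hn] : exists n : nat, (t - p) / d < n%:R by exists (Num.truncn ((t - p) / d)).+1; exact: Num.Theory.truncnS_gt.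
have := step n; rewrite (min_idPl _) //.
by move: hn; rewrite ltr_pdivrMr // => hn; lra.
Qed.

End level_estimate.

(** * A smooth truncation *)

Section truncation.
Context {R : realType}.
Local Notation leb := (@lebesgue_measure R).

Let pos (x : R) := Num.max x 0.

Let is_derive_sqr_pos (x : R) : is_derive x (1 : R) (fun y : R => pos y ^+ 2) (2 * pos x).
Proof.
have [x0|x0|->] := ltgtP x 0.
- rewrite {2}/pos (max_idPr (ltW x0)) mulr0.
  apply: (@near_eq_is_derive _ _ _ (cst 0)) => //.
    by near=> y; rewrite /pos (max_idPr _) ?expr0n //; apply/ltW; near: y; exact: lt_nbhsl.
- rewrite {2}/pos (max_idPl (ltW x0)).
  apply: (@near_eq_is_derive _ _ _ (fun y : R => y ^+ 2)) => //.
    by near=> y; rewrite /pos (max_idPl _) //; apply/ltW; near: y; exact: lt_nbhsr.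
  by apply: is_derive_eq; rewrite /GRing.scale /=; ring.
- rewrite {2}/pos (max_idPl (lexx 0)) mulr0; apply: (@is_derive0_quad _ _ 1) => h.
  rewrite mul1r ger0_norm ?sqr_ge0 // /pos; have [h0|h0] := leP h 0.
    by rewrite expr0n /= sqr_ge0.
  by [].
Unshelve. all: by end_near. Qed.

(* A C^1 truncation: [0] on [s <= 1], [1] on [2 <= s]. *)
Definition ramp (s : R) : R :=
  2 * (pos (s - 1) ^+ 2 - 2 * pos (s - 3 / 2) ^+ 2 + pos (s - 2) ^+ 2).
Definition ramp' (s : R) : R := 4 * (pos (s - 1) - 2 * pos (s - 3 / 2) + pos (s - 2)).

Lemma is_derive_ramp (s : R) : is_derive s (1 : R) ramp (ramp' s).
Proof.
have dp (c : R) : is_derive s (1 : R) (fun y : R => pos (y - c) ^+ 2) (2 * pos (s - c)).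
  have := @is_derive1_comp R (fun y : R => pos y ^+ 2) (fun y : R => y - c) s _ _ (is_derive_sqr_pos _).
  move=> /(_ 1); rewrite mulr1; apply.
  by apply: is_derive_eq; rewrite subr0.
have d1 := dp 1; have d2 := dp (3 / 2); have d3 := dp 2.
by apply: is_derive_eq; rewrite /ramp' /GRing.scale /=; ring.
Qed.

(** The bound by |s| keeps the L^{q*} norm of the truncation below that of the rescaled function;
    the value 1 from 2 on places the upper level set inside {truncation >= 1}. *)
Lemma ramp_bounds s : [/\ 0 <= ramp s, ramp s <= `|s| & 2 <= s -> ramp s = 1].
Proof.
have n1 := ler_norm s; have n2 : 0 <= `|s| by [].
rewrite /ramp /pos; have [h1|h1] := leP (s - 1) 0; have [h2|h2] := leP (s - 3 / 2) 0;
  have [h3|h3] := leP (s - 2) 0; split; try lra; try nra.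
Qed.

(** The support in ]1, 2[ localises the gradient of a truncation at height b to the shell b < g < 2
    b. *)
Lemma ramp'_bounds s : `|ramp' s| <= 2 * \1_(`]1, 2[%classic : set R) s.
Proof.
have -> : \1_(`]1, 2[%classic : set R) s = (1 < s < 2)%R%:R :> R.
  by rewrite indicE; congr (nat_of_bool _)%:R; apply/idP/idP; rewrite inE /= in_itv.
rewrite ler_norml /ramp' /pos; have [h1|h1] := leP (s - 1) 0; have [h2|h2] := leP (s - 3 / 2) 0;
  have [h3|h3] := leP (s - 2) 0; have [/andP[hh hh']|] := boolP (1 < s < 2);
  rewrite ?negb_and -?leNgt; try (move=> /orP[hh|hh]); rewrite /=; lra.
Qed.

Lemma continuous_ramp' : continuous ramp'.
Proof.
have cp (c : R) : continuous (fun s => pos (s - c)).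
  move=> x; apply: (@continuous_comp _ _ _ (fun s : R => s - c) pos).
    by apply: cvgB; [exact: cvg_id|exact: cvg_cst].
  by apply: continuous_max; [exact: cvg_id|exact: cvg_cst].
move=> x; rewrite /ramp'; apply: cvgM; first exact: cvg_cst.
apply: cvgD; last exact: cp.
by apply: cvgB; [exact: cp|apply: cvgM; [exact: cvg_cst|exact: cp]].
Qed.

Lemma ftc_le (F f : R -> R) (h : R) : 0 < h -> continuous f ->
  (forall t : R, is_derive t (1 : R) F (f t)) ->
  ((`|F h - F 0|)%:E <= \int[leb]_(t in `[0%R, h]) (`|f t|)%:E)%E.
Proof.
move=> h0 cf dF.
have cF : continuous F.
  by move=> x; apply: differentiable_continuous; apply/derivable1_diffP; have [] := dF x.
have e : (\int[leb]_(t in `[0%R, h]) (f t)%:E = (F h)%:E - (F 0)%:E)%E.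
  apply: continuous_FTC2 => //.
  - by apply: continuous_subspaceT.
  - split; first by move=> x _; have [] := dF x.
    + by apply: cvg_at_right_filter; exact: cF.
    + by apply: cvg_at_left_filter; exact: cF.
  - by move=> x _; rewrite derive1E; have [] := dF x.
rewrite -EFinB in e; have := congr1 abse e => /= <-.
apply: (@le_trans _ _ (\int[leb]_(t in `[0%R, h]) `|(f t)%:E|)%E) => //.
apply: le_abse_integral => //; apply/measurable_EFinP; apply: measurable_funTS.
exact: continuous_measurable_fun.
Qed.

End truncation.

(** * The Sobolev inequality for test functions *)

Section sobolev_test_functions.
Context {R : realType}.
Local Notation leb := (@lebesgue_measure R).
Implicit Types (f g : R3 R -> R) (p r q : R).

Lemma lpow_bounded_compact r f : 0 < r -> bounded_compact f -> (lpow r f < +oo)%E.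
Proof.
move=> r0 [mf [M fM]]; pose N := Num.max M 0.
have mb := @measurable_box R M.
have m1 : measurable_fun setT (\1_(box M) : R3 R -> R) by exact: measurable_indic.
apply: (@le_lt_trans _ _ (\int[mu3]_x (N `^ r * \1_(box M) x)%:E)%E).
  apply: ge0_le_int => //; [exact: measurable_powR_norm|exact: measurable_funM|move=> x].
  have := fM x; rewrite indicE; case: (_ \in _) => /=; rewrite ?mulr1 ?mulr0 => fx.
    by rewrite ge0_ler_powR ?nnegrE //; [exact: ltW|rewrite le_max lexx orbT|rewrite le_max fx].
  by move: fx; rewrite normr_le0 => /eqP ->; rewrite normr0 powR0 ?gt_eqF.
rewrite (ge0_intZl mu3 m1) ?powR_ge0 // (integral_indic mu3 measurableT mb) setIT.
have hb := mu3_box_lty M; have hb0 := measure_ge0 mu3 (box M).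
by rewrite lte_mul_pinfty // lee_fin powR_ge0.
Qed.

Lemma measurable_test f : test_function f -> measurable_fun setT f.
Proof. by move=> tf; exact: continuous3_measurable (test_continuous tf). Qed.

Lemma test_line f i x (t : R) : test_function f ->
  is_derive t (1 : R) (fun s : R => f (line i (x, s))) (grad f i (line i (x, t))).
Proof. by move=> tf; apply: (is_derive_line (x := x)); exact: test_derivable. Qed.

Lemma continuous_line f i x : continuous f -> continuous (fun t : R => f (line i (x, t))).
Proof.
move=> cf t; apply: (@continuous_comp _ _ _ (fun t : R => line i (x, t)) f); last exact: cf.
by rewrite /line /=; apply: cvgD; [exact: cvg_cst|apply: cvgZl; exact: cvg_id].
Qed.

Lemma sobolev_expE q : q < 3 -> q + sobolev_exp q * q / 3 = sobolev_exp q.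
Proof. by move=> q3; rewrite /sobolev_exp; field; rewrite subr_eq0 gt_eqF. Qed.

Lemma sobolev_exp_gt q : 0 < q -> q < 3 -> q < sobolev_exp q.
Proof. by move=> q0 q3; rewrite /sobolev_exp ltr_pdivlMr ?subr_gt0 //; nra. Qed.

(** [level_estimate] at level 1 for [ramp] applied to g / b, with r = q*. Rescaling gives b^{-q*} M
    for the function and (2/b)^q K for the gradient; the exponents of b add up to -(q + q* q / 3) =
    -q* since q* is the fixed point. *)
Lemma sobolev_level q g (b M K : R) : 1 < q -> q < 3 -> test_function g -> 0 < b -> 0 < M -> 0 <= K ->
  (lpow (sobolev_exp q) g <= M%:E)%E ->
  (forall i, \int[mu3]_(x in [set x | (b < g x < 2 * b)%R]) (`|grad g i x| `^ q)%:E <= K%:E)%E ->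
  (mu3 [set x | (2 * b <= g x)%R] <=
   (Clev q (sobolev_exp q) * 2 `^ q * M `^ (q / 3) * b `^ (- sobolev_exp q) * K)%:E)%E.
Proof.
set qs := sobolev_exp q => q1 q3 tg b0 M0 K0 gM gK.
have q0 : 0 < q by lra.
have qs0 : 0 < qs by apply: lt_trans (sobolev_exp_gt q0 q3).
have mg := measurable_test tg.
pose f x := ramp (b^-1 * g x).
have cr : continuous (@ramp R).
  by move=> s; apply: differentiable_continuous; apply/derivable1_diffP; have [] := is_derive_ramp s.
have mr : measurable_fun setT (@ramp R) by exact: continuous_measurable_fun.
have mr' : measurable_fun setT (@ramp' R) by apply: continuous_measurable_fun; exact: continuous_ramp'.
have mbg : measurable_fun setT (fun x => b^-1 * g x) by exact: measurable_funM.
have mf : measurable_fun setT f by exact: (measurableT_comp mr).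
have b'0 : 0 < b^-1 by rewrite invr_gt0.
have fM : (lpow qs f <= (b `^ (- qs) * M)%:E)%E.
  rewrite EFinM; apply: (@le_trans _ _ ((b `^ (- qs))%:E * lpow qs g)%E); last first.
    by apply: lee_wpmul2l => //; rewrite lee_fin powR_ge0.
  rewrite /lpow -ge0_intZl ?powR_ge0 //; last exact: measurable_powR_norm.
  apply: ge0_le_int => //; first exact: measurable_powR_norm.
    by apply: measurable_funM => //; exact: measurable_powR_norm.
  move=> x; have [r0 r1 _] := ramp_bounds (b^-1 * g x).
  have -> : b `^ (- qs) = b^-1 `^ qs by rewrite -(powR_inv1 (ltW b0)) -powRrM mulN1r.
  rewrite -powRM ?invr_ge0 ?(ltW b0) //.
  have bg0 : 0 <= b^-1 * `|g x| by rewrite mulr_ge0 // ltW.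
  rewrite (ge0_ler_powR (ltW qs0)) ?nnegrE //.
  by rewrite /f ger0_norm // (le_trans r1) // normrM gtr0_norm.
pose G i x := `|ramp' (b^-1 * g x) * (b^-1 * grad g i x)|.
have mgr i : measurable_fun setT (grad g i) by exact: measurable_test (test_grad i tg).
have mG i : measurable_fun setT (G i).
  apply: measurableT_comp => //; apply: measurable_funM; last exact: measurable_funM.
  exact: (measurableT_comp mr').
pose S := [set x | b < g x < 2 * b].
have mS : measurable S.
  have := mg measurableT _ (measurable_itv `]b, 2 * b[); rewrite setTI.
  by rewrite (_ : _ @^-1` _ = S) //; apply/seteqP; split=> x /=; rewrite in_itv.
have lG i : (lpow q (G i) <= ((2 / b) `^ q * K)%:E)%E.
  have mgq := measurable_powR_norm q (mgr i).
  have m1 : measurable_fun setT (\1_S : R3 R -> R) by exact: measurable_indic.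
  have mS1 : measurable_fun setT (fun x => `|grad g i x| `^ q * \1_S x) by exact: measurable_funM.
  rewrite EFinM; apply: (@le_trans _ _ (((2 / b) `^ q)%:E * \int[mu3]_(x in S) (`|grad g i x| `^ q)%:E)%E); last first.
    by apply: lee_wpmul2l; rewrite ?lee_fin ?powR_ge0 //; exact: gK.
  rewrite int_indicE -ge0_intZl ?powR_ge0 //.
  apply: ge0_le_int => //; [exact: measurable_powR_norm|exact: measurable_funM|move=> x].
  rewrite normr_id /G (normrM (ramp' _)) (normrM b^-1) (gtr0_norm b'0); have := ramp'_bounds (b^-1 * g x).
  have -> : \1_(`]1, 2[%classic : set R) (b^-1 * g x) = \1_S x :> R.
    rewrite !indicE; congr (nat_of_bool _)%:R; apply/idP/idP; rewrite !inE /= in_itv /= mulrC;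
      by rewrite ltr_pdivlMr // ltr_pdivrMr // mul1r.
  have [->|->] : \1_S x = 0 :> R \/ \1_S x = 1 :> R by rewrite indicE; case: (_ \in _); [right|left].
    rewrite !mulr0 normr_le0 => /eqP ->; by rewrite normr0 mul0r powR0 ?gt_eqF.
  rewrite !mulr1 => h; have b20 : 0 <= 2 / b by rewrite divr_ge0 // ltW.
  rewrite -powRM // ge0_ler_powR ?nnegrE ?mulr_ge0 //; try exact: ltW.
  by rewrite mulrA ler_wpM2r // ler_wpM2r // ltW.
have hK i (h kappa : R) : 0 < h -> 0 < kappa ->
    (((kappa / h) `^ q)%:E * mu3 [set x | (kappa <= `|f (line i (x, h)) - f x|)%R] <= ((2 / b) `^ q * K)%:E)%E.
  move=> h0 k0; apply: le_trans (lG i).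
  apply: (shift_level q1 h0 k0 mf (mG i)) => [x|]; [exact: normr_ge0|apply: aeW => x].
  have cl (F : R3 R -> R) : test_function F -> continuous (fun t : R => F (line i (x, t))).
    by move=> tF; apply: continuous_line; exact: test_continuous.
  pose F := fun t : R => ramp (b^-1 * g (line i (x, t))).
  pose F' := fun t : R => ramp' (b^-1 * g (line i (x, t))) * (b^-1 * grad g i (line i (x, t))).
  have dF (t : R) : is_derive t (1 : R) F (F' t).
    apply: (@is_derive1_comp R (@ramp R) (fun t : R => b^-1 * g (line i (x, t)))); first exact: is_derive_ramp.
    have dl := test_line i x t tg.
    by have := is_deriveZ b^-1 dl.
  have cF' : continuous F'.
    move=> t; apply: cvgM; last by apply: cvgM; [exact: cvg_cst|apply: cl; exact: test_grad].
    apply: (@continuous_comp _ _ _ (fun t : R => b^-1 * g (line i (x, t))) (@ramp' R)); last exact: continuous_ramp'.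
    by apply: cvgM; [exact: cvg_cst|exact: cl].
  have := ftc_le h0 cF' dF; rewrite /F /line_integral /f.
  by rewrite (_ : line i (x, 0) = x) // /line /= scale0r addr0.
have M'0 : 0 < b `^ (- qs) * M by rewrite mulr_gt0 // powR_gt0.
have K'0 : 0 <= (2 / b) `^ q * K by rewrite mulr_ge0 // powR_ge0.
have := level_estimate q1 qs0 mf ltr01 K'0 M'0 hK fM.
rewrite powR1 mulr1 => L; apply: le_trans (le_trans _ L) _.
  apply: le_measure; rewrite ?inE.
  - by apply: measurable_ge.
  - by apply: measurable_ge; exact: measurableT_comp.
  - move=> x /= hx; rewrite /f; have [_ _ ->] := ramp_bounds (b^-1 * g x); first by rewrite normr1.
    by rewrite mulrC ler_pdivlMr.
rewrite lee_fin mulrA ler_wpM2r // le_eqVlt; apply/orP; left; apply/eqP.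
have C0 : 0 < Clev q qs by rewrite /Clev; positivity.
rewrite -!mulrA; congr (_ * _).
apply: ln_inj; [by rewrite posrE; positivity..|].
rewrite !(lnM, ln_powR, lnV) ?posrE; try positivity.
have /= := congr1 (fun y => y * ln b) (sobolev_expE q3); rewrite -/qs; lra.
Qed.

Lemma trivIset_scales g (b : R) : 0 < b ->
  trivIset setT (fun k => [set x : R3 R | 2 ^+ k * b < `|g x| < 2 * (2 ^+ k * b)]).
Proof.
move=> b0; apply/trivIsetP => j k _ _; wlog jk : j k / (j < k)%N.
  by move=> h; rewrite neq_ltn => /orP[jk|jk]; [|rewrite setIC]; apply: h => //; rewrite ltn_eqF.
move=> _; apply/seteqP; split=> // x [/= /andP[_ h1] /andP[h2 _]].
have := lt_trans h2 h1; rewrite mulrA ltr_pM2r // -exprS ltNge => /negP; apply.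
by apply: ler_weXn2l; rewrite ?ler1n.
Qed.

(** The first 2 accounts for both signs of g, 4^{q*} for the ratio between the upper end 4c of a
    shell and c, 2^q for the slope of the ramp, and 3 for the coordinates. *)
Definition Csob q : R := 2 * 4 `^ sobolev_exp q * Clev q (sobolev_exp q) * 2 `^ q * 3.

(** At height c the weight (4c)^{q*} cancels the c^{-q*} of [sobolev_level], so every scale
    contributes a constant times the gradient integral over its own shell c < |g| < 2c. Convergence
    comes from disjointness of the shells instead of geometric decay. *)
Lemma sobolev_scales q g (b M K : R) : 1 < q -> q < 3 -> test_function g -> 0 < b -> 0 < M -> 0 <= K ->
  (lpow (sobolev_exp q) g <= M%:E)%E -> (forall i, (lpow q (grad g i) <= K%:E)%E) ->
  (\int[mu3]_(x in [set x | (2 * b <= `|g x|)%R]) (`|g x| `^ sobolev_exp q)%:E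
     <= (Csob q * M `^ (q / 3) * K)%:E)%E.
Proof.
set qs := sobolev_exp q => q1 q3 tg b0 M0 K0 gM gK.
have q0 : 0 < q by lra.
have qs0 : 0 < qs by apply: lt_trans (sobolev_exp_gt q0 q3).
have mg := measurable_test tg.
have mgr i : measurable_fun setT (grad g i) by exact: measurable_test (test_grad i tg).
pose S (c : R) := [set x | c < `|g x| < 2 * c].
have mS c : measurable (S c).
  have mgn : measurable_fun setT (fun x => `|g x|) by exact: measurableT_comp.
  have := mgn measurableT _ (measurable_itv `]c, 2 * c[); rewrite setTI.
  by rewrite (_ : _ @^-1` _ = S c) //; apply/seteqP; split=> x /=; rewrite in_itv.
pose D i c := (\int[mu3]_(x in S c) (`|grad g i x| `^ q)%:E)%E.
have mq i : measurable_fun setT (fun x => (`|grad g i x| `^ q)%:E).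
  by apply/measurable_EFinP; exact: measurable_powR_norm.
have D0 i c : (0 <= D i c)%E by apply: integral_ge0 => x _; rewrite lee_fin powR_ge0.
have DK i c : (D i c <= K%:E)%E.
  by apply: le_trans (gK i); apply: ge0_subset_integral => // x _; rewrite lee_fin powR_ge0.
have Dfin i c : D i c \is a fin_num.
  by rewrite ge0_fin_numE // (le_lt_trans (DK i c)) // ltry.
(* [sobolev_level] takes one bound for all three directions, so the directional integrals over the
   shell are summed. *)
pose B c := \sum_(i < 3) fine (D i c).
have B0 c : 0 <= B c by apply: sumr_ge0 => i _; exact: fine_ge0.
have DB i c : (D i c <= (B c)%:E)%E.
  rewrite -(fineK (Dfin i c)) lee_fin /B (bigD1 i) //= lerDl.
  by apply: sumr_ge0 => j _; exact: fine_ge0.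
pose C1 := Clev q qs * 2 `^ q * M `^ (q / 3).
have C10 : 0 <= C1 by rewrite /C1 /Clev !mulr_ge0 ?powR_ge0.
have lvl c : 0 < c -> (lev g (2 * c) <= (2 * C1 * c `^ (- qs) * B c)%:E)%E.
  move=> c0; pose g' x := (-1) * g x.
  have tg' : test_function g' by exact: testZ.
  have half (h : R3 R -> R) : test_function h -> (forall x, `|h x| = `|g x|) ->
      (forall i x, `|grad h i x| = `|grad g i x|) ->
      (mu3 [set x | (2 * c <= h x)%R] <= (C1 * c `^ (- qs) * B c)%:E)%E.
    move=> th hg hgr; apply: (sobolev_level q1 q3 th c0 M0 (B0 c)).
      by rewrite /lpow; under eq_integral do rewrite hg.
    move=> i; under eq_integral do rewrite hgr.
    apply: le_trans (DB i c); apply: ge0_subset_integral => //.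
    - have mh := measurable_test th.
      have := mh measurableT _ (measurable_itv `]c, 2 * c[); rewrite setTI.
      by rewrite (_ : _ @^-1` _ = [set x | c < h x < 2 * c]) //; apply/seteqP; split=> x /=; rewrite in_itv.
    - exact: measurable_funTS.
    - move=> x /= /andP[h1 h2]; rewrite /S /= -hg ger0_norm ?h1 ?h2 //.
      by apply: ltW; exact: lt_trans h1.
  have h1 := half g tg (fun x => erefl) (fun i x => erefl).
  have h2 : (mu3 [set x | (2 * c <= g' x)%R] <= (C1 * c `^ (- qs) * B c)%:E)%E.
    apply: half => // [x|i x]; first by rewrite /g' mulN1r normrN.
    by rewrite /g' gradZ // mulN1r normrN.
  have -> : 2 * C1 * c `^ (- qs) * B c = C1 * c `^ (- qs) * B c + C1 * c `^ (- qs) * B c by ring.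
  rewrite EFinD; apply: le_trans (leeD h1 h2).
  have m1 : measurable [set x | 2 * c <= g x] by exact: measurable_ge.
  have m2 : measurable [set x | 2 * c <= g' x] by apply: measurable_ge; exact: measurable_test.
  apply: le_trans (measureU2 mu3 m1 m2); apply: le_measure; rewrite ?inE.
  - by apply: measurable_ge; exact: measurableT_comp.
  - exact: measurableU.
  - by move=> x /=; rewrite /g' mulN1r ler_normr => /orP[]; [left|right].
have b20 : 0 < 2 * b by rewrite mulr_gt0.
apply: le_trans (dyadic_bound qs0 b20 mg) _.
pose C2 := 4 `^ qs * (2 * C1).
have C20 : 0 <= C2 by rewrite /C2 !mulr_ge0 ?powR_ge0.
apply: nneseries_le => [k|n]; first by rewrite mule_ge0 // lee_fin powR_ge0.
apply: (@le_trans _ _ (\sum_(0 <= k < n) (C2 * B (2 ^+ k * b))%:E)%E).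
  apply: lee_sum => k _; have c0 : 0 < 2 ^+ k * b by rewrite mulr_gt0 // exprn_gt0.
  rewrite (_ : 2 ^+ k * (2 * b) = 2 * (2 ^+ k * b)); last by ring.
  rewrite (_ : 2 ^+ k.+1 * (2 * b) = 4 * (2 ^+ k * b)); last by rewrite exprS; ring.
  move: c0; set c := _ * b => c0.
  apply: (le_trans (lee_wpmul2l _ (lvl c c0))); first by rewrite lee_fin powR_ge0.
  rewrite -EFinM lee_fin powRM ?(ltW c0) // /C2 powRN.
  rewrite (_ : 4 `^ qs * c `^ qs * _ = (c `^ qs / c `^ qs) * (4 `^ qs * (2 * C1) * B c)); last by ring.
  by rewrite divff ?mul1r // gt_eqF // powR_gt0.
rewrite sumEFin lee_fin -mulr_sumr exchange_big /=.
have Dsum i : \sum_(0 <= k < n) fine (D i (2 ^+ k * b)) <= K.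
  rewrite -lee_fin -sumEFin; under eq_bigr do rewrite fineK //.
  apply: (@le_trans _ _ (\sum_(0 <= k <oo) D i (2 ^+ k * b)%R)%E).
    by apply: nneseries_lim_ge => k _ _.
  apply: le_trans (gK i); rewrite /D -(@ge0_integral_bigcup _ _ _ mu3 (fun k => S (2 ^+ k * b))) //.
  - apply: ge0_subset_integral => //; first exact: bigcup_measurable.
  - exact: measurable_funTS.
  - exact: trivIset_scales.
apply: (@le_trans _ _ (C2 * (K *+ 3))).
  rewrite ler_wpM2l // (le_trans (ler_sum _ (fun i _ => Dsum i))) //.
  by rewrite sumr_const card_ord.
by rewrite /C2 /C1 /Csob -/qs -mulr_natr le_eqVlt; apply/orP; left; apply/eqP; ring.
Qed.

(** Letting the lowest scale tend to 0 gives M <= C M^{q/3} K for M = [lpow (sobolev_exp q) g]. As g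
    is bounded with compact support, M is finite and M^{q/3} can be divided out; 1 - q/3 = q / q*
    gives the final exponent. *)
Lemma sobolev_test q g (K : R) : 1 < q -> q < 3 -> test_function g -> 0 <= K ->
  (forall i, (lpow q (grad g i) <= K%:E)%E) ->
  (lpow (sobolev_exp q) g <= ((Csob q * K) `^ (sobolev_exp q / q))%:E)%E.
Proof.
set qs := sobolev_exp q => q1 q3 tg K0 gK.
have q0 : 0 < q by lra.
have qs0 : 0 < qs by apply: lt_trans (sobolev_exp_gt q0 q3).
have bg := bounded_compact_test tg; have mg := measurable_test tg.
have l0 : (0 <= lpow qs g)%E by apply: int_ge0 => x; exact: powR_ge0.
have lfin : lpow qs g \is a fin_num by rewrite ge0_fin_numE // lpow_bounded_compact.
rewrite -(fineK lfin) lee_fin; set M := fine _.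
have : 0 <= M by exact: fine_ge0.
rewrite le_eqVlt => /predU1P[<-|M0]; first exact: powR_ge0.
have gM : (lpow qs g <= M%:E)%E by rewrite fineK.
have [N N0 gN] := test_support tg.
have [V V0 hV] : exists2 V : R, 0 <= V & mu3 (box N) = V%:E.
  exists (fine (mu3 (box N))); first exact: fine_ge0.
  by rewrite fineK // ge0_fin_numE // mu3_box_lty.
have main : M <= Csob q * M `^ (q / 3) * K.
  apply/ler_addgt0Pr => e e0.
  have V1 : 0 < V + 1 by lra.
  (* Chosen so that the part of the support where |g| < 2 b contributes at most (2 b)^{q*} V <= e;
     [V + 1] avoids a zero denominator. *)
  pose b := (e / (V + 1)) `^ (qs^-1) / 2.
  have b0 : 0 < b by rewrite /b divr_gt0 // powR_gt0 // divr_gt0.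
  have hb : (2 * b) `^ qs * V <= e.
    rewrite (_ : 2 * b = (e / (V + 1)) `^ qs^-1); last by rewrite /b; field.
    have eV : 0 <= e / (V + 1) by rewrite divr_ge0 // ltW.
    rewrite -powRrM mulVf ?gt_eqF // powRr1 //.
    by rewrite mulrAC ler_pdivrMr // ler_pM2l //; lra.
  have S := sobolev_scales q1 q3 tg b0 M0 K0 gM gK.
  rewrite -lee_fin EFinD fineK //.
  pose A := [set x | 2 * b <= `|g x|].
  have mA : measurable A by apply: measurable_ge; exact: measurableT_comp.
  have mq := measurable_powR_norm qs mg.
  have mb := measurable_box N.
  have m1 : measurable_fun setT (\1_A : R3 R -> R) by exact: measurable_indic.
  have m2 : measurable_fun setT (\1_(box N) : R3 R -> R) by exact: measurable_indic.
  have mA1 : measurable_fun setT (fun x => `|g x| `^ qs * \1_A x) by exact: measurable_funM.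
  have mA2 : measurable_fun setT (fun x => (2 * b) `^ qs * \1_(box N) x) by exact: measurable_funM.
  apply: (@le_trans _ _ (\int[mu3]_x (`|g x| `^ qs * \1_A x + (2 * b) `^ qs * \1_(box N) x)%:E)%E).
    apply: ge0_le_int => //; first exact: measurable_funD.
    move=> x; have [Ax|nA] := boolP (x \in A).
      by rewrite !indicE Ax mulr1 lerDl mulr_ge0 // powR_ge0.
    rewrite !indicE (negbTE nA) mulr0 add0r; have [bx|nb] := boolP (x \in _); last first.
      by rewrite gN ?normr0 ?powR0 ?gt_eqF ?mulr0 // => /mem_set; exact/negP.
    rewrite mulr1 ge0_ler_powR ?nnegrE //; [exact: ltW|by rewrite mulr_ge0 // ltW|].
    by rewrite leNgt; apply/negP => h; move/negP: nA; apply; apply/mem_set; exact: ltW.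
  rewrite ge0_intD //; last by move=> x; rewrite mulr_ge0 // powR_ge0.
  apply: leeD; first by rewrite -int_indicE.
  by rewrite ge0_intZl ?powR_ge0 // integral_indic // setIT hV -EFinM lee_fin.
have C0 : 0 <= Csob q by rewrite /Csob /Clev !mulr_ge0 ?powR_ge0.
have e1 : 1 - q / 3 = q / qs.
  by rewrite /qs /sobolev_exp; field; rewrite subr_eq0 !gt_eqF.
have m' : M `^ (q / qs) <= Csob q * K.
  rewrite -(ler_pM2l (powR_gt0 (q / 3) M0)) -powRD; last by rewrite (gt_eqF M0) implybT.
  rewrite -e1 addrCA subrr addr0 (powRr1 (ltW M0)) mulrCA mulrA.
  exact: main.
have -> : M = (M `^ (q / qs)) `^ (qs / q).
  rewrite -powRrM mulrA divfK ?gt_eqF // divff ?gt_eqF // powRr1 //; exact: ltW.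
have qq : 0 <= qs / q by rewrite divr_ge0 // ltW.
by rewrite (ge0_ler_powR qq) ?nnegrE ?powR_ge0 ?mulr_ge0.
Qed.

End sobolev_test_functions.

(** * Uniform convexity and monotonicity *)

Section vector_inequalities.
Context {R : realType}.
Implicit Types (a b : 'I_3 -> R) (q s t : R).

(** [dot3] and [norm3] at a point are convertible to [dotv] and [nv], so vector inequalities
    transfer to fields directly. *)
Definition dotv a b : R := \sum_(i < 3) a i * b i.
Definition nv a : R := Num.sqrt (dotv a a).

Lemma nv_ge0 a : 0 <= nv a. Proof. exact: sqrtr_ge0. Qed.

Lemma dotv_ge0 a : 0 <= dotv a a.
Proof. by apply: sumr_ge0 => i _; rewrite -expr2 sqr_ge0. Qed.

Lemma nv_sqr a : nv a ^+ 2 = dotv a a.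
Proof. by rewrite sqr_sqrtr // dotv_ge0. Qed.

Lemma nvN a : nv (fun i => - a i) = nv a.
Proof. by congr Num.sqrt; apply: eq_bigr => i _; rewrite mulrNN. Qed.

Lemma nvZ (c : R) a : nv (fun i => c * a i) = `|c| * nv a.
Proof.
rewrite -sqrtr_sqr -sqrtrM ?sqr_ge0 //; congr Num.sqrt.
by rewrite /dotv mulr_sumr; apply: eq_bigr => i _; ring.
Qed.

Lemma nv_coord a i : `|a i| <= nv a.
Proof.
rewrite -(ler_pXn2r (n := 2)) ?nnegrE ?nv_ge0 // nv_sqr real_normK ?num_real // /dotv.
rewrite (bigD1 i) //= -expr2 lerDl; apply: sumr_ge0 => j _; rewrite -expr2; exact: sqr_ge0.
Qed.

Lemma cauchy_schwarz a b : `|dotv a b| <= nv a * nv b.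
Proof.
rewrite -(ler_pXn2r (n := 2)) ?nnegrE ?mulr_ge0 ?nv_ge0 // exprMn !nv_sqr real_normK ?num_real //.
rewrite /dotv !big_ord_recl !big_ord0 !addr0.
set a0 := a _; set a1 := a _; set a2 := a _; set b0 := b _; set b1 := b _; set b2 := b _.
rewrite -subr_ge0.
have -> : (a0 * a0 + (a1 * a1 + a2 * a2)) * (b0 * b0 + (b1 * b1 + b2 * b2)) -
   (a0 * b0 + (a1 * b1 + a2 * b2)) ^+ 2 =
   (a0 * b1 - a1 * b0) ^+ 2 + (a0 * b2 - a2 * b0) ^+ 2 + (a1 * b2 - a2 * b1) ^+ 2 by ring.
by rewrite !addr_ge0 // sqr_ge0.
Qed.

Lemma dotvD2 a b (c : R) : dotv (fun i => a i + c * b i) (fun i => a i + c * b i) =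
  dotv a a + 2 * c * dotv a b + c ^+ 2 * dotv b b.
Proof. by rewrite /dotv !big_ord_recl !big_ord0; ring. Qed.

Lemma nvD a b : nv (fun i => a i + b i) <= nv a + nv b.
Proof.
have n0 := addr_ge0 (nv_ge0 a) (nv_ge0 b).
rewrite -(ler_pXn2r (n := 2)) ?nnegrE ?nv_ge0 // sqrrD !nv_sqr.
have -> : (fun i => a i + b i) = (fun i => a i + 1 * b i) by apply/funext => i; rewrite mul1r.
rewrite dotvD2 expr1n mul1r mulr1; have := cauchy_schwarz a b; rewrite ler_norml => /andP[_].
by move: (nv a * nv b) => x; lra.
Qed.

Lemma nvB a b : nv (fun i => a i - b i) <= nv a + nv b.
Proof. by apply: le_trans (nvD a (fun i => - b i)) _; rewrite nvN. Qed.

Lemma nv_le_sum a : nv a <= \sum_(i < 3) `|a i|.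
Proof.
have s0 : 0 <= \sum_(i < 3) `|a i| by apply: sumr_ge0.
rewrite -(ler_pXn2r (n := 2)) ?nnegrE ?nv_ge0 // nv_sqr /dotv.
have h i : a i * a i = `|a i| * `|a i| by rewrite -normrM ger0_norm // -expr2 sqr_ge0.
under eq_bigr do rewrite h.
have key (x y z : R) : 0 <= x -> 0 <= y -> 0 <= z ->
    x * x + (y * y + (z * z + 0)) <= (x + (y + (z + 0))) ^+ 2.
  move=> x0 y0 z0; have := mulr_ge0 x0 y0; have := mulr_ge0 x0 z0; have := mulr_ge0 y0 z0.
  by rewrite !addr0 expr2; lra.
by rewrite !big_ord_recl !big_ord0; exact: key.
Qed.

Lemma parallelogram a b :
  nv (fun i => (a i + b i) / 2) ^+ 2 = (nv a ^+ 2 + nv b ^+ 2) / 2 - nv (fun i => a i - b i) ^+ 2 / 4.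
Proof. by rewrite !nv_sqr /dotv !big_ord_recl !big_ord0; field. Qed.

Lemma powR_tangent q s t : 1 < q -> 0 <= s -> 0 < t ->
  t `^ q + q * t `^ (q - 1) * (s - t) <= s `^ q.
Proof.
move=> q1 s0 t0; have := young_tangent q1 s0 t0; have q0 : 0 < q by lra.
have e : t `^ q = t * t `^ (q - 1) by rewrite mulr_powRB1 // ltW.
rewrite e -(ler_pM2l q0); set y := t `^ (q - 1).
rewrite (_ : q * (s `^ q / q + _) = s `^ q + (q - 1) * (t * y)); last by field; rewrite gt_eqF.
lra.
Qed.

Lemma powR_sum_le q s t : 0 < q -> 0 <= s -> 0 <= t -> (s + t) `^ q <= 2 `^ q * (s `^ q + t `^ q).
Proof.
move=> q0 s0 t0; wlog st : s t s0 t0 / s <= t.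
  by move=> h; have [|/ltW] := leP s t; [|rewrite addrC [X in _ * X]addrC]; apply: h.
apply: (@le_trans _ _ ((2 * t) `^ q)).
  by rewrite (ge0_ler_powR (ltW q0)) ?nnegrE ?addr_ge0 ?mulr_ge0 //; lra.
by rewrite powRM // ler_wpM2l ?powR_ge0 // lerDr powR_ge0.
Qed.

Lemma powR_mid_convex q s t : 1 < q -> 0 <= s -> 0 <= t ->
  ((s + t) / 2) `^ q <= (s `^ q + t `^ q) / 2.
Proof.
move=> q1 s0 t0; have q0 : 0 < q by lra.
have := addr_ge0 s0 t0; rewrite le_eqVlt => /predU1P[<-|st0].
  by rewrite mul0r powR0 ?gt_eqF // divr_ge0 // addr_ge0 // powR_ge0.
have m0 : 0 < (s + t) / 2 by rewrite divr_gt0.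
have := powR_tangent q1 s0 m0; have := powR_tangent q1 t0 m0.
set X := _ `^ q; set Y := q * _; set S := s `^ q; set T := t `^ q.
move=> h1 h2; have : Y * (s - (s + t) / 2) + Y * (t - (s + t) / 2) = 0 by field.
lra.
Qed.

(** Tangents at 1 give only the weak inequality. Reaching 1 + e through 1 + e/2, where the slope is
    strictly larger than q, makes it strict. *)
Lemma bernoulli_strict q (e : R) : 1 < q -> 0 < e < 1 -> 2 < (1 + e) `^ q + (1 - e) `^ q.
Proof.
move=> q1 /andP[e0 e1]; have q0 : 0 < q by lra.
have z0 : 0 < 1 + e / 2 by lra.
have h1 : (1 + e / 2) `^ q + q * (1 + e / 2) `^ (q - 1) * (1 + e - (1 + e / 2)) <= (1 + e) `^ q.
  by apply: powR_tangent => //; lra.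
have h2 : 1 `^ q + q * 1 `^ (q - 1) * (1 + e / 2 - 1) <= (1 + e / 2) `^ q.
  by apply: powR_tangent => //; lra.
have h3 : 1 `^ q + q * 1 `^ (q - 1) * (1 - e - 1) <= (1 - e) `^ q.
  by apply: powR_tangent => //; lra.
have h4 : 1 < (1 + e / 2) `^ (q - 1).
  by rewrite /powR gt_eqF // expR_gt1 mulr_gt0 // ?ln_gt0; lra.
rewrite !powR1 !mulr1 in h2 h3; move: h1 h2 h3 h4.
set A := (1 + e / 2) `^ (q - 1); set B := _ `^ q; set C := _ `^ q; set D := _ `^ q.
move=> h1 h2 h3 h4.
have qe : 0 < q * e by rewrite mulr_gt0.
have : q * e < q * e * A by rewrite ltr_pMr.
lra.
Qed.

(** By homogeneity s = m (1 + x) and t = m (1 - x) with e <= x <= 1. The sum (1 + x)^q + (1 - x)^q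
    is at least its value at e, which exceeds 2 by 2 k. *)
Lemma scalar_uniform_convex q (e : R) : 1 < q -> 0 < e < 1 ->
  exists2 k, 0 < k & forall s t, 0 <= s -> 0 <= t -> e * (s + t) <= `|s - t| ->
    (1 + k) * ((s + t) / 2) `^ q <= (s `^ q + t `^ q) / 2.
Proof.
move=> q1 e01; have q0 : 0 < q by lra.
have := bernoulli_strict q1 e01; move: e01 => /andP[e0 e1].
set f := _ + _ => f2; exists ((f - 2) / 2); first by lra.
move=> s t s0 t0; wlog st : s t s0 t0 / t <= s.
  move=> h; have [|/ltW] := leP t s; first exact: h.
  by move=> ts; rewrite distrC [s + t]addrC [s `^ q + _]addrC; apply: h.
rewrite ger0_norm ?subr_ge0 // => est.
have := addr_ge0 s0 t0; rewrite le_eqVlt => /predU1P[<-|st0].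
  by rewrite mul0r powR0 ?gt_eqF // mulr0 divr_ge0 // addr_ge0 // powR_ge0.
set m := (s + t) / 2; have m0 : 0 < m by rewrite divr_gt0.
pose x := (s - t) / (s + t).
have sE : s = m * (1 + x) by rewrite /m /x; field; rewrite gt_eqF.
have tE : t = m * (1 - x) by rewrite /m /x; field; rewrite gt_eqF.
have xe : e <= x by rewrite /x ler_pdivlMr.
have x1 : x <= 1 by rewrite /x ler_pdivrMr //; lra.
clearbody m x; rewrite sE tE !powRM ?(ltW m0) //; try lra.
have mq : 0 < m `^ q by rewrite powR_gt0.
have h1 : (1 + e) `^ q + q * (1 + e) `^ (q - 1) * (1 + x - (1 + e)) <= (1 + x) `^ q.
  by apply: powR_tangent => //; lra.
have h2 : (1 - e) `^ q + q * (1 - e) `^ (q - 1) * (1 - x - (1 - e)) <= (1 - x) `^ q.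
  by apply: powR_tangent => //; lra.
have h3 : (1 - e) `^ (q - 1) <= (1 + e) `^ (q - 1).
  by rewrite ge0_ler_powR ?nnegrE; lra.
have : f <= (1 + x) `^ q + (1 - x) `^ q.
  move: h1 h2 h3; rewrite /f; set A := _ `^ (q - 1); set B := _ `^ (q - 1).
  have qx : 0 <= q * (x - e) by rewrite mulr_ge0 //; lra.
  move=> h1 h2 h3; have := ler_wpM2l qx h3; lra.
move=> hf; have := ler_wpM2l (ltW mq) hf; lra.
Qed.

(** The midpoint convexity defect of |.|^q. It vanishes only for a = b, and the bounds below make
    this quantitative. *)
Definition vgap q a b : R :=
  (nv a `^ q + nv b `^ q) / 2 - nv (fun i => (a i + b i) / 2) `^ q.

Let mid_le a b : nv (fun i => (a i + b i) / 2) <= (nv a + nv b) / 2.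
Proof.
have -> : (fun i => (a i + b i) / 2) = (fun i => 2^-1 * (a i + b i)) by apply/funext => i; rewrite mulrC.
by rewrite nvZ ger0_norm // mulrC ler_pM2r // nvD.
Qed.

Lemma vgap_ge0 q a b : 1 < q -> 0 <= vgap q a b.
Proof.
move=> q1; rewrite subr_ge0; apply: le_trans (powR_mid_convex q1 (nv_ge0 a) (nv_ge0 b)).
have q0 : 0 <= q by lra.
by rewrite (ge0_ler_powR q0) ?nnegrE ?nv_ge0 ?mid_le // divr_ge0 // addr_ge0 // nv_ge0.
Qed.

(* Either the moduli differ, and one-dimensional strict convexity applies, or
   they almost agree, and the parallelogram law shortens the midpoint. *)
Lemma vgap_separated q (d : R) : 1 < q -> 0 < d < 1 ->
  exists2 c, 0 < c & forall a b, d * (nv a + nv b) <= nv (fun i => a i - b i) ->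
    c * (nv a `^ q + nv b `^ q) <= vgap q a b.
Proof.
move=> q1 /andP[d0 d1]; have q0 : 0 < q by lra.
pose e := d / 2; have e01 : 0 < e < 1 by rewrite /e; lra.
have [k k0 hk] := scalar_uniform_convex q1 e01.
(* If |s - t| < e (s + t) and |a - b| >= d (s + t), the parallelogram law gives |(a + b)/2|^2 <= (1
   + e^2 - d^2) ((s + t)/2)^2, and e = d/2. *)
pose z := 1 - 3 * d ^+ 2 / 4.
have d2 : 0 < d ^+ 2 < 1 by rewrite exprn_gt0 // expr_lt1 // ltW.
have z01 : 0 < z < 1 by rewrite /z; lra.
pose th := Num.sqrt z `^ q.
have th1 : th < 1.
  have sz0 : 0 < Num.sqrt z by rewrite sqrtr_gt0; lra.
  have sz1 : Num.sqrt z < 1 by rewrite -sqrtr1 ltr_sqrt; lra.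
  by rewrite /th /powR gt_eqF // expR_lt1 pmulr_rlt0 // ln_lt0 // sz0.
pose c := Num.min (k / (1 + k) / 2) ((1 - th) / 2).
have c0 : 0 < c by rewrite lt_min !divr_gt0 //; lra.
exists c => // a b hd; set s := nv a in hd *; set t := nv b in hd *.
have s0 : 0 <= s := nv_ge0 a; have t0 : 0 <= t := nv_ge0 b.
have S0 : 0 <= s `^ q + t `^ q by rewrite addr_ge0 // powR_ge0.
have m0 : 0 <= (s + t) / 2 by rewrite divr_ge0 // addr_ge0.
have mc := mid_le a b; rewrite -/s -/t in mc.
rewrite /vgap -/s -/t; set w := nv (fun i => (a i + b i) / 2) in mc *.
have w0 : 0 <= w by exact: nv_ge0.
have wq : w `^ q <= ((s + t) / 2) `^ q by rewrite (ge0_ler_powR (ltW q0)) ?nnegrE.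
have [h|h] := leP (e * (s + t)) `|s - t|.
  have {}hk := hk _ _ s0 t0 h.
  apply: (@le_trans _ _ (k / (1 + k) / 2 * (s `^ q + t `^ q))).
    by rewrite ler_wpM2r // ge_min lexx.
  have k1 : 0 < 1 + k by lra.
  have : ((s + t) / 2) `^ q <= (s `^ q + t `^ q) / 2 / (1 + k) by rewrite ler_pdivlMr // mulrC.
  set X := s `^ q + t `^ q; rewrite (_ : k / (1 + k) / 2 * X = X / 2 - X / 2 / (1 + k)); first lra.
  by field; rewrite gt_eqF.
apply: (@le_trans _ _ ((1 - th) / 2 * (s `^ q + t `^ q))).
  by rewrite ler_wpM2r // ge_min lexx orbT.
have w2 : w ^+ 2 <= z * ((s + t) / 2) ^+ 2.
  rewrite /w parallelogram -/s -/t.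
  have h1 : (d * (s + t)) ^+ 2 <= nv (fun i => a i - b i) ^+ 2.
    by rewrite ler_pXn2r ?nnegrE ?nv_ge0 // mulr_ge0 ?addr_ge0 // ltW.
  have h2 : (s - t) ^+ 2 <= (e * (s + t)) ^+ 2.
    rewrite -[leLHS]real_normK ?num_real // ler_pXn2r ?nnegrE //; first exact: ltW.
    by rewrite mulr_ge0 ?addr_ge0 //; case/andP: e01 => /ltW.
  move: h1 h2; rewrite /z /e; move: (nv _ ^+ 2) => y; rewrite !exprMn !expr2; lra.
have wz : w <= Num.sqrt z * ((s + t) / 2).
  have zm : 0 <= Num.sqrt z * ((s + t) / 2) by rewrite mulr_ge0 ?sqrtr_ge0.
  rewrite -(ler_pXn2r (n := 2)) ?nnegrE // exprMn [Num.sqrt z ^+ 2]sqr_sqrtr //.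
  by case/andP: z01 => /ltW.
have : w `^ q <= th * ((s + t) / 2) `^ q.
  by rewrite /th -powRM ?sqrtr_ge0 // (ge0_ler_powR (ltW q0)) ?nnegrE // mulr_ge0 ?sqrtr_ge0.
have th0 : 0 <= th by exact: powR_ge0.
have := ler_wpM2l th0 (powR_mid_convex q1 s0 t0); lra.
Qed.

(** Pairs with |a - b| < d (|a| + |b|) are paid for by the [e] term, the others by the defect. The
    form is the same for all q > 1, where Clarkson's inequalities would split at q = 2. *)
Lemma vgap_bound q (e : R) : 1 < q -> 0 < e -> exists2 C, 0 < C &
  forall a b, nv (fun i => a i - b i) `^ q <= e * (nv a `^ q + nv b `^ q) + C * vgap q a b.
Proof.
move=> q1 e0; have q0 : 0 < q by lra.
pose d := Num.min (2^-1) ((e / 2 `^ q) `^ q^-1).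
have e2 : 0 < e / 2 `^ q by rewrite divr_gt0 // powR_gt0.
have d0 : 0 < d by rewrite lt_min invr_gt0 ltr0n powR_gt0.
have d1 : d < 1 by rewrite gt_min; apply/orP; left; lra.
have dq : d `^ q <= e / 2 `^ q.
  apply: (@le_trans _ _ (((e / 2 `^ q) `^ q^-1) `^ q)).
    by rewrite (ge0_ler_powR (ltW q0)) ?nnegrE ?powR_ge0 ?(ltW d0) // ge_min lexx orbT.
  by rewrite -powRrM mulVf ?gt_eqF // powRr1 // ltW.
have d01 : 0 < d < 1 by rewrite d0 d1.
have [c c0 hc] := vgap_separated q1 d01.
exists (2 `^ q / c) => [|a b]; first by rewrite divr_gt0 // powR_gt0.
have g0 := vgap_ge0 a b q1.
have S0 : 0 <= nv a `^ q + nv b `^ q by rewrite addr_ge0 // powR_ge0.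
have st := addr_ge0 (nv_ge0 a) (nv_ge0 b).
have hs := powR_sum_le q0 (nv_ge0 a) (nv_ge0 b).
have q20 : 0 < 2 `^ q :> R by rewrite powR_gt0.
have [h|h] := leP (d * (nv a + nv b)) (nv (fun i => a i - b i)).
  have {}hc := hc a b h.
  apply: (@le_trans _ _ (2 `^ q / c * vgap q a b)); last by rewrite lerDr mulr_ge0 // ltW.
  apply: (@le_trans _ _ ((nv a + nv b) `^ q)).
    by rewrite (ge0_ler_powR (ltW q0)) ?nnegrE ?nv_ge0 ?nvB.
  apply: le_trans hs _; rewrite -mulrA ler_pM2l // mulrC ler_pdivlMr // mulrC; exact: hc.
apply: (@le_trans _ _ (e * (nv a `^ q + nv b `^ q))); last first.
  by rewrite lerDl mulr_ge0 // divr_ge0 // ltW.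
apply: (@le_trans _ _ ((d * (nv a + nv b)) `^ q)).
  by rewrite (ge0_ler_powR (ltW q0)) ?nnegrE ?nv_ge0 ?mulr_ge0 // ltW.
rewrite powRM ?(ltW d0) //; apply: (@le_trans _ _ (e / 2 `^ q * (2 `^ q * (nv a `^ q + nv b `^ q)))).
  by apply: ler_pM => //; exact: powR_ge0.
by rewrite mulrA divfK // gt_eqF.
Qed.

(** With k^q = 1 + e: if |b| <= (k - 1) |a| then |a + b| <= k |a|; otherwise |a| is controlled by
    |b| and |a + b| <= k / (k - 1) |b|. *)
Lemma nv_add_bound q (e : R) : 1 < q -> 0 < e -> exists2 C, 0 < C &
  forall a b, nv (fun i => a i + b i) `^ q <= (1 + e) * nv a `^ q + C * nv b `^ q.
Proof.
move=> q1 e0; have q0 : 0 < q by lra.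
pose k := (1 + e) `^ q^-1.
have k1 : 1 < k by rewrite /k /powR gt_eqF ?expR_gt1 ?mulr_gt0 ?invr_gt0 ?ln_gt0 //; lra.
have kq : k `^ q = 1 + e by rewrite -powRrM mulVf ?gt_eqF // powRr1 //; lra.
pose C := k / (k - 1); have k10 : 0 < k - 1 by lra.
have C0 : 0 < C by rewrite divr_gt0 //; lra.
exists (C `^ q) => [|a b]; first exact: powR_gt0.
have k0 : 0 <= k by lra.
rewrite -kq -!powRM ?nv_ge0 ?(ltW C0) //.
have na := nv_ge0 a; have nb := nv_ge0 b; have nab := nvD a b.
have [h|h] := leP (nv b) ((k - 1) * nv a).
  apply: (@le_trans _ _ ((k * nv a) `^ q)); last by rewrite lerDl powR_ge0.
  by rewrite (ge0_ler_powR (ltW q0)) ?nnegrE ?nv_ge0 ?mulr_ge0 //; lra.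
apply: (@le_trans _ _ ((C * nv b) `^ q)); last by rewrite lerDr powR_ge0.
have Cb : 0 <= C * nv b by rewrite mulr_ge0 // ltW.
rewrite (ge0_ler_powR (ltW q0)) ?nnegrE ?nv_ge0 // /C mulrAC ler_pdivlMr //; nra.
Qed.

Definition fluxv q b i : R := nv b `^ (q - 2) * b i.

Lemma dotv_flux q b a : dotv (fluxv q b) a = nv b `^ (q - 2) * dotv b a.
Proof. by rewrite /dotv mulr_sumr; apply: eq_bigr => i _; rewrite /fluxv mulrA. Qed.

Let powR_q1 q (x : R) : 0 <= x -> x `^ (q - 2) * x = if x == 0 then 0 else x `^ (q - 1).
Proof.
move=> x0; case: ifPn => [/eqP ->|xn0]; first by rewrite mulr0.
rewrite -[X in _ * X](powRr1 x0) -powRD; last by rewrite xn0 implybT.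
by congr powR; ring.
Qed.

Lemma flux_le q b a : 1 < q -> `|dotv (fluxv q b) a| <= nv b `^ (q - 1) * nv a.
Proof.
move=> q1; rewrite dotv_flux normrM ger0_norm ?powR_ge0 //.
apply: (@le_trans _ _ (nv b `^ (q - 2) * (nv b * nv a))).
  by rewrite ler_wpM2l ?powR_ge0 // cauchy_schwarz.
rewrite mulrA powR_q1 ?nv_ge0 //; case: ifPn => // /eqP ->.
by rewrite mul0r mulr_ge0 ?powR_ge0 ?nv_ge0.
Qed.

Lemma flux_self q b : 1 < q -> dotv (fluxv q b) b = nv b `^ q.
Proof.
move=> q1; rewrite dotv_flux -nv_sqr expr2 mulrA powR_q1 ?nv_ge0 //.
case: ifPn => [/eqP ->|n0]; first by rewrite mul0r powR0 // gt_eqF //; lra.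
have nb : 0 < nv b by rewrite lt_neqAle eq_sym n0 nv_ge0.
by rewrite mulrC mulr_powRB1 ?nv_ge0 //; lra.
Qed.

(** The flux at b is the gradient of |.|^q / q, so this is the supporting hyperplane inequality;
    Cauchy-Schwarz reduces it to the scalar tangent. *)
Lemma flux_tangent q a b : 1 < q ->
  nv b `^ q + q * dotv (fluxv q b) (fun i => a i - b i) <= nv a `^ q.
Proof.
move=> q1; have q0 : 0 < q by lra.
have -> : dotv (fluxv q b) (fun i => a i - b i) = dotv (fluxv q b) a - nv b `^ q.
  by rewrite -(flux_self b q1) /dotv -sumrB; apply: eq_bigr => i _; rewrite mulrBr.
have := flux_le b a q1; rewrite ler_norml => /andP[_ h].
have na := nv_ge0 a; have := nv_ge0 b; rewrite le_eqVlt => /predU1P[nb|nb].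
  have n1 : q - 1 != 0 by rewrite gt_eqF //; lra.
  rewrite -nb (powR0 n1) mul0r in h; rewrite -nb powR0 ?gt_eqF //; have := powR_ge0 (nv a) q.
  have : q * dotv (fluxv q b) a <= 0 by rewrite pmulr_rle0.
  lra.
have T := powR_tangent q1 na nb.
have e : nv b `^ q = nv b * nv b `^ (q - 1) by rewrite mulr_powRB1 // ltW.
have := ler_wpM2l (ltW q0) h; rewrite e in T *; lra.
Qed.

(** Adding the supporting hyperplane inequalities at a and at b, both evaluated at the midpoint,
    leaves the convexity defect as a quantitative lower bound. *)
Lemma flux_monotone q a b : 1 < q ->
  4 / q * vgap q a b <= dotv (fluxv q a) (fun i => a i - b i) - dotv (fluxv q b) (fun i => a i - b i).
Proof.
move=> q1; have q0 : 0 < q by lra.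
pose c i := (a i + b i) / 2.
have h1 := flux_tangent c a q1; have h2 := flux_tangent c b q1.
have e1 : dotv (fluxv q a) (fun i => c i - a i) = - 2^-1 * dotv (fluxv q a) (fun i => a i - b i).
  by rewrite /dotv mulr_sumr; apply: eq_bigr => i _; rewrite /c; field.
have e2 : dotv (fluxv q b) (fun i => c i - b i) = 2^-1 * dotv (fluxv q b) (fun i => a i - b i).
  by rewrite /dotv mulr_sumr; apply: eq_bigr => i _; rewrite /c; field.
rewrite e1 in h1; rewrite e2 in h2; rewrite /vgap -/c mulrAC ler_pdivrMr //.
lra.
Qed.

End vector_inequalities.

(** * Completeness and the space D^{1,q} *)

Section null_sequences.
Context {R : realType}.
Implicit Types u v w : nat -> \bar R.

(** Convergence to 0 for powers of norms, which are nonnegative and whose first terms may be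
    infinite. *)
Definition null u := forall e : R, 0 < e -> exists N, forall n, (N <= n)%N -> (u n <= e%:E)%E.

Lemma null_le (C : R) u v w : 0 < C -> (forall n, u n <= C%:E * (v n + w n))%E ->
  null v -> null w -> null u.
Proof.
move=> C0 uvw nv nw e e0; pose d := e / C / 2.
have d0 : 0 < d by rewrite !divr_gt0.
have [N1 h1] := nv d d0; have [N2 h2] := nw d d0.
exists (maxn N1 N2) => n; rewrite geq_max => /andP[n1 n2].
apply: le_trans (uvw n) _; apply: (@le_trans _ _ (C%:E * (d%:E + d%:E))%E).
  by apply: lee_wpmul2l; [rewrite lee_fin ltW|apply: leeD; [exact: h1|exact: h2]].
by rewrite -EFinD -EFinM lee_fin /d le_eqVlt; apply/orP; left; apply/eqP; field; rewrite gt_eqF.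
Qed.

Lemma null_le1 (C : R) u v : 0 < C -> (forall n, u n <= C%:E * v n)%E -> null v -> null u.
Proof.
move=> C0 uv nv; apply: (null_le C0 (v := v) (w := cst 0%E)) => // [n|e e0].
  by rewrite adde0.
by exists 0%N => n _; rewrite lee_fin ltW.
Qed.

Lemma null_cst0 (c : \bar R) u : null u -> (forall n, c <= u n)%E -> (0 <= c)%E -> c = 0%E.
Proof.
move=> nu cu c0; apply/eqP; rewrite eq_le c0 andbT; apply/lee_addgt0Pr => e e0.
by have [N h] := nu e e0; rewrite add0e; exact: le_trans (cu N) (h N _).
Qed.

End null_sequences.

(** * Completeness of L^r *)

Section lebesgue_spaces.
Context {R : realType}.
Implicit Types (f g : R3 R -> R) (r : R).

Lemma lpow_ge0 r f : (0 <= lpow r f)%E.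
Proof. by apply: int_ge0 => x; exact: powR_ge0. Qed.

Lemma lpowD r f g : 0 < r -> measurable_fun setT f -> measurable_fun setT g ->
  (lpow r (fun x => f x + g x)%R <= (2 `^ r)%:E * (lpow r f + lpow r g))%E.
Proof.
move=> r0 mf mg; have mfr := measurable_powR_norm r mf; have mgr := measurable_powR_norm r mg.
have mfg := measurable_funD mfr mgr.
rewrite /lpow -ge0_intD // -ge0_intZl ?powR_ge0 //.
apply: ge0_le_int => //.
- by apply: measurable_powR_norm; exact: measurable_funD.
- exact: measurable_funM.
move=> x; apply: le_trans (powR_sum_le r0 (normr_ge0 _) (normr_ge0 _)).
by rewrite (ge0_ler_powR (ltW r0)) ?nnegrE ?addr_ge0 ?ler_normD.
Qed.

Lemma lpowZ r (c : R) f : measurable_fun setT f ->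
  lpow r (fun x => c * f x) = ((`|c| `^ r)%:E * lpow r f)%E.
Proof.
move=> mf; rewrite /lpow -ge0_intZl ?powR_ge0 //; last exact: measurable_powR_norm.
by apply: eq_integral => x _; rewrite normrM powRM.
Qed.

Lemma lpowB_sym r f g : lpow r (fun x => f x - g x) = lpow r (fun x => g x - f x).
Proof. by apply: eq_integral => x _; rewrite distrC. Qed.

Lemma lpow_eq0 r f : 0 < r -> measurable_fun setT f -> lpow r f = 0%E -> {ae mu3, forall x, f x = 0}.
Proof.
move=> r0 mf f0; have mF : measurable_fun setT (fun x => (`|f x| `^ r)%:E).
  by apply/measurable_EFinP; exact: measurable_powR_norm.
have : (\int[mu3]_x `|(`|f x| `^ r)%:E| = 0)%E.
  by rewrite -[RHS]f0; apply: eq_integral => x _; rewrite gee0_abs // lee_fin powR_ge0.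
move=> /(ae_eq_integral_abs mu3 measurableT mF).1; apply: filterS => x /(_ I) /eqP.
by rewrite eqe powR_eq0 normr_eq0 => /andP[/eqP].
Qed.

Lemma eq_lpow_ae r f g : measurable_fun setT f -> measurable_fun setT g ->
  f = g %[ae mu3] -> lpow r f = lpow r g.
Proof.
move=> mf mg fg; apply: ae_eq_integral => //; try (apply/measurable_EFinP; exact: measurable_powR_norm).
by apply: filterS fg => x -> .
Qed.

Lemma continuous_powR_norm r : 0 < r -> continuous (fun x : R => `|x| `^ r).
Proof.
move=> r0 x; have [->|x0] := eqVneq x 0.
  rewrite /continuous_at normr0 powR0 ?gt_eqF //; apply/cvgrPdist_le => e e0.
  near=> y; rewrite sub0r normrN ger0_norm ?powR_ge0 //.
  have -> : e = (e `^ r^-1) `^ r by rewrite -powRrM mulVf ?gt_eqF // powRr1 // ltW.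
  rewrite (ge0_ler_powR (ltW r0)) ?nnegrE ?powR_ge0 //.
  near: y; have e'0 : 0 < e `^ r^-1 by rewrite powR_gt0.
  apply: filterS (nbhsx_ballx (0 : R) _ e'0) => y; rewrite /ball /= sub0r normrN.
  exact: ltW.
have nx : 0 < `|x| by rewrite normr_gt0.
have cp : {for `|x|, continuous (fun y : R => y `^ r)}.
  by apply: differentiable_continuous; apply/derivable1_diffP; have [] := is_derive1_powR r nx.
exact: (cvg_comp _ _ (@norm_continuous _ R^o x) cp).
Unshelve. all: by end_near. Qed.

Lemma cvg_powR_norm r (u : nat -> R) (l : R) : 0 < r -> u n @[n --> \oo] --> l ->
  `|u n| `^ r @[n --> \oo] --> `|l| `^ r.
Proof.
by move=> r0 ul; exact: (continuous_cvg _ (continuous_powR_norm r0 (x := l)) ul).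
Qed.

Lemma limn_einf_le (u : nat -> \bar R) (c : \bar R) : (forall n, u n <= c)%E -> (limn_einf u <= c)%E.
Proof.
move=> uc; rewrite limn_einf_lim; apply: lime_le; first exact: is_cvg_einfs.
apply: nearW => n; apply: le_trans (uc n); apply: ereal_inf_lbound; exists n => //=.
Qed.

(** The weights force |a_{k+1} - a_k| <= s^{1/r} 2^{-k/r}, a summable geometric sequence. *)
Lemma summable_increments_cvg (a : nat -> R) r (s : R) : 0 < r -> 0 <= s ->
  (forall k, 2 ^+ k * `|a k.+1 - a k| `^ r <= s) -> cvgn a.
Proof.
move=> r0 s0 hs; pose z : R := 2^-1 `^ r^-1.
have h0 : 0 <= 2^-1 :> R by rewrite invr_ge0.
have z0 : 0 <= z by exact: powR_ge0.
have z1 : z < 1.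
  rewrite /z /powR gt_eqF ?invr_gt0 // expR_lt1 pmulr_rlt0 ?invr_gt0 // ln_lt0 //.
  by rewrite invr_gt0 ltr0n invf_lt1 // ltr1n.
have Dk k : `|a k.+1 - a k| <= geometric (s `^ r^-1) z k.
  have hu : `|a k.+1 - a k| `^ r <= s * 2^-1 ^+ k.
    by rewrite exprVn ler_pdivlMr ?exprn_gt0 // mulrC.
  have rk0 : 0 <= 2^-1 ^+ k :> R by rewrite exprn_ge0.
  have -> : geometric (s `^ r^-1) z k = (s * 2^-1 ^+ k) `^ r^-1.
    rewrite /geometric /= powRM // -(powR_mulrn k z0) -(powR_mulrn k h0) /z -!powRrM.
    by rewrite [k%:R * _]mulrC.
  have -> : `|a k.+1 - a k| = (`|a k.+1 - a k| `^ r) `^ r^-1.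
    by rewrite -powRrM divff ?gt_eqF // powRr1.
  have ri : 0 <= r^-1 by rewrite invr_ge0 ltW.
  by rewrite (ge0_ler_powR ri) ?nnegrE ?powR_ge0 // mulr_ge0.
have ct : cvgn (series (telescope a)).
  apply: (@normed_cvg R R^o); apply: (@series_le_cvg _ _ (geometric (s `^ r^-1) z)) => //.
  - by move=> k; exact: normr_ge0.
  - by move=> k; rewrite /geometric /= mulr_ge0 ?powR_ge0 ?exprn_ge0.
  - by apply: is_cvg_geometric_series; rewrite ger0_norm.
have -> : a = (fun k => a 0%N + series (telescope a) k).
  by apply/funext => k; exact: eq_sum_telescope.
by apply: is_cvgD => //; exact: is_cvg_cst.
Qed.

(* No triangle inequality is used, only the quasi-norm: Fatou's lemma along a
   subsequence whose increments are summable with the weights [2 ^ k]. *)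
Lemma lpow_complete r (f : nat -> R3 R -> R) : 0 < r -> (forall n, measurable_fun setT (f n)) ->
  (forall e : R, 0 < e -> exists N, forall m n, (N <= m)%N -> (N <= n)%N ->
    (lpow r (fun x => f m x - f n x)%R <= e%:E)%E) ->
  exists2 g : R3 R -> R, measurable_fun setT g & null (fun n => lpow r (fun x => f n x - g x)).
Proof.
move=> r0 mf fC.
(* Increments of size 4^{-k} remain summable, as 2^{-k}, after multiplication by the weights 2^k. *)
have e4 k : 0 < (4 ^- k : R) by rewrite invr_gt0 exprn_gt0.
have [N hN] := choice (fun k => fC _ (e4 k)).
(* Summing the thresholds makes the subsequence monotone and beyond every [N k]; the summand [k]
   makes it tend to infinity. *)
pose n k := (k + \sum_(j < k.+1) N j)%N.
have nN k m : (n k <= m)%N -> (N k <= m)%N.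
  apply: leq_trans; rewrite /n big_ord_recr /= addnA; exact: leq_addl.
have nS k : (n k <= n k.+1)%N by rewrite /n [in X in (_ <= _ + X)%N]big_ord_recr /= leq_add // leq_addr.
have nk k : (k <= n k)%N by exact: leq_addr.
pose D k x := `|f (n k.+1) x - f (n k) x| `^ r.
have mfB i j : measurable_fun setT (fun x => f i x - f j x) by exact: measurable_funB.
have mD k : measurable_fun setT (D k) by exact: measurable_powR_norm.
pose u k x := (2 ^+ k * D k x)%:E.
have u0 k x : (0 <= u k x)%E by rewrite lee_fin mulr_ge0 ?exprn_ge0 ?powR_ge0.
have mu k : measurable_fun setT (u k) by apply/measurable_EFinP; exact: measurable_funM.
pose S x := (\sum_(0 <= k <oo) u k x)%E.
have S0 x : (0 <= S x)%E by exact: nneseries_ge0.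
have mS : measurable_fun setT S by apply: ge0_emeasurable_sum.
have IS : (\int[mu3]_x S x < +oo)%E.
  apply: (@le_lt_trans _ _ ((1 - 2^-1)^-1)%:E); last exact: ltry.
  rewrite /S integral_nneseries //.
  apply: nneseries_le => [k|k]; first exact: integral_ge0.
  apply: (@le_trans _ _ (\sum_(0 <= i < k) ((2^-1 : R) ^+ i)%:E)%E).
    apply: lee_sum => i _; rewrite /u ge0_intZl ?exprn_ge0 //; last by move=> x; exact: powR_ge0.
    have h : (\int[mu3]_x (D i x)%:E <= (4 ^- i)%:E)%E.
      by apply: hN; apply: nN => //; exact: nS.
    apply: (le_trans (lee_wpmul2l _ h)); first by rewrite lee_fin exprn_ge0.
    rewrite -EFinM lee_fin -exprVn -exprMn le_eqVlt; apply/orP; left; apply/eqP; congr (_ ^+ i).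
    by field.
  by rewrite sumEFin lee_fin geometric_sum_le //; lra.
have iS : mu3.-integrable setT S.
  by apply/integrableP; split=> //; under eq_integral do rewrite gee0_abs //.
have aeS := integrable_ae measurableT iS.
pose A := [set x | (S x < +oo)%E].
have mA : measurable A by rewrite -[A]setTI; exact: emeasurable_fun_infty_o.
pose h k x := f (n k) x * \1_A x.
have mh k : measurable_fun setT (h k) by apply: measurable_funM => //; exact: measurable_indic.
have cA x : A x -> cvgn (fun k => f (n k) x).
  move=> Ax; have Sf : S x \is a fin_num by rewrite ge0_fin_numE.
  pose s := fine (S x); have s0 : 0 <= s by exact: fine_ge0.
  apply: (summable_increments_cvg r0 s0) => k.
  have : (u k x <= s%:E)%E; last by rewrite /u lee_fin.
  rewrite /s fineK //; apply: le_trans (nneseries_lim_ge k.+1 _) => //.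
  by rewrite big_nat_recr //= -[leLHS]add0e; apply: leeD => //; exact: sume_ge0.
(* [h] is cut off by the set where the weighted sum is finite, so the limit exists at every point
   and is measurable. *)
pose g x := limn (h ^~ x).
have hA x : A x -> h ^~ x = fun k => f (n k) x.
  by move=> Ax; apply/funext => k; rewrite /h indicE mem_set // mulr1.
have hg x : h k x @[k --> \oo] --> g x.
  have [Ax|nAx] := pselect (A x); first by have := cA x Ax; rewrite -hA.
  have e : h ^~ x = cst 0 by apply/funext => k; rewrite /h indicE memNset // mulr0.
  have : cvgn (h ^~ x) by rewrite e; exact: is_cvg_cst.
  by [].
have mg : measurable_fun setT g by apply: (measurable_fun_cvg mh) => x _; exact: hg.
exists g => // e e0; have [M hM] := fC e e0; exists M => i Mi.
(* The shift by [M] puts all indices of the subsequence into the range of the Cauchy bound, so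
   Fatou's lemma needs no tail argument. *)
pose F k x := (`|f i x - f (n (k + M)%N) x| `^ r)%:E.
have mF k : measurable_fun setT (F k) by apply/measurable_EFinP; exact: measurable_powR_norm.
have F0 k x : (0 <= F k x)%E by rewrite lee_fin powR_ge0.
have mig : measurable_fun setT (fun x => f i x - g x) by exact: measurable_funB.
apply: (@le_trans _ _ (\int[mu3]_x limn_einf (F ^~ x))%E).
  rewrite /lpow le_eqVlt; apply/orP; left; apply/eqP; apply: ae_eq_integral => //.
  - by apply/measurable_EFinP; exact: measurable_powR_norm.
  - rewrite [X in measurable_fun _ X](_ : _ = (fun x => - limn_esup (fun k => - F k x))%E) //.
    by apply: measurableT_comp => //; apply: measurable_fun_limn_esup => k; apply: measurableT_comp.
  apply: filterS aeS => x /(_ I) Sx _.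
  have Ax : A x by rewrite /A /= ltey_eq Sx.
  have c1 : F k x @[k --> \oo] --> (`|f i x - g x| `^ r)%:E.
    apply: cvg_EFin; first exact: nearW.
    have := hg x; rewrite hA // => c; have c' := @cvg_comp _ _ _ _ _ _ _ _ (cvg_addnr M) c.
    have c2 : f i x - f (n (k + M)%N) x @[k --> \oo] --> f i x - g x.
      by apply: cvgB; [exact: cvg_cst|exact: c'].
    exact: (cvg_powR_norm r0 c2).
  by rewrite (cvg_limn_einf_sup c1).1.
apply: le_trans (fatou mu3 measurableT mF _) _ => //.
apply: limn_einf_le => k; apply: hM => //.
by apply: leq_trans (nk _); exact: leq_addl.
Qed.

End lebesgue_spaces.

(** * Hoelder pairings and L^q vector fields *)

Section pairing.
Context {R : realType}.
Implicit Types (f g k : R3 R -> R) (r q : R) (G H : 'I_3 -> R3 R -> R).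

Lemma lpow_mono r f g : 0 < r -> measurable_fun setT f -> measurable_fun setT g ->
  (forall x, `|f x| <= `|g x|) -> (lpow r f <= lpow r g)%E.
Proof.
move=> r0 mf mg fg; apply: ge0_le_int => [| |x|x]; try exact: measurable_powR_norm.
  exact: powR_ge0.
by rewrite (ge0_ler_powR (ltW r0)) ?nnegrE.
Qed.

Lemma lpow_sub_lty r f g : 0 < r -> measurable_fun setT f -> measurable_fun setT g ->
  (lpow r f < +oo)%E -> (lpow r (fun x => f x - g x)%R < +oo)%E -> (lpow r g < +oo)%E.
Proof.
move=> r0 mf mg ff fg.
have mN : measurable_fun setT (fun x => -1 * (f x - g x)).
  by apply: measurable_funM => //; exact: measurable_funB.
have e : g = (fun x => f x + -1 * (f x - g x)) by apply/funext => x; ring.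
rewrite e; apply: le_lt_trans (lpowD r0 mf mN) _.
rewrite lpowZ; last exact: measurable_funB.
rewrite normrN1 powR1 mul1e lte_mul_pinfty ?lee_fin ?powR_ge0 //.
exact: lte_add_pinfty.
Qed.

Lemma lnormE r f : 0 < r -> ('N[mu3]_r%:E [EFin \o f] `^ r = lpow r f)%E.
Proof.
by move=> r0; rewrite poweR_Lnorm // gt_eqF.
Qed.

Lemma lnorm_le r f (e : R) : 0 < r -> 0 <= e ->
  ('N[mu3]_r%:E [EFin \o f] <= e%:E)%E <-> (lpow r f <= (e `^ r)%:E)%E.
Proof.
move=> r0 e0; rewrite -lnormE //; have := Lnorm_ge0 mu3 r%:E (EFin \o f).
case: ('N[mu3]_r%:E [EFin \o f])%E => [y| |] //; last by rewrite poweRyr ?gt_eqF.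
rewrite !lee_fin => y0; split=> h.
  by rewrite (ge0_ler_powR (ltW r0)) ?nnegrE.
have ri : 0 <= r^-1 by rewrite invr_ge0 ltW.
have {}h : (y `^ r) `^ r^-1 <= (e `^ r) `^ r^-1.
  by rewrite (ge0_ler_powR ri) ?nnegrE ?powR_ge0.
by rewrite -!powRrM divff ?gt_eqF // !powRr1 in h.
Qed.

Lemma hoelder_lpow r f k (A B : R) : 1 < r -> measurable_fun setT f -> measurable_fun setT k ->
  0 <= A -> 0 <= B -> (lpow r f <= A%:E)%E -> (lpow (r / (r - 1)) k <= B%:E)%E ->
  (\int[mu3]_x `|(f x * k x)%:E| <= (A `^ r^-1 * B `^ (r / (r - 1))^-1)%:E)%E.
Proof.
move=> r1 mf mk A0 B0 fA kB; have r0 : 0 < r by lra.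
have s0 : 0 < r / (r - 1) by rewrite divr_gt0 //; lra.
have rs : r^-1 + (r / (r - 1))^-1 = 1 by rewrite invf_div; field; rewrite gt_eqF.
have := hoelder mu3 mf mk r0 s0 rs; rewrite Lnorm1 => h; apply: le_trans h _.
rewrite (EFinM (_ `^ _)); apply: lee_pmul; try exact: Lnorm_ge0.
  by apply/lnorm_le; rewrite ?powR_ge0 // -powRrM mulVf ?gt_eqF // powRr1.
by apply/lnorm_le; rewrite ?powR_ge0 // -powRrM mulVf ?gt_eqF // powRr1.
Qed.

Lemma hoelder_integrable r f k : 1 < r -> measurable_fun setT f -> measurable_fun setT k ->
  (lpow r f < +oo)%E -> (lpow (r / (r - 1)) k < +oo)%E ->
  mu3.-integrable setT (fun x => (f x * k x)%:E).
Proof.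
move=> r1 mf mk fy ky; apply/integrableP; split; first by apply/measurable_EFinP; exact: measurable_funM.
have fin (u : \bar R) : (0 <= u)%E -> (u < +oo)%E -> (u <= (fine u)%:E)%E.
  by move=> u0 uy; rewrite fineK // ge0_fin_numE.
have f0 := fine_ge0 (lpow_ge0 r f); have k0 := fine_ge0 (lpow_ge0 (r / (r - 1)) k).
apply: le_lt_trans (hoelder_lpow r1 mf mk f0 k0 (fin _ (lpow_ge0 _ _) fy) (fin _ (lpow_ge0 _ _) ky)) _.
exact: ltry.
Qed.

Lemma normr_Rintegral_le f (c : R) : mu3.-integrable setT (EFin \o f) ->
  (\int[mu3]_x `|(f x)%:E| <= c%:E)%E -> `|\int[mu3]_x f x| <= c.
Proof.
move=> fi fc; rewrite -lee_fin; apply: le_trans fc.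
have -> : (`|\int[mu3]_x f x|)%:E = `|\int[mu3]_x (f x)%:E|%E by rewrite -EFin_Rintegral.
by apply: le_abse_integral => //; case/integrableP: fi.
Qed.

Lemma null_pairing r (f : nat -> R3 R -> R) k : 1 < r -> (forall n, measurable_fun setT (f n)) ->
  measurable_fun setT k -> null (fun n => lpow r (f n)) -> (lpow (r / (r - 1)) k < +oo)%E ->
  null (fun n => \int[mu3]_x `|(f n x * k x)%:E|)%E.
Proof.
move=> r1 mf mk nf ky e e0; pose B := fine (lpow (r / (r - 1)) k) + 1.
have r0 : 0 < r by lra.
have k0 := lpow_ge0 (r / (r - 1)) k.
have B0 : 0 < B by rewrite ltr_wpDl // fine_ge0.
have kB : (lpow (r / (r - 1)) k <= B%:E)%E.
  rewrite -(fineK (x := lpow _ k)) ?ge0_fin_numE // lee_fin /B; lra.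
pose c := B `^ (r / (r - 1))^-1; have c0 : 0 < c by rewrite powR_gt0.
have d0 : 0 < (e / c) `^ r by rewrite powR_gt0 // divr_gt0.
have [N hN] := nf _ d0; exists N => n Nn.
have := hoelder_lpow r1 (mf n) mk (ltW d0) (ltW B0) (hN n Nn) kB => h; apply: le_trans h _.
have ec : 0 <= e / c by rewrite divr_ge0 // ltW.
by rewrite -powRrM divff ?gt_eqF // powRr1 // -/c divfK // gt_eqF.
Qed.

Lemma measurable_norm3 G : (forall i, measurable_fun setT (G i)) -> measurable_fun setT (norm3 G).
Proof.
move=> mG; apply: (measurableT_comp (continuous_measurable_fun (@sqrt_continuous R))).
by apply: measurable_sum => i; exact: measurable_funM.
Qed.

Lemma measurable_dot3 G H : (forall i, measurable_fun setT (G i)) -> (forall i, measurable_fun setT (H i)) ->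
  measurable_fun setT (dot3 G H).
Proof. by move=> mG mH; apply: measurable_sum => i; exact: measurable_funM. Qed.

Lemma norm3_ge0 G x : 0 <= norm3 G x. Proof. exact: sqrtr_ge0. Qed.

Lemma lpow_coord q G i : 0 < q -> (forall i, measurable_fun setT (G i)) ->
  (lpow q (G i) <= lpow q (norm3 G))%E.
Proof.
move=> q0 mG; apply: lpow_mono => // [|x]; first exact: measurable_norm3.
by rewrite (ger0_norm (norm3_ge0 G x)); exact: (nv_coord (fun i => G i x)).
Qed.

Lemma lpow_norm3D q G H : 0 < q -> (forall i, measurable_fun setT (G i)) ->
  (forall i, measurable_fun setT (H i)) ->
  (lpow q (norm3 (fun i x => G i x + H i x)%R) <= (2 `^ q)%:E * (lpow q (norm3 G) + lpow q (norm3 H)))%E.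
Proof.
move=> q0 mG mH; have m1 := measurable_norm3 mG; have m2 := measurable_norm3 mH.
apply: le_trans (lpowD q0 m1 m2); apply: lpow_mono => //.
- by apply: measurable_norm3 => i; exact: measurable_funD.
- exact: measurable_funD.
move=> x; rewrite !ger0_norm ?addr_ge0 ?norm3_ge0 //.
exact: (nvD (fun i => G i x) (fun i => H i x)).
Qed.

Lemma lpow_norm3Z q (c : R) G : (forall i, measurable_fun setT (G i)) ->
  lpow q (norm3 (fun i x => c * G i x)) = ((`|c| `^ q)%:E * lpow q (norm3 G))%E.
Proof.
move=> mG; rewrite -lpowZ; last exact: measurable_norm3.
apply: eq_integral => x _; congr (_ `^ _)%:E.
by rewrite (_ : norm3 _ x = `|c| * norm3 G x) ?normrM ?normr_id //; exact: (nvZ c (fun i => G i x)).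
Qed.

Let i0 : 'I_3 := ord0.
Let i1 : 'I_3 := lift ord0 ord0.
Let i2 : 'I_3 := lift ord0 (lift ord0 ord0).

Lemma lpow_norm3_le q G : 0 < q -> (forall i, measurable_fun setT (G i)) ->
  (lpow q (norm3 G) <= (2 `^ q)%:E * (lpow q (G i0) +
     (2 `^ q)%:E * (lpow q (G i1) + lpow q (G i2))))%E.
Proof.
move=> q0 mG; pose h x := `|G i1 x| + `|G i2 x|.
have mn i : measurable_fun setT (fun x => `|G i x|) by exact: measurableT_comp.
have mh : measurable_fun setT h by exact: measurable_funD.
have en i : lpow q (fun x => `|G i x|) = lpow q (G i) by apply: eq_integral => x _; rewrite normr_id.
apply: (@le_trans _ _ (lpow q (fun x => `|G i0 x| + h x)%R)).
  apply: lpow_mono => //; [exact: measurable_norm3|exact: measurable_funD|move=> x].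
  have hx0 : 0 <= `|G i0 x| + h x by rewrite /h !addr_ge0.
  rewrite (ger0_norm hx0) (ger0_norm (norm3_ge0 G x)); apply: le_trans (nv_le_sum (fun i => G i x)) _.
  by rewrite !big_ord_recl big_ord0 addr0.
apply: le_trans (lpowD q0 (mn i0) mh) _; apply: lee_wpmul2l; first by rewrite lee_fin powR_ge0.
rewrite en; apply: leeD => //; apply: le_trans (lpowD q0 (mn i1) (mn i2)) _.
by rewrite !en.
Qed.

Lemma lpow_norm3_lty q G : 0 < q -> (forall i, measurable_fun setT (G i)) ->
  (forall i, lpow q (G i) < +oo)%E -> (lpow q (norm3 G) < +oo)%E.
Proof.
move=> q0 mG Gy; apply: le_lt_trans (lpow_norm3_le q0 mG) _.
have p2 : (0 <= (2 `^ q)%:E :> \bar R)%E by rewrite lee_fin powR_ge0.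
apply: lte_mul_pinfty => //; apply: lte_add_pinfty; first exact: Gy.
by apply: lte_mul_pinfty => //; apply: lte_add_pinfty; exact: Gy.
Qed.

Lemma null_norm3 q (G : nat -> 'I_3 -> R3 R -> R) : 0 < q -> (forall n i, measurable_fun setT (G n i)) ->
  (forall i, null (fun n => lpow q (G n i))) -> null (fun n => lpow q (norm3 (G n))).
Proof.
move=> q0 mG nG; have p2 : 0 < 2 `^ q :> R by rewrite powR_gt0.
apply: (null_le p2 (fun n => lpow_norm3_le q0 (mG n)) (nG i0)).
exact: (null_le p2 (fun n => lexx _) (nG i1) (nG i2)).
Qed.

Lemma loc_integrable_lpow r f : 1 < r -> measurable_fun setT f -> (lpow r f < +oo)%E -> loc_integrable f.
Proof.
move=> r1 mf fy; split=> // K cK; have mK := compact3_measurable cK.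
have [M M0 KM] := compact_subset_box cK.
apply: (@integrableS _ _ _ _ (box M)) => //; first exact: measurable_box.
have mb := @measurable_box R M.
have m1 : measurable_fun setT (\1_(box M) : R3 R -> R) by exact: measurable_indic.
have s0 : 0 < r / (r - 1) by rewrite divr_gt0 //; lra.
have b1 : bounded_compact (\1_(box M) : R3 R -> R).
  split=> //; exists (Num.max M 1) => x; rewrite !indicE.
  have [xM|] := boolP (x \in box M); last by rewrite normr0 mulr_ge0 // le_max ler01 orbT.
  rewrite normr1 mem_set ?mulr1 ?le_max ?lexx ?orbT //.
  by apply: boxS (set_mem xM); rewrite le_max lexx.
have := hoelder_integrable r1 mf m1 fy (lpow_bounded_compact s0 b1).
move=> /integrableP[_ h]; apply/integrableP; split; first by apply/measurable_EFinP; exact: measurable_funTS.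
apply: le_lt_trans h => /=.
rewrite integral_mkcond le_eqVlt; apply/orP; left; apply/eqP; apply: eq_integral => x _.
by rewrite patchE indicE; case: ifP; rewrite ?mulr1 // mulr0 normr0.
Qed.

End pairing.

(** * The closure of the test functions *)

Section dirichlet_pairs.
Context {R : realType}.
Context (q : R) (q1 : 1 < q) (q3 : q < 3).
Implicit Types (f g w k : R3 R -> R) (G H : 'I_3 -> R3 R -> R).
Local Notation qs := (sobolev_exp q).

Let q0 : 0 < q. Proof. exact: lt_trans ltr01 q1. Qed.
Let qqs : q < qs. Proof. exact: sobolev_exp_gt q0 q3. Qed.
Let qs1 : 1 < qs. Proof. exact: lt_trans q1 qqs. Qed.
Let qs0 : 0 < qs. Proof. exact: lt_trans q0 qqs. Qed.

Lemma sobolev_small (e : R) : 0 < e -> exists2 d : R, 0 < d & forall g, test_function g ->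
  (lpow q (norm3 (grad g)) <= d%:E)%E -> (lpow qs g <= e%:E)%E.
Proof.
move=> e0; have C0 : 0 <= Csob q by rewrite /Csob /Clev !mulr_ge0 ?powR_ge0.
pose d := e `^ (q / qs) / (Csob q + 1).
have C1 : 0 < Csob q + 1 by lra.
have d0 : 0 < d by rewrite divr_gt0 // powR_gt0.
exists d => // g tg gd.
have h i : (lpow q (grad g i) <= d%:E)%E.
  by apply: le_trans gd; apply: lpow_coord => // j; exact: measurable_test (test_grad j tg).
apply: le_trans (sobolev_test q1 q3 tg (ltW d0) h) _; rewrite lee_fin.
have qq : 0 <= qs / q by rewrite divr_ge0 // ltW.
apply: (@le_trans _ _ ((e `^ (q / qs)) `^ (qs / q))).
  have Cd0 : 0 <= Csob q * d by rewrite mulr_ge0 // ltW.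
  rewrite (ge0_ler_powR qq) ?nnegrE ?powR_ge0 // /d mulrCA ler_piMr ?powR_ge0 // ler_pdivrMr //; lra.
by rewrite -powRrM mulrA divfK ?gt_eqF // divff ?gt_eqF // powRr1 // ltW.
Qed.

Lemma sobolev_null (g : nat -> R3 R -> R) : (forall n, test_function (g n)) ->
  null (fun n => lpow q (norm3 (grad (g n)))) -> null (fun n => lpow qs (g n)).
Proof.
move=> tg ng e e0; have [d d0 hd] := sobolev_small e0.
by have [N hN] := ng d d0; exists N => n Nn; apply: hd => //; exact: hN.
Qed.

(* [(w, H)] is the limit of a sequence of test functions together with their
   gradients: [w] belongs to D^{1,q} and [H] is its gradient in L^q. *)
Definition Dapprox w H (g : nat -> R3 R -> R) : Prop :=
  [/\ forall n, test_function (g n),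
      null (fun n => lpow qs (fun x => g n x - w x)) &
      null (fun n => lpow q (norm3 (fun i x => grad (g n) i x - H i x)))].

Definition Dpair w H : Prop :=
  [/\ measurable_fun setT w, forall i, measurable_fun setT (H i) & exists g : nat -> R3 R -> R, Dapprox w H g].

Let mtest g : test_function g -> measurable_fun setT g. Proof. exact: measurable_test. Qed.
Let mgrad g i : test_function g -> measurable_fun setT (grad g i).
Proof. by move=> tg; exact: measurable_test (test_grad i tg). Qed.

Lemma Dpair_test g : test_function g -> Dpair g (grad g).
Proof.
move=> tg; split=> [|i|]; [exact: mtest|exact: mgrad|exists (fun _ => g); split=> // e e0].
  exists 0%N => n _; rewrite /lpow; under eq_integral do rewrite subrr normr0 powR0 ?gt_eqF //.
  by rewrite integral0 lee_fin ltW.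
exists 0%N => n _; rewrite /lpow (eq_integral (cst 0%E)) ?integral0 ?lee_fin 1?ltW // => x _.
rewrite (_ : norm3 _ x = 0) ?normr0 ?powR0 ?gt_eqF // /norm3 /dot3 big1 ?sqrtr0 // => i _.
by rewrite subrr mul0r.
Qed.

Lemma Dpair_lin (c : R) w H w' H' : Dpair w H -> Dpair w' H' ->
  Dpair (fun x => w x + c * w' x) (fun i x => H i x + c * H' i x).
Proof.
move=> [mw mH [g [tg gw gH]]] [mw' mH' [g' [tg' gw' gH']]].
have C1 (a : R) : 0 < `|a| `^ q + 1 by rewrite ltr_wpDl // powR_ge0.
have C2 (a : R) : 0 < `|a| `^ qs + 1 by rewrite ltr_wpDl // powR_ge0.
have p2 (r : R) : 0 < 2 `^ r :> R by rewrite powR_gt0.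
split=> [|i|].
- by apply: measurable_funD => //; exact: measurable_funM.
- by apply: measurable_funD => //; exact: measurable_funM.
exists (fun n x => g n x + c * g' n x); split.
- by move=> n; apply: testD => //; exact: testZ.
- refine (null_le (p2 qs) (v := fun n => lpow qs (fun x => g n x - w x))
    (w := fun n => lpow qs (fun x => c * (g' n x - w' x))) _ gw _).
    move=> n; have m1 : measurable_fun setT (fun x => g n x - w x) by apply: measurable_funB => //; exact: mtest.
    have m2 : measurable_fun setT (fun x => c * (g' n x - w' x)).
      by apply: measurable_funM => //; apply: measurable_funB => //; exact: mtest.
    apply: le_trans (lpowD qs0 m1 m2); rewrite le_eqVlt; apply/orP; left; apply/eqP.
    by congr lpow; apply/funext => x; ring.
  apply: (null_le1 (C2 c)) gw' => n; rewrite lpowZ; last by apply: measurable_funB => //; exact: mtest.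
  by apply: lee_wpmul2r; [exact: lpow_ge0|rewrite lee_fin lerDl].
- refine (null_le (p2 q) (v := fun n => lpow q (norm3 (fun i x => grad (g n) i x - H i x)))
    (w := fun n => lpow q (norm3 (fun i x => c * (grad (g' n) i x - H' i x)))) _ gH _).
    move=> n.
    have m1 i : measurable_fun setT (fun x => grad (g n) i x - H i x) by apply: measurable_funB => //; exact: mgrad.
    have m2 i : measurable_fun setT (fun x => c * (grad (g' n) i x - H' i x)).
      by apply: measurable_funM => //; apply: measurable_funB => //; exact: mgrad.
    apply: le_trans (lpow_norm3D q0 m1 m2); rewrite le_eqVlt; apply/orP; left; apply/eqP.
    congr (lpow q (norm3 _)); apply/funext => i; apply/funext => x.
    have tcg := testZ c (tg' n).
    by rewrite (gradD i (tg n) tcg) (gradZ c i (tg' n)); ring.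
  apply: (null_le1 (C1 c)) gH' => n; rewrite lpow_norm3Z; last first.
    by move=> i; apply: measurable_funB => //; exact: mgrad.
  by apply: lee_wpmul2r; [exact: lpow_ge0|rewrite lee_fin lerDl].
Qed.

Lemma Dpair_lty w H : Dpair w H -> (lpow qs w < +oo)%E /\ (lpow q (norm3 H) < +oo)%E.
Proof.
move=> [mw mH [g [tg gw gH]]]; have [N1 h1] := gw 1 ltr01; have [N2 h2] := gH 1 ltr01.
split.
  apply: (lpow_sub_lty qs0 (mtest (tg N1)) mw).
    exact: lpow_bounded_compact (bounded_compact_test (tg N1)).
  exact: le_lt_trans (h1 N1 (leqnn _)) (ltry _).
apply: lpow_norm3_lty => // i; apply: (lpow_sub_lty q0 (mgrad i (tg N2)) (mH i)).
  exact: lpow_bounded_compact (bounded_compact_test (test_grad i (tg N2))).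
have mB j : measurable_fun setT (fun x => grad (g N2) j x - H j x) by apply: measurable_funB => //; exact: mgrad.
by apply: le_lt_trans (lpow_coord i q0 mB) _; exact: le_lt_trans (h2 N2 (leqnn _)) (ltry _).
Qed.

(** Only the gradients are assumed Cauchy; the Sobolev inequality applied to differences makes the
    functions Cauchy in L^{q*}. *)
Lemma Dapprox_complete (g : nat -> R3 R -> R) : (forall n, test_function (g n)) ->
  (forall e : R, 0 < e -> exists N, forall m n, (N <= m)%N -> (N <= n)%N ->
    (lpow q (norm3 (grad (fun x => g m x - g n x)%R)) <= e%:E)%E) ->
  exists w H, [/\ measurable_fun setT w, forall i, measurable_fun setT (H i) & Dapprox w H g].
Proof.
move=> tg gC.
have [w mw gw] : exists2 w : R3 R -> R, measurable_fun setT w & null (fun n => lpow qs (fun x => g n x - w x)).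
  apply: (lpow_complete qs0) => [n|e e0]; first exact: mtest.
  have [d d0 hd] := sobolev_small e0; have [N hN] := gC d d0.
  by exists N => m n Nm Nn; apply: hd; [exact: testB|exact: hN].
have comp i : exists h : R3 R -> R, measurable_fun setT h /\ null (fun n => lpow q (fun x => grad (g n) i x - h x)).
  have [|e e0|h mh nh] := @lpow_complete _ q (fun n => grad (g n) i) q0.
  - by move=> n; exact: mgrad.
  - have [N hN] := gC e e0; exists N => m n Nm Nn; apply: le_trans (hN m n Nm Nn).
    rewrite -(gradB i (tg m) (tg n)); apply: lpow_coord => // j.
    by apply: mgrad; exact: testB.
  - by exists h.
have [H hH] := choice comp; exists w, H; split; [exact: mw|by move=> i; exact: (hH i).1|].
split; [exact: tg|exact: gw|].
apply: (null_norm3 (G := fun n i x => grad (g n) i x - H i x) q0) => [n i|i]; last exact: (hH i).2.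
by apply: measurable_funB; [exact: mgrad|exact: (hH i).1].
Qed.

(** The Sobolev inequality in the limit, in the form that uniqueness uses: the gradients of the
    approximants tend to 0, hence so do the approximants in L^{q*}. *)
Lemma Dpair_sobolev0 w H : Dpair w H -> lpow q (norm3 H) = 0%E -> {ae mu3, forall x, w x = 0}.
Proof.
move=> [mw mH [g [tg gw gH]]] H0.
have p2 (r : R) : 0 < 2 `^ r :> R by rewrite powR_gt0.
have nz : null (fun _ : nat => 0%E : \bar R) by move=> e e0; exists 0%N => n _; rewrite lee_fin ltW.
have ng : null (fun n => lpow q (norm3 (grad (g n)))).
  apply: (null_le (p2 q) _ gH nz) => n.
  have mB i : measurable_fun setT (fun x => grad (g n) i x - H i x) by apply: measurable_funB => //; exact: mgrad.
  have := lpow_norm3D q0 mB mH; rewrite H0; apply: le_trans.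
  rewrite le_eqVlt; apply/orP; left; apply/eqP; congr (lpow q (norm3 _)).
  by apply/funext => i; apply/funext => x; rewrite subrK.
have nqs := sobolev_null tg ng.
have w0 : lpow qs w = 0%E.
  have nsum : null (fun n => (2 `^ qs)%:E * (lpow qs (g n) + lpow qs (fun x => g n x - w x)%R))%E.
    exact: (null_le (p2 qs) _ nqs gw).
  apply: (null_cst0 nsum) => [n|]; last exact: lpow_ge0.
  have mB : measurable_fun setT (fun x => w x - g n x) by apply: measurable_funB => //; exact: mtest.
  have := lpowD qs0 (mtest (tg n)) mB; rewrite [lpow qs (fun x => w x - _)]lpowB_sym; apply: le_trans.
  by rewrite le_eqVlt; apply/orP; left; apply/eqP; congr lpow; apply/funext => x; rewrite addrC subrK.
exact: lpow_eq0 w0.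
Qed.

Let abs_split (A B C D e : R) : A = - C -> `|A - B| <= e / 2 -> `|C - D| <= e / 2 -> `|B + D| <= e.
Proof. by rewrite !ler_norml => -> /andP[? ?] /andP[? ?]; apply/andP; split; lra. Qed.

Let conj1 (r : R) : 1 < r -> 0 < r / (r - 1). Proof. by move=> r1; rewrite divr_gt0 //; lra. Qed.

(** Integration by parts holds for the approximants, and by Hoelder both pairings with a test
    function pass to the limit. *)
Lemma Dpair_weak_gradient w H : Dpair w H -> weak_gradient w H.
Proof.
move=> Dw; have [wy Hy] := Dpair_lty Dw; have [mw mH [g [tg gw gH]]] := Dw.
have Hiy i : (lpow q (H i) < +oo)%E by apply: le_lt_trans (lpow_coord i q0 mH) Hy.
split; first exact: loc_integrable_lpow qs1 mw wy.
  by move=> i; exact: loc_integrable_lpow q1 (mH i) (Hiy i).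
move=> i psi tpsi; have tdpsi := test_grad i tpsi.
have ty r k : 1 < r -> test_function k -> (lpow (r / (r - 1)) k < +oo)%E.
  by move=> r1 tk; apply: lpow_bounded_compact; [exact: conj1|exact: bounded_compact_test].
have iw : mu3.-integrable setT (fun x => (w x * grad psi i x)%:E).
  exact: (hoelder_integrable qs1 mw (mtest tdpsi) wy (ty _ _ qs1 tdpsi)).
have iH : mu3.-integrable setT (fun x => (H i x * psi x)%:E).
  exact: (hoelder_integrable q1 (mH i) (mtest tpsi) (Hiy i) (ty _ _ q1 tpsi)).
have mB n : measurable_fun setT (fun x => g n x - w x) by apply: measurable_funB => //; exact: mtest.
have mBg n j : measurable_fun setT (fun x => grad (g n) j x - H j x) by apply: measurable_funB => //; exact: mgrad.
have n1 := null_pairing qs1 mB (mtest tdpsi) gw (ty _ _ qs1 tdpsi).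
have gHi : null (fun n => lpow q (fun x => grad (g n) i x - H i x)).
  apply: (null_le1 ltr01) gH => n; rewrite mul1e.
  exact: (lpow_coord i q0 (mBg n)).
have n2 := null_pairing q1 (fun n => mBg n i) (mtest tpsi) gHi (ty _ _ q1 tpsi).
apply/eqP; rewrite -subr_eq0 -normr_le0; apply/ler_addgt0Pr => e e0; rewrite add0r opprK.
have e2 : 0 < e / 2 by rewrite divr_gt0.
have [N1 h1] := n1 _ e2; have [N2 h2] := n2 _ e2; pose n := maxn N1 N2.
have {}h1 := h1 n (leq_maxl _ _); have {}h2 := h2 n (leq_maxr _ _).
have [_ _ /(_ i psi tpsi)] := weak_gradient_test (tg n).
have ig : mu3.-integrable setT (fun x => (g n x * grad psi i x)%:E).
  by apply: (loc_integrableM (loc_integrable_test (tg n))); exact: bounded_compact_test.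
have ig' : mu3.-integrable setT (fun x => (grad (g n) i x * psi x)%:E).
  by apply: (loc_integrableM (loc_integrable_test (test_grad i (tg n)))); exact: bounded_compact_test.
have iB1 : mu3.-integrable setT (fun x => ((g n x - w x) * grad psi i x)%:E).
  by under eq_fun do rewrite mulrBl EFinB; exact: integrableB.
have iB2 : mu3.-integrable setT (fun x => ((grad (g n) i x - H i x) * psi x)%:E).
  by under eq_fun do rewrite mulrBl EFinB; exact: integrableB.
have b1 := normr_Rintegral_le iB1 h1; have b2 := normr_Rintegral_le iB2 h2.
have E1 : \int[mu3]_x ((g n x - w x) * grad psi i x) =
    \int[mu3]_x (g n x * grad psi i x) - \int[mu3]_x (w x * grad psi i x).
  by rewrite -(RintegralB measurableT ig iw); apply: eq_Rintegral => x _; rewrite mulrBl.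
have E2 : \int[mu3]_x ((grad (g n) i x - H i x) * psi x) =
    \int[mu3]_x (grad (g n) i x * psi x) - \int[mu3]_x (H i x * psi x).
  by rewrite -(RintegralB measurableT ig' iH); apply: eq_Rintegral => x _; rewrite mulrBl.
rewrite E1 in b1; rewrite E2 in b2 => ww; exact: abs_split ww b1 b2.
Qed.

Lemma D1normE g : D1norm q g = 'N[mu3]_q%:E [EFin \o norm3 (grad g)]%E. Proof. by []. Qed.

Lemma Dpair_D1 w H : Dpair w H -> D1 q w.
Proof.
move=> Dw; have [wy _] := Dpair_lty Dw; have [mw mH [g [tg gw gH]]] := Dw.
have lty_norm f : (lpow qs f < +oo)%E -> ('N[mu3]_qs%:E [EFin \o f] < +oo)%E.
  rewrite -(ge0_fin_numE (lpow_ge0 qs f)) => fy; have f0 := fine_ge0 (lpow_ge0 qs f).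
  apply: (@le_lt_trans _ _ ((fine (lpow qs f)) `^ qs^-1)%:E); last exact: ltry.
  apply/(lnorm_le _ qs0 (powR_ge0 _ _)).
  by rewrite -powRrM mulVf ?gt_eqF // powRr1 // fineK.
split.
  by rewrite inE /=; apply/andP; split; rewrite inE //=; exact: lty_norm.
exists g; split=> // [eps eps0|].
- have p2 : 0 < 2 `^ q :> R by rewrite powR_gt0.
  pose d := (eps / 2) `^ q / 2 `^ q / 2.
  have d0 : 0 < d by rewrite !divr_gt0 // powR_gt0 // divr_gt0.
  have [N hN] := gH d d0; exists N => m n Nm Nn; rewrite D1normE.
  apply: (@le_lt_trans _ _ (eps / 2)%:E); last by rewrite lte_fin; lra.
  apply/lnorm_le => //; first lra.
  have m1 i : measurable_fun setT (fun x => grad (g m) i x - H i x) by apply: measurable_funB => //; exact: mgrad.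
  have m2 i : measurable_fun setT (fun x => -1 * (grad (g n) i x - H i x)).
    by apply: measurable_funM => //; apply: measurable_funB => //; exact: mgrad.
  have -> : grad (g m \- g n) = fun i x => (grad (g m) i x - H i x) + (-1) * (grad (g n) i x - H i x).
    by apply/funext => i; apply/funext => x; rewrite (gradB i (tg m) (tg n)); ring.
  apply: le_trans (lpow_norm3D q0 m1 m2) _.
  rewrite lpow_norm3Z; last by move=> i; apply: measurable_funB => //; exact: mgrad.
  rewrite normrN1 powR1 mul1e.
  apply: (@le_trans _ _ ((2 `^ q)%:E * (d%:E + d%:E))%E).
    apply: lee_wpmul2l; first by rewrite lee_fin ltW.
    by apply: leeD; exact: hN.
  by rewrite -EFinD -EFinM lee_fin /d le_eqVlt; apply/orP; left; apply/eqP; field; rewrite gt_eqF.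
- apply/fine_cvgP; split.
    near=> n; rewrite ge0_fin_numE ?Lnorm_ge0 //; apply: lty_norm.
    apply: (@le_lt_trans _ _ 1%:E); last exact: ltry.
    near: n; have [N hN] := gw 1 ltr01; exists N => // n /= Nn; exact: hN.
  apply/cvgrPdist_le => e e0; have e'0 : 0 < e `^ qs by rewrite powR_gt0.
  have [N hN] := gw _ e'0; exists N => // n /= Nn.
  rewrite sub0r normrN ger0_norm ?fine_ge0 ?Lnorm_ge0 //.
  have h : ('N[mu3]_qs%:E [EFin \o (g n \- w)%R] <= e%:E)%E by apply/lnorm_le => //; [exact: ltW|exact: hN].
  rewrite -lee_fin fineK // ge0_fin_numE ?Lnorm_ge0 //; exact: le_lt_trans h (ltry _).
Unshelve. all: by end_near. Qed.

(** [D1] records only the function; its gradient is recovered as the L^q limit of the Cauchy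
    gradients. The limit function supplied by completeness is dropped, because the same sequence
    already tends to [w]. *)
Lemma D1_Dpair w : D1 q w -> exists H, Dpair w H.
Proof.
move=> [lw [g [tg gC gw]]].
have mw : measurable_fun setT w by move: lw; rewrite inE /= => /andP[]; rewrite inE.
have gC' (e : R) : 0 < e -> exists N, forall m n, (N <= m)%N -> (N <= n)%N ->
    (lpow q (norm3 (grad (fun x => g m x - g n x)%R)) <= e%:E)%E.
  move=> e0; have e'0 : 0 < e `^ q^-1 by rewrite powR_gt0.
  have [N hN] := gC _ e'0; exists N => m n Nm Nn.
  have /ltW := hN m n Nm Nn; rewrite D1normE => /(lnorm_le _ q0 (ltW e'0)).1.
  by rewrite -powRrM mulVf ?gt_eqF // powRr1 // ltW.
have [w' [H [_ mH [_ _ gH]]]] := Dapprox_complete tg gC'.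
exists H; split; [exact: mw|exact: mH|exists g; split; [exact: tg| |exact: gH]] => e e0.
have e'0 : 0 < e `^ qs^-1 by rewrite powR_gt0.
have /fine_cvgP[[N1 _ h1] /cvgrPdist_le /(_ _ e'0)[N2 _ h2]] := gw.
exists (maxn N1 N2) => n; rewrite geq_max => /andP[n1 n2].
have : ('N[mu3]_qs%:E [EFin \o (g n \- w)%R] <= (e `^ qs^-1)%:E)%E.
  rewrite -(fineK (h1 n n1)) lee_fin; have := h2 n n2; rewrite /= sub0r normrN.
  by apply: le_trans; exact: ler_norm.
move=> /(lnorm_le _ qs0 (ltW e'0)).1.
by rewrite -powRrM mulVf ?gt_eqF // powRr1 // ltW.
Qed.

End dirichlet_pairs.

(** * The Dirichlet principle *)

Section energy.
Context {R : realType} (q : R) (q1 : 1 < q).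
Implicit Types (G H K : 'I_3 -> R3 R -> R).

Let q0 : 0 < q. Proof. exact: lt_trans ltr01 q1. Qed.

Definition Lvec H : Prop := (forall i, measurable_fun setT (H i)) /\ (lpow q (norm3 H) < +oo)%E.

(* Sealed, so that unification does not unfold the integrals. *)
Lemma energy_exists : {E : ('I_3 -> R3 R -> R) -> R | forall H, E H = \int[mu3]_x (norm3 H x `^ q)}.
Proof. by exists (fun H => \int[mu3]_x (norm3 H x `^ q)). Qed.

Definition energy : ('I_3 -> R3 R -> R) -> R := sval energy_exists.

Lemma energy_def H : energy H = \int[mu3]_x (norm3 H x `^ q).
Proof. exact: (svalP energy_exists). Qed.

Let lpowE H : lpow q (norm3 H) = (\int[mu3]_x (norm3 H x `^ q)%:E)%E.
Proof. by apply: eq_integral => x _; rewrite ger0_norm // norm3_ge0. Qed.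

Lemma energy_integrable H : Lvec H -> mu3.-integrable setT (EFin \o (fun x => norm3 H x `^ q)).
Proof.
move=> [mH yH]; apply/integrableP; split.
  by apply/measurable_EFinP; apply: (measurableT_comp (measurable_powR q)); exact: measurable_norm3.
apply: le_lt_trans yH; rewrite lpowE le_eqVlt; apply/orP; left; apply/eqP.
by apply: eq_integral => x _; rewrite gee0_abs // lee_fin powR_ge0.
Qed.

Lemma energyE H : Lvec H -> lpow q (norm3 H) = (energy H)%:E.
Proof. by move=> LH; rewrite lpowE -(EFin_Rintegral (energy_integrable LH)) energy_def. Qed.

Lemma energy_ge0 H : 0 <= energy H.
Proof. by rewrite energy_def; apply: Rintegral_ge0 => x _; exact: powR_ge0. Qed.

(** Hoelder with exponents q and q / (q - 1). The general [k] serves twice: k = |G| gives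
    integrability of the flux pairing, and k = |G| + |H| a majorant for dominated convergence. *)
Lemma flux_dominating (k : R3 R -> R) H : measurable_fun setT k -> (lpow q k < +oo)%E -> Lvec H ->
  mu3.-integrable setT (fun x => (norm3 H x * `|k x| `^ (q - 1))%:E).
Proof.
move=> mk ky [mH yH].
apply: (hoelder_integrable q1 (measurable_norm3 mH) (measurable_powR_norm _ mk) yH).
apply: le_lt_trans ky; rewrite le_eqVlt; apply/orP; left; apply/eqP; apply: eq_integral => x _.
congr EFin; rewrite ger0_norm ?powR_ge0 // -powRrM; congr powR; field.
by rewrite gt_eqF // subr_gt0.
Qed.

Lemma Lvec_lin (c : R) G H : Lvec G -> Lvec H -> Lvec (fun i x => G i x + c * H i x).
Proof.
move=> [mG yG] [mH yH]; have mcH i : measurable_fun setT (fun x => c * H i x) by exact: measurable_funM.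
split=> [i|]; first exact: measurable_funD.
apply: le_lt_trans (lpow_norm3D q0 mG mcH) _; rewrite (lpow_norm3Z q c mH).
have p2 : (0 <= (2 `^ q)%:E :> \bar R)%E by rewrite lee_fin powR_ge0.
have pc : (0 <= (`|c| `^ q)%:E :> \bar R)%E by rewrite lee_fin powR_ge0.
apply: lte_mul_pinfty p2 _ _; first by [].
by apply: lte_add_pinfty; [exact: yG|apply: lte_mul_pinfty pc _ yH].
Qed.

Lemma LvecB G H : Lvec G -> Lvec H -> Lvec (fun i x => G i x - H i x).
Proof.
move=> LG LH; have := Lvec_lin (-1) LG LH.
by congr Lvec; apply/funext => i; apply/funext => x; rewrite mulN1r.
Qed.

Lemma Lvec_mid G H : Lvec G -> Lvec H -> Lvec (fun i x => (G i x + H i x) / 2).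
Proof.
move=> LG LH; have := Lvec_lin (- 2^-1) (Lvec_lin 1 LG LH) (Lvec_lin 1 LG LH).
by congr Lvec; apply/funext => i; apply/funext => x; field.
Qed.

Let intZ (c : R) (f : R3 R -> R) : mu3.-integrable setT (EFin \o f) ->
  mu3.-integrable setT (EFin \o (fun x => c * f x)).
Proof. by move=> fi; exact: (integrableZl measurableT c fi). Qed.

Let intD (f g : R3 R -> R) : mu3.-integrable setT (EFin \o f) -> mu3.-integrable setT (EFin \o g) ->
  mu3.-integrable setT (EFin \o (fun x => f x + g x)).
Proof. by move=> fi gi; exact: (integrableD measurableT fi gi). Qed.

Let Rintegral_le_lin (a b c : R) (f g h k : R3 R -> R) :
  mu3.-integrable setT (EFin \o f) -> mu3.-integrable setT (EFin \o g) ->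
  mu3.-integrable setT (EFin \o h) -> mu3.-integrable setT (EFin \o k) ->
  (forall x, k x + c * h x <= a * f x + b * g x) ->
  \int[mu3]_x k x + c * \int[mu3]_x h x <= a * \int[mu3]_x f x + b * \int[mu3]_x g x.
Proof.
move=> fi gi hi ki kh; rewrite -(RintegralZl a measurableT fi) -(RintegralZl b measurableT gi).
rewrite -(RintegralZl c measurableT hi) -(RintegralD measurableT (intZ a fi) (intZ b gi)).
rewrite -(RintegralD measurableT ki (intZ c hi)).
exact: (le_Rintegral measurableT (intD ki (intZ c hi)) (intD (intZ a fi) (intZ b gi)) (fun x _ => kh x)).
Qed.

Lemma energy_le (a b : R) G H K : Lvec G -> Lvec H -> Lvec K ->
  (forall x, norm3 K x `^ q <= a * norm3 G x `^ q + b * norm3 H x `^ q) ->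
  energy K <= a * energy G + b * energy H.
Proof.
move=> LG LH LK h; have iG := energy_integrable LG; have iH := energy_integrable LH.
rewrite !energy_def -(RintegralZl a measurableT iG) -(RintegralZl b measurableT iH).
rewrite -(RintegralD measurableT (intZ a iG) (intZ b iH)).
exact: (le_Rintegral measurableT (energy_integrable LK) (intD (intZ a iG) (intZ b iH)) (fun x _ => h x)).
Qed.

Lemma energy_gap (e : R) : 0 < e -> exists2 C : R, 0 < C & forall G H, Lvec G -> Lvec H ->
  energy (fun i x => G i x - H i x) <= e * (energy G + energy H) +
    C * ((energy G + energy H) / 2 - energy (fun i x => (G i x + H i x) / 2)).
Proof.
move=> e0; have [C C0 hC] := vgap_bound q1 e0; exists C => // G H LG LH.
pose M i x := (G i x + H i x) / 2; have LM : Lvec M by exact: Lvec_mid.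
have LB := LvecB LG LH.
have iG := energy_integrable LG; have iH := energy_integrable LH.
have iM := energy_integrable LM; have iB := energy_integrable LB.
have : energy (fun i x => G i x - H i x) + C * energy M <= (e + C / 2) * energy G + (e + C / 2) * energy H.
  rewrite !energy_def; apply: (Rintegral_le_lin iG iH iM iB) => x.
  have := hC (fun i => G i x) (fun i => H i x); rewrite /vgap.
  rewrite -/(norm3 G x) -/(norm3 H x) -/(norm3 (fun i x => G i x - H i x) x) -/(norm3 M x).
  move: (_ `^ q) (_ `^ q) (_ `^ q) (_ `^ q) => A B D F; lra.
move: (energy _) (energy _) (energy _) (energy _) => A B D F; lra.
Qed.

Let close_of_le (g k d e y : R) : 0 <= k -> 0 <= g -> 0 < d -> d <= 1 -> d * (2 * k + 3) <= e / 2 ->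
  y <= 1 -> y <= e / 2 -> g <= (1 + d) * k + y -> k <= (1 + d) * g + y -> `|g - k| <= e.
Proof.
move=> k0 g0 d0 d1 dk y1 y2 h1 h2.
have g2 : g <= 2 * k + 1 by have := ler_wpM2r k0 d1; lra.
have dg : d * g <= d * (2 * k + 3) by rewrite ler_pM2l //; lra.
have dkk : d * k <= d * (2 * k + 3) by rewrite ler_pM2l //; lra.
by rewrite ler_norml; apply/andP; split; lra.
Qed.

(** [nv_add_bound] in both directions replaces Minkowski's inequality: [d] makes the relative error
    small first, then the index absorbs the constant belonging to [d]. *)
Lemma energy_cvg (G : nat -> 'I_3 -> R3 R -> R) H : (forall n, Lvec (G n)) -> Lvec H ->
  null (fun n => lpow q (norm3 (fun i x => G n i x - H i x))) ->
  forall e : R, 0 < e -> exists N, forall n, (N <= n)%N -> `|energy (G n) - energy H| <= e.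
Proof.
move=> LG LH nG e e0.
pose d := Num.min 1 (e / 2 / (2 * energy H + 3)).
have EH := energy_ge0 H.
have d0 : 0 < d by rewrite lt_min ltr01 /= !divr_gt0 //; lra.
have d1 : d <= 1 by rewrite ge_min lexx.
have dH : d * (2 * energy H + 3) <= e / 2 by rewrite -ler_pdivlMr ?ge_min ?lexx ?orbT //; lra.
have [C C0 hC] := nv_add_bound q1 d0.
pose c := Num.min 1 (e / 2) / C; have c0 : 0 < c by rewrite divr_gt0 // lt_min ltr01 divr_gt0.
have cC : C * c = Num.min 1 (e / 2) by rewrite /c mulrC divfK // gt_eqF.
have c1 : C * c <= 1 by rewrite cC ge_min lexx.
have c2 : C * c <= e / 2 by rewrite cC ge_min lexx orbT.
have [N hN] := nG c c0; exists N => n Nn.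
have LB := LvecB (LG n) LH; have := hN n Nn; rewrite (energyE LB) lee_fin => hB.
have CB : C * energy (fun i x => G n i x - H i x) <= C * c by rewrite ler_pM2l.
have h1 : energy (G n) <= (1 + d) * energy H + C * energy (fun i x => G n i x - H i x).
  apply: (energy_le LH LB (LG n)) => x; have := hC (fun i => H i x) (fun i => G n i x - H i x).
  by rewrite (_ : (fun i => _) = (fun i => G n i x)) //; apply/funext => i; rewrite addrC subrK.
have h2 : energy H <= (1 + d) * energy (G n) + C * energy (fun i x => G n i x - H i x).
  apply: (energy_le (LG n) LB LH) => x; have := hC (fun i => G n i x) (fun i => - (G n i x - H i x)).
  rewrite (nvN (fun i => G n i x - H i x)).
  by rewrite (_ : (fun i => _ + - _) = (fun i => H i x)) //; apply/funext => i; rewrite opprB addrC subrK.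
by apply: (close_of_le EH (energy_ge0 (G n)) d0 d1 dH _ _ h1 h2); apply: le_trans CB _.
Qed.

Let measurable_qflux G i : (forall j, measurable_fun setT (G j)) -> measurable_fun setT (qflux q G i).
Proof.
move=> mG; apply: measurable_funM => //.
by apply: (measurableT_comp (measurable_powR _)); exact: measurable_norm3.
Qed.

Lemma measurable_flux G H : (forall i, measurable_fun setT (G i)) -> (forall i, measurable_fun setT (H i)) ->
  measurable_fun setT (dot3 (qflux q G) H).
Proof. by move=> mG mH; apply: measurable_dot3 => // i; exact: measurable_qflux. Qed.

Lemma flux_le3 G H x : `|dot3 (qflux q G) H x| <= norm3 H x * `|norm3 G x| `^ (q - 1).
Proof.
rewrite (ger0_norm (norm3_ge0 G x)) mulrC.
exact: (flux_le (fun i => G i x) (fun i => H i x) q1).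
Qed.

Lemma flux_integrable G H : Lvec G -> Lvec H -> mu3.-integrable setT (EFin \o dot3 (qflux q G) H).
Proof.
move=> LG LH; have [mG yG] := LG; have [mH _] := LH.
apply: (le_integrable measurableT _ _ (flux_dominating (measurable_norm3 mG) yG LH)).
  by apply/measurable_EFinP; exact: measurable_flux.
move=> x _ /=; rewrite lee_fin; apply: le_trans (flux_le3 G H x) _; exact: ler_norm.
Qed.

Let cvg_dotv (u v : nat -> 'I_3 -> R) (a b : 'I_3 -> R) :
  (forall i, u n i @[n --> \oo] --> a i) -> (forall i, v n i @[n --> \oo] --> b i) ->
  dotv (u n) (v n) @[n --> \oo] --> dotv a b.
Proof.
move=> ua vb; rewrite /dotv !big_ord_recl big_ord0.
under eq_fun do rewrite !big_ord_recl big_ord0.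
apply: cvgD; first by apply: cvgM; [exact: ua|exact: vb].
apply: cvgD; first by apply: cvgM; [exact: ua|exact: vb].
by apply: cvgD; [apply: cvgM; [exact: ua|exact: vb]|exact: cvg_cst].
Qed.

(** For a <> 0 the factors converge separately. At a = 0 the power |.|^{q-2} may be singular, and
    the bound |.|^{q-1} |b| is used instead. *)
Lemma flux_cvg (a b : 'I_3 -> R) (t : nat -> R) : t n @[n --> \oo] --> 0 ->
  dotv (fluxv q (fun i => a i + t n * b i)) b @[n --> \oo] --> dotv (fluxv q a) b.
Proof.
move=> t0; pose u n i := a i + t n * b i.
have cu i : u n i @[n --> \oo] --> a i.
  rewrite -[X in _ --> X]addr0 -(mul0r (b i)); apply: cvgD; first exact: cvg_cst.
  by apply: cvgM => //; exact: cvg_cst.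
have cd : dotv (u n) b @[n --> \oo] --> dotv a b.
  exact: cvg_dotv cu (fun i => @cvg_cst _ _ _ _ _).
have cn : nv (u n) @[n --> \oo] --> nv a.
  apply: (continuous_cvg _ (@sqrt_continuous R (dotv a a))).
  exact: (cvg_dotv cu cu).
have [na|na] := eqVneq (nv a) 0; last first.
  have na0 : 0 < nv a by rewrite lt_neqAle eq_sym na nv_ge0.
  have cp : {for nv a, continuous (fun y : R => y `^ (q - 2))}.
    apply: differentiable_continuous; apply/derivable1_diffP.
    by have [] := is_derive1_powR (q - 2) na0.
  have cnp : nv (u n) `^ (q - 2) @[n --> \oo] --> nv a `^ (q - 2).
    exact: (continuous_cvg _ cp cn).
  have c : nv (u n) `^ (q - 2) * dotv (u n) b @[n --> \oo] --> nv a `^ (q - 2) * dotv a b.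
    exact: cvgM cnp cd.
  rewrite dotv_flux (_ : (fun n => _) = (fun n => nv (u n) `^ (q - 2) * dotv (u n) b)); first exact: c.
  by apply/funext => n; rewrite dotv_flux.
have -> : dotv (fluxv q a) b = 0.
  apply/eqP; rewrite -normr_le0; apply: le_trans (flux_le a b q1) _.
  by rewrite na powR0 ?mul0r // gt_eqF // subr_gt0.
have q10 : 0 < q - 1 by rewrite subr_gt0.
have c0 : nv (u n) `^ (q - 1) * nv b @[n --> \oo] --> 0.
  have := cvg_powR_norm q10 cn; rewrite na normr0 powR0 ?gt_eqF // => h.
  rewrite -[X in _ --> X](mul0r (nv b)); apply: cvgM; last exact: cvg_cst.
  by under eq_fun do rewrite -(ger0_norm (nv_ge0 (u _))).
apply/cvgrPdist_le => e e0; move/cvgrPdist_le: c0 => /(_ e e0); apply: filterS => n.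
rewrite !sub0r !normrN => h; apply: le_trans (flux_le (u n) b q1) _.
by apply: le_trans h; exact: ler_norm.
Qed.

(** The supporting hyperplane is taken at the perturbed field, so it bounds the increment from
    above, as a minimality argument requires. The energy never has to be differentiated; continuity
    of the flux is enough. *)
Lemma energy_tangent (t : R) G H : Lvec G -> Lvec H ->
  energy (fun i x => G i x + t * H i x) - energy G <=
  q * t * \int[mu3]_x dot3 (qflux q (fun i x => G i x + t * H i x)) H x.
Proof.
move=> LG LH; pose B i x := G i x + t * H i x; have LB : Lvec B by exact: Lvec_lin.
have iG := energy_integrable LG; have iB := energy_integrable LB; have iF := flux_integrable LB LH.
rewrite !energy_def -(RintegralB measurableT iB iG) -(RintegralZl (q * t) measurableT iF).
apply: (le_Rintegral measurableT (integrableB measurableT iB iG) (intZ _ iF)) => x _; have := flux_tangent (fun i => G i x) (fun i => B i x) q1.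
have -> : (fun i => G i x - B i x) = (fun i => - t * H i x).
  by apply/funext => i; rewrite /B; ring.
have -> : dotv (fluxv q (B ^~ x)) (fun i => - t * H i x) = - t * dot3 (qflux q B) H x.
  by rewrite /dotv /dot3 mulr_sumr; apply: eq_bigr => i _; rewrite /qflux /fluxv /=; ring.
rewrite -/(norm3 G x) -/(norm3 B x); move: (_ `^ q) (_ `^ q) (dot3 _ _ _) => A E D; lra.
Qed.

Lemma flux_cvg_int G H : Lvec G -> Lvec H ->
  \int[mu3]_x dot3 (qflux q (fun i x => G i x + n.+1%:R^-1 * H i x)) H x @[n --> \oo] -->
  \int[mu3]_x dot3 (qflux q G) H x.
Proof.
move=> LG LH; have [mG yG] := LG; have [mH yH] := LH.
pose B n i x := G i x + n.+1%:R^-1 * H i x.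
have LB n : Lvec (B n) by exact: Lvec_lin.
pose k x := norm3 G x + norm3 H x.
have mk : measurable_fun setT k by apply: measurable_funD; exact: measurable_norm3.
have ky : (lpow q k < +oo)%E.
  apply: le_lt_trans (lpowD q0 (measurable_norm3 mG) (measurable_norm3 mH)) _.
  have p2 : (0 <= (2 `^ q)%:E :> \bar R)%E by rewrite lee_fin powR_ge0.
  by apply: lte_mul_pinfty p2 _ _; [by []|exact: lte_add_pinfty yG yH].
have cv x : dot3 (qflux q (B n)) H x @[n --> \oo] --> dot3 (qflux q G) H x.
  have h0 : n.+1%:R^-1 @[n --> \oo] --> (0 : R) by exact: cvg_harmonic.
  exact: (flux_cvg (a := G ^~ x) (b := H ^~ x) h0).
have [|||||_ _ C] := @dominated_convergence _ _ _ mu3 setT measurableT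
  (fun n x => (dot3 (qflux q (B n)) H x)%:E) (fun x => (dot3 (qflux q G) H x)%:E)
  (fun x => (norm3 H x * `|k x| `^ (q - 1))%:E).
- by move=> n; apply/measurable_EFinP; apply: measurable_flux => //; exact: (LB n).1.
- by apply/measurable_EFinP; exact: measurable_flux.
- by apply: aeW => x _; apply: cvg_EFin; [exact: nearW|exact: cv].
- exact: flux_dominating.
- apply: aeW => x n _; rewrite lee_fin; apply: le_trans (flux_le3 _ _ _) _.
  rewrite ler_wpM2l ?norm3_ge0 // ge0_ler_powR ?nnegrE // ?subr_ge0 ?(ltW q1) //.
  rewrite !ger0_norm ?addr_ge0 ?norm3_ge0 //; apply: le_trans (nvD (fun i => G i x) (fun i => _ * H i x)) _.
  rewrite lerD2l (nvZ _ (fun i => H i x)) ger0_norm ?invr_ge0 //.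
  by rewrite ler_piMl ?nv_ge0 // invf_le1 // ler1n.
have C' : (\int[mu3]_x dot3 (qflux q (B n)) H x)%:E @[n --> \oo] --> (\int[mu3]_x dot3 (qflux q G) H x)%:E.
  rewrite (EFin_Rintegral (flux_integrable LG LH)).
  by under eq_fun do rewrite (EFin_Rintegral (flux_integrable (LB _) LH)).
by move/fine_cvgP: C' => -[].
Qed.

(** Integrated monotonicity forces the total convexity defect to be at most 0; [energy_gap] with
    arbitrarily small e then makes the energy of G - H vanish. *)
Lemma flux_inj G H : Lvec G -> Lvec H ->
  \int[mu3]_x dot3 (qflux q G) (fun i x => G i x - H i x) x =
  \int[mu3]_x dot3 (qflux q H) (fun i x => G i x - H i x) x ->
  lpow q (norm3 (fun i x => G i x - H i x)) = 0%E.
Proof.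
move=> LG LH eGH; have LB := LvecB LG LH; have LM := Lvec_mid LG LH.
set B := (fun i x => G i x - H i x) in eGH LB *.
pose M i x := (G i x + H i x) / 2; rewrite -/M in LM.
have iG := energy_integrable LG; have iH := energy_integrable LH; have iM := energy_integrable LM.
have iFG := flux_integrable LG LB; have iFH := flux_integrable LH LB.
have gap : (energy G + energy H) / 2 - energy M <= 0.
  pose D x := norm3 G x `^ q + norm3 H x `^ q + -2 * norm3 M x `^ q.
  have iGH := intD iG iH; have iD := intD iGH (intZ (-2) iM).
  have iF := integrableB measurableT iFG iFH.
  have : \int[mu3]_x D x <= \int[mu3]_x (q / 2 * (dot3 (qflux q G) B x - dot3 (qflux q H) B x)).
    apply: (le_Rintegral measurableT iD (intZ _ iF)) => x _; have := flux_monotone (fun i => G i x) (fun i => H i x) q1; rewrite /vgap.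
    rewrite -/(norm3 G x) -/(norm3 H x) -/(norm3 M x) /D.
    rewrite -[dotv (fluxv q (G ^~ x)) _]/(dot3 (qflux q G) B x) -[dotv (fluxv q (H ^~ x)) _]/(dot3 (qflux q H) B x).
    rewrite mulrAC ler_pdivrMr //; move: (_ `^ q) (_ `^ q) (_ `^ q) (dot3 _ _ _) (dot3 _ _ _) => a b c d f; lra.
  rewrite (RintegralZl (q / 2) measurableT iF) (RintegralB measurableT iFG iFH) eGH subrr mulr0.
  rewrite /D (RintegralD measurableT iGH (intZ (-2) iM)) (RintegralD measurableT iG iH) (RintegralZl (-2) measurableT iM).
  rewrite -(energy_def G) -(energy_def H) -(energy_def M).
  move: (energy _) (energy _) (energy _) => a b c; lra.
rewrite (energyE LB); congr EFin; apply/eqP; rewrite eq_le energy_ge0 andbT.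
apply/ler_addgt0Pr => e e0; rewrite add0r.
have EG := energy_ge0 G; have EH := energy_ge0 H; clear eGH.
have S0 : 0 < energy G + energy H + 1 by lra.
have d0 : 0 < e / (energy G + energy H + 1) by rewrite divr_gt0.
have [C C0 hC] := energy_gap d0; apply: le_trans (hC G H LG LH) _.
rewrite -/M; have := ler_wpM2l (ltW C0) gap; rewrite mulr0.
have : e / (energy G + energy H + 1) * (energy G + energy H) <= e.
  by rewrite mulrAC ler_pdivrMr // ler_pM2l //; lra.
move: (C * _) (_ * (energy G + _)) => y z; lra.
Qed.

End energy.

(** * Minimisation of the action *)

Section dirichlet_principle.
Context {R : realType} (q : R) (q1 : 1 < q) (q3 : q < 3) (h : R3 R -> R).
Local Notation qs := (sobolev_exp q).
Context (mh : measurable_fun setT h) (hy : (lpow (qs / (qs - 1)) h < +oo)%E).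
Implicit Types (f g w : R3 R -> R) (G H : 'I_3 -> R3 R -> R).

Let q0 : 0 < q. Proof. exact: lt_trans ltr01 q1. Qed.
Let qs1 : 1 < qs. Proof. exact: lt_trans q1 (sobolev_exp_gt q0 q3). Qed.
Let qs0 : 0 < qs. Proof. exact: lt_trans ltr01 qs1. Qed.

Lemma Dpair_Lvec w H : Dpair q w H -> Lvec q H.
Proof. by move=> Dw; have [_ yH] := Dpair_lty q1 q3 Dw; case: Dw. Qed.

Lemma load_integrable w H : Dpair q w H -> mu3.-integrable setT (fun x => (h x * w x)%:E).
Proof.
move=> Dw; have [yw _] := Dpair_lty q1 q3 Dw; have [mw _ _] := Dw.
have := hoelder_integrable qs1 mw mh yw hy.
by under eq_fun do rewrite mulrC.
Qed.

(** Sealed for the same reason as [energy]. *)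
Lemma load_exists : {L : (R3 R -> R) -> R | forall w, L w = \int[mu3]_x (h x * w x)}.
Proof. by exists (fun w => \int[mu3]_x (h x * w x)). Qed.

Definition load : (R3 R -> R) -> R := sval load_exists.

Lemma load_def w : load w = \int[mu3]_x (h x * w x).
Proof. exact: (svalP load_exists). Qed.

Lemma load_lin (c : R) w H w' H' : Dpair q w H -> Dpair q w' H' ->
  load (fun x => w x + c * w' x) = load w + c * load w'.
Proof.
move=> /load_integrable iw /load_integrable iw'; rewrite !load_def.
rewrite -(RintegralZl c measurableT iw') -(RintegralD measurableT iw (integrableZl measurableT c iw')).
by apply: eq_Rintegral => x _; ring.
Qed.

Lemma load_cvg w H (g : nat -> R3 R -> R) : Dpair q w H -> Dapprox q w H g -> forall e : R, 0 < e ->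
  exists N, forall n, (N <= n)%N -> `|load (g n) - load w| <= e.
Proof.
move=> Dw [tg gw _] e e0; have [mw _ _] := Dw; have iw := load_integrable Dw.
have mB n : measurable_fun setT (fun x => g n x - w x).
  by apply: measurable_funB => //; exact: measurable_test.
have [N hN] := null_pairing qs1 mB mh gw hy e0; exists N => n Nn.
have ig := load_integrable (Dpair_test q1 q3 (tg n)).
have iB : mu3.-integrable setT (fun x => ((g n x - w x) * h x)%:E).
  apply: eq_integrable (integrableB measurableT ig iw) => // x _.
  by rewrite -EFinB; congr EFin; ring.
have := normr_Rintegral_le iB (hN n Nn); congr (`|_| <= e).
rewrite !load_def -(RintegralB measurableT ig iw).
by apply: eq_Rintegral => x _; ring.
Qed.

(** Hoelder with exponent q*, then the Sobolev inequality; the powers q*/q and 1/q* combine to 1/q.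
    The 1 added to the constant makes it positive. *)
Lemma load_bound : exists2 b : R, 0 < b & forall g, test_function g ->
  `|load g| <= b * energy q (grad g) `^ q^-1.
Proof.
pose B := fine (lpow (qs / (qs - 1)) h); have B0 : 0 <= B by apply: fine_ge0; exact: lpow_ge0.
have hB : (lpow (qs / (qs - 1)) h <= B%:E)%E by rewrite fineK // ge0_fin_numE ?lpow_ge0.
have C0 : 0 <= Csob q by rewrite /Csob /Clev !mulr_ge0 ?powR_ge0.
pose c := Csob q `^ q^-1 * B `^ (qs / (qs - 1))^-1.
have c0 : 0 <= c by rewrite mulr_ge0 ?powR_ge0.
exists (c + 1) => [|g tg]; first by rewrite ltr_wpDl.
have Dg := Dpair_test q1 q3 tg; have Lg := Dpair_Lvec Dg; have E0 := energy_ge0 q (grad g).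
have mg := measurable_test tg.
have gE i : (lpow q (grad g i) <= (energy q (grad g))%:E)%E.
  by rewrite -(energyE Lg); apply: lpow_coord q0 Lg.1.
have S := sobolev_test q1 q3 tg E0 gE.
have := hoelder_lpow qs1 mg mh (powR_ge0 _ _) B0 S hB.
have -> : ((Csob q * energy q (grad g)) `^ (qs / q)) `^ qs^-1 = Csob q `^ q^-1 * energy q (grad g) `^ q^-1.
  rewrite -powRM // -powRrM; congr powR; field; rewrite !gt_eqF //.
have ig : mu3.-integrable setT (fun x => (g x * h x)%:E).
  by apply: eq_integrable (load_integrable Dg) => // x _; rewrite mulrC.
move=> /(normr_Rintegral_le ig) I; have -> : load g = \int[mu3]_x (g x * h x).
  by rewrite load_def; apply: eq_Rintegral => x _; rewrite mulrC.
apply: le_trans I _; rewrite mulrDl mul1r -[leLHS]addr0; apply: lerD; last exact: powR_ge0.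
by rewrite /c mulrAC.
Qed.

Definition action w H : R := energy q H / q - load w.

Lemma action_coercive : exists C : R, forall g, test_function g ->
  energy q (grad g) / (2 * q) - C <= action g (grad g).
Proof.
have [b b0 hb] := load_bound.
(* With c^{q-1} = 2 b, half of Young's inequality reads b E^{1/q} <= E / (2 q) + constant, which
   leaves half of the energy term. *)
pose c := (2 * b) `^ (q - 1)^-1; have c0 : 0 < c by rewrite powR_gt0 // mulr_gt0.
exists ((1 - q^-1) * c `^ q / 2) => g tg; have {hb} := hb g tg.
have E0 := energy_ge0 q (grad g); rewrite /action; move: (load g) (energy q _) E0 => l E E0.
have := young_tangent q1 (powR_ge0 E q^-1) c0.
have -> : c `^ (q - 1) = 2 * b.
  by rewrite /c -powRrM mulVf ?gt_eqF ?subr_gt0 // powRr1 // mulr_ge0 // ltW.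
rewrite -powRrM mulVf ?gt_eqF // powRr1 // ler_norml.
have -> : E / (2 * q) = E / q / 2 by field; rewrite gt_eqF.
move: (E / q) (E `^ q^-1) (_ * c `^ q) => x y z hy1 /andP[h1 h2]; lra.
Qed.

Lemma action_cvg w H (g : nat -> R3 R -> R) : Dpair q w H -> Dapprox q w H g -> forall e : R, 0 < e ->
  exists N, forall n, (N <= n)%N -> `|action (g n) (grad (g n)) - action w H| <= e.
Proof.
move=> Dw Ag e e0; have [tg gw gH] := Ag; have e2 : 0 < e / 2 by rewrite divr_gt0.
have [N1 h1] := load_cvg Dw Ag e2.
have LG n := Dpair_Lvec (Dpair_test q1 q3 (tg n)).
have [N2 h2] := energy_cvg q1 LG (Dpair_Lvec Dw) gH e2.
exists (maxn N1 N2) => n; rewrite geq_max => /andP[/h1 {}h1 /h2 {}h2].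
rewrite /action; move: h1 h2; move: (load _) (load _) (energy _ _) (energy _ _) => l l' E E' h1 h2.
have -> : E' / q - l' - (E / q - l) = (E' - E) / q - (l' - l) by ring.
apply: le_trans (ler_normB _ _) _; rewrite [leRHS](splitr e); apply: lerD => //.
rewrite normrM (gtr0_norm (x := q^-1)) ?invr_gt0 // ler_pdivrMr //.
by apply: le_trans h2 _; rewrite ler_peMr // ltW.
Qed.

(** The load is linear, so the action of the midpoint lies below the average of the actions by
    exactly the energy defect over q. Near-minimality thus bounds the defect. *)
Lemma action_mid f g : test_function f -> test_function g ->
  let k x := 2^-1 * (f x + g x) in
  [/\ test_function k, grad k = (fun i x => (grad f i x + grad g i x) / 2) &
      action k (grad k) = (action f (grad f) + action g (grad g)) / 2 -
        ((energy q (grad f) + energy q (grad g)) / 2 - energy q (grad k)) / q].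
Proof.
move=> tf tg k; have tk : test_function k by apply: testZ; exact: testD.
split=> //.
  apply/funext => i; apply/funext => x.
  by rewrite (gradZ 2^-1 i (testD tf tg)) (gradD i tf tg) mulrC.
have Df := Dpair_test q1 q3 tf; have Dg := Dpair_test q1 q3 tg.
have lk : load k = (load f + load g) / 2.
  have iF := load_integrable Df; have iG := load_integrable Dg.
  rewrite !load_def -(RintegralD measurableT iF iG) mulrC.
  rewrite -(RintegralZl 2^-1 measurableT (integrableD measurableT iF iG)).
  by apply: eq_Rintegral => x _; rewrite /k; ring.
rewrite /action lk; move: (load _) (load _) (energy _ _) (energy _ _) (energy _ _) => a b c d e.
by field; rewrite gt_eqF.
Qed.

(* [a], [b], [c] are the energies of two terms of a minimising sequence and of
   their midpoint, [u] and [v] the corresponding actions. *)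
Let minimizing_arith (a b c u v s t e K M m : R) : 0 <= M -> 0 < e -> 0 < K ->
  m <= (u + v) / 2 - ((a + b) / 2 - c) / q -> b <= M -> a <= M -> v < m + t -> u < m + s ->
  K * q * t <= e / 2 -> K * q * s <= e / 2 ->
  e / 2 / (2 * M + 1) * (a + b) + K * ((a + b) / 2 - c) <= e.
Proof.
move=> M0 e0 K0 hm hb ha hv hu ht hs; set D := (a + b) / 2 - c in hm *.
have M1 : 0 < 2 * M + 1 by lra.
have h1 : e / 2 / (2 * M + 1) * (a + b) <= e / 2.
  by rewrite mulrAC ler_pdivrMr // ler_pM2l ?divr_gt0 //; lra.
have h2 : D <= q * ((s + t) / 2) by rewrite mulrC -ler_pdivrMr //; lra.
have h3 : K * D <= K * (q * ((s + t) / 2)) by rewrite ler_pM2l.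
have h4 : K * (q * ((s + t) / 2)) = (K * q * s + K * q * t) / 2 by ring.
move: (K * D) (_ * (a + b)) (K * q * s) (K * q * t) h4 h3 h1 ht hs => A B X Y; lra.
Qed.

(** The infimum is taken over test functions and extends to the closure by continuity of the action.
    Uniform convexity gives strong convergence of the gradients, so no weak compactness enters. *)
Lemma minimizer : exists phi G, Dpair q phi G /\
  forall w H, Dpair q w H -> action phi G <= action w H.
Proof.
have [C hC] := action_coercive.
pose S := [set y | exists2 g, test_function g & y = action g (grad g)].
have S0 : S !=set0.
  by exists (action (cst 0) (grad (cst 0))); exists (cst 0) => //; exact: test_cst0.
have Slb : has_lbound S.
  exists (- C) => _ [g tg ->]; apply: le_trans (hC g tg).
  by rewrite -[leLHS]add0r lerD2r divr_ge0 ?energy_ge0 // mulr_ge0 // ltW.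
have [m mle ex] : exists2 m, forall g, test_function g -> m <= action g (grad g) &
    forall n, exists g, test_function g /\ action g (grad g) < m + n.+1%:R^-1.
  exists (inf S) => [g tg|n]; first by apply: ge_inf => //; exists g.
  have n0 : 0 < n.+1%:R^-1 :> R by rewrite invr_gt0.
  by have [_ [g tg ->] lt] := inf_adherent n0 (conj S0 Slb); exists g.
have [g hg] := choice ex.
have tg n : test_function (g n) := (hg n).1.
have mall w H : Dpair q w H -> m <= action w H.
  move=> Dw; have [_ _ [k Ak]] := Dw; apply/ler_addgt0Pr => e e0.
  have [N hN] := action_cvg Dw Ak e0; have [tk _ _] := Ak.
  have := mle _ (tk N); have := hN N (leqnn N); rewrite ler_norml => /andP[_].
  move: (action _ _) (action _ _) => a b; lra.
(* Coercivity turned into an energy bound: the actions of the sequence stay below m + 1. *)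
pose M := 2 * q * (m + 1 + C).
have EM n : energy q (grad (g n)) <= M.
  have := hC _ (tg n); have := (hg n).2.
  have n1 : n.+1%:R^-1 <= 1 :> R by rewrite invf_le1 // ler1n.
  rewrite /M; move: (action _ _) (energy _ _) => a E h1 h2.
  have : E / (2 * q) <= m + 1 + C by move: h1 h2 n1; move: n.+1%:R^-1 (E / (2 * q)) => z y h1 h2 n1; lra.
  by rewrite ler_pdivrMr ?mulr_gt0 // mulrC.
have M0 : 0 <= M by apply: le_trans (energy_ge0 q _) (EM 0%N).
have gC (e : R) : 0 < e -> exists N, forall i j, (N <= i)%N -> (N <= j)%N ->
    (lpow q (norm3 (grad (fun x => g i x - g j x)%R)) <= e%:E)%E.
  move=> e0; pose d := e / 2 / (2 * M + 1).
  have M1 : 0 < 2 * M + 1 by lra.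
  have d0 : 0 < d by rewrite !divr_gt0.
  have [K K0 hK] := energy_gap q1 d0.
  have eK : 0 < e / 2 / (K * q) by rewrite !divr_gt0 // mulr_gt0.
  exists (Num.truncn (e / 2 / (K * q))^-1) => i j Ni Nj.
  have small n : (Num.truncn (e / 2 / (K * q))^-1 <= n)%N -> K * q * n.+1%:R^-1 <= e / 2.
    move=> Nn; have Kq : 0 < K * q by rewrite mulr_gt0.
    rewrite mulrC -ler_pdivlMr // -[leRHS]invrK lef_pV2 ?posrE ?invr_gt0 //.
    apply: le_trans (ltW (Num.Theory.truncnS_gt _)) _; by rewrite ler_nat ltnS.
  have LG n := Dpair_Lvec (Dpair_test q1 q3 (tg n)).
  have [tk gk Ak] := action_mid (tg i) (tg j).
  have := hK _ _ (LG i) (LG j); rewrite -gk.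
  have mk := mle _ tk; rewrite Ak in mk.
  have -> : grad (fun x => g i x - g j x) = (fun l x => grad (g i) l x - grad (g j) l x).
    by apply/funext => l; rewrite gradB.
  rewrite (energyE (LvecB q1 (LG i) (LG j))) lee_fin => hE; apply: le_trans hE _.
  have := small i Ni; have := small j Nj; have := (hg i).2; have := (hg j).2; have := EM i; have := EM j.
  move: mk; move: (energy _ _) (energy _ _) (energy _ _) (action _ _) (action _ _) => a b c u v.
  move: i.+1%:R^-1 j.+1%:R^-1 => s t.
  by move=> mk bM aM vt us tt ss; exact: (minimizing_arith M0 e0 K0 mk bM aM vt us tt ss).
have [phi [G [mphi mG AG]]] := Dapprox_complete q1 q3 tg gC.
have DG : Dpair q phi G by split => //; exists g.
exists phi, G; split=> // w H Dw; apply: le_trans (mall w H Dw).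
apply/ler_addgt0Pr => e e0; have e2 : 0 < e / 2 by rewrite divr_gt0.
have [N hN] := action_cvg DG AG e2.
pose n := maxn N (Num.truncn (e / 2)^-1).
have := hN n (leq_maxl _ _); have := (hg n).2.
have : n.+1%:R^-1 <= e / 2.
  rewrite -[leRHS]invrK lef_pV2 ?posrE ?invr_gt0 //.
  by apply: le_trans (ltW (Num.Theory.truncnS_gt _)) _; rewrite ler_nat ltnS leq_maxr.
rewrite ler_norml; move: (action _ _) (action _ _) n.+1%:R^-1 => a b c h1 h2 /andP[h3 h4]; lra.
Qed.

End dirichlet_principle.

(** * The Euler-Lagrange equation and well-posedness *)

Section poisson.
Context {R : realType} (q : R) (q1 : 1 < q) (q3 : q < 3) (h : R3 R -> R).
Local Notation qs := (sobolev_exp q).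
Context (mh : measurable_fun setT h) (hy : (lpow (qs / (qs - 1)) h < +oo)%E).
Implicit Types (f g w : R3 R -> R) (G H : 'I_3 -> R3 R -> R).

Let flux_load_arith (E E' l lw t I : R) : 0 < t -> E / q - l <= E' / q - (l + t * lw) ->
  E' - E <= q * t * I -> lw <= I.
Proof.
move=> t0 h1 h2; have q0 : 0 < q := lt_trans ltr01 q1.
have h3 : (E' - E) / q <= t * I by rewrite ler_pdivrMr // mulrC mulrA.
rewrite -(ler_pM2l t0); have e : (E' - E) / q = E' / q - E / q by ring.
by rewrite e in h3; lra.
Qed.

(** Perturbing by t w with t = 1/(n+1), minimality gives t [load h w] <= (energy increment) / q, and
    [energy_tangent] bounds this by t times the flux pairing at the perturbed field. Divide by t and
    let it tend to 0. *)
Lemma minimizer_flux_ge phi G : Dpair q phi G ->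
  (forall w H, Dpair q w H -> action q h phi G <= action q h w H) ->
  forall w H, Dpair q w H -> load h w <= \int[mu3]_x dot3 (qflux q G) H x.
Proof.
move=> Dphi hmin w H Dw; have LG := Dpair_Lvec q1 q3 Dphi; have LH := Dpair_Lvec q1 q3 Dw.
have le n : load h w <= \int[mu3]_x dot3 (qflux q (fun i x => G i x + n.+1%:R^-1 * H i x)) H x.
  have t0 : 0 < n.+1%:R^-1 :> R by rewrite invr_gt0.
  have := hmin _ _ (Dpair_lin q1 q3 n.+1%:R^-1 Dphi Dw); rewrite /action.
  rewrite (load_lin q1 q3 mh hy n.+1%:R^-1 Dphi Dw) => h1.
  exact: flux_load_arith t0 h1 (energy_tangent q1 n.+1%:R^-1 LG LH).
exact: (ler_cvg_to (@cvg_cst _ (load h w) _ _ _) (flux_cvg_int q1 LG LH) (nearW _ le)).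
Qed.

Lemma euler_lagrange phi G : Dpair q phi G ->
  (forall w H, Dpair q w H -> action q h phi G <= action q h w H) ->
  forall w H, Dpair q w H -> \int[mu3]_x dot3 (qflux q G) H x = load h w.
Proof.
move=> Dphi hmin w H Dw; have ge := minimizer_flux_ge Dphi hmin.
have LG := Dpair_Lvec q1 q3 Dphi; have LH := Dpair_Lvec q1 q3 Dw.
(* The opposite inequality comes from the direction -w, written w + (-2) w to fit the form of
   [Dpair_lin]. *)
have := ge _ _ (Dpair_lin q1 q3 (-2) Dw Dw).
rewrite (load_lin q1 q3 mh hy (-2) Dw Dw); have := ge _ _ Dw.
have -> : \int[mu3]_x dot3 (qflux q G) (fun i x => H i x + -2 * H i x) x =
    -1 * \int[mu3]_x dot3 (qflux q G) H x.
  rewrite -(RintegralZl (-1) measurableT (flux_integrable q1 LG LH)); apply: eq_Rintegral => x _.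
  by rewrite /dot3 mulr_sumr; apply: eq_bigr => i _; ring.
move: (load h w) (Rintegral _ _ _) => a b h1 h2; apply/eqP; rewrite eq_le; apply/andP; split; lra.
Qed.

(** A solution is tested with an arbitrary weak gradient [H] of w. It agrees almost everywhere with
    the L^q limit of the approximating gradients, so the same sequence approximates (w, H). *)
Lemma D1_weak_Dpair w H : D1 q w -> weak_gradient w H -> Dpair q w H.
Proof.
move=> D1w wH; have [K DK] := D1_Dpair q1 q3 D1w.
have wK := Dpair_weak_gradient q1 q3 DK; have [mw mK [g [tg gw gK]]] := DK.
have [_ lH _] := wH; have mH i : measurable_fun setT (H i) by case: (lH i).
have ww : w = w %[ae mu3] by exact: aeW.
have KH := weak_gradient_uniq wK wH ww.
split; [exact: mw|exact: mH|exists g; split; [exact: tg|exact: gw|]].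
rewrite (_ : (fun n => _) = (fun n => lpow q (norm3 (fun i x => grad (g n) i x - K i x)))); first exact: gK.
apply/funext => n; apply: eq_lpow_ae.
- by apply: measurable_norm3 => i; apply: measurable_funB => //; exact: measurable_test (test_grad i (tg n)).
- by apply: measurable_norm3 => i; apply: measurable_funB => //; exact: measurable_test (test_grad i (tg n)).
move: (KH ord0) (KH (lift ord0 ord0)) (KH (lift ord0 (lift ord0 ord0))); apply: filterS3 => x e0 e1 e2 _.
have KHx i : K i x = H i x.
  have [->|[->|->]] : i = ord0 \/ i = lift ord0 ord0 \/ i = lift ord0 (lift ord0 ord0).
    by case: i => [[|[|[|//]]] hi]; [left|right; left|right; right]; exact: val_inj.
  - exact: e0.
  - exact: e1.
  - exact: e2.
by rewrite /norm3 /dot3; congr Num.sqrt; apply: eq_bigr => i _; rewrite KHx.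
Qed.

Lemma poisson_well_posed : exists phi : R3 R -> R,
  [/\ D1 q phi, q_poisson_solution q h phi &
      forall psi : R3 R -> R, D1 q psi -> q_poisson_solution q h psi -> psi = phi %[ae mu3]].
Proof.
have [phi [G [Dphi hmin]]] := minimizer q1 q3 mh hy.
have EL := euler_lagrange Dphi hmin; have LG := Dpair_Lvec q1 q3 Dphi.
exists phi; split; first exact: (Dpair_D1 q1 q3 Dphi).
  exists G => [|w H D1w wH]; first exact: (Dpair_weak_gradient q1 q3 Dphi).
  have Dw := D1_weak_Dpair D1w wH; have LH := Dpair_Lvec q1 q3 Dw.
  split; [exact: (flux_integrable q1 LG LH)|exact: (load_integrable q1 q3 mh hy Dw)|].
  by rewrite (EL _ _ Dw) load_def.
move=> psi D1psi [K wK solK]; have Dpsi := D1_weak_Dpair D1psi wK.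
(* The difference of the two solutions is an admissible test function in both equations. The
   equations then make the flux pairings coincide, and [flux_inj] applies. *)
have Dd := Dpair_lin q1 q3 (-1) Dpsi Dphi.
have eK : (fun i x => K i x + -1 * G i x) = (fun i x => K i x - G i x).
  by apply/funext => i; apply/funext => x; rewrite mulN1r.
rewrite eK in Dd.
have [_ _ sK] := solK _ _ (Dpair_D1 q1 q3 Dd) (Dpair_weak_gradient q1 q3 Dd).
have sG := EL _ _ Dd; rewrite load_def in sG.
have LK := Dpair_Lvec q1 q3 Dpsi.
have E0 := flux_inj q1 LK LG (etrans sK (esym sG)).
have := Dpair_sobolev0 q1 q3 Dd E0; apply: filterS => x /eqP.
by rewrite mulN1r subr_eq0 => /eqP.
Qed.

End poisson.

Lemma Lfun_lpow (R : realType) (r : R) (f : R3 R -> R) : 0 < r -> f \in Lfun mu3 r%:E ->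
  measurable_fun setT f /\ (lpow r f < +oo)%E.
Proof.
move=> r0; rewrite inE /= => /andP[]; rewrite !inE /= /finite_norm => mf Nf; split=> //.
rewrite -(lnormE f r0); have := Lnorm_ge0 mu3 r%:E (EFin \o f).
by move: Nf; case: ('N[mu3]_r%:E [EFin \o f])%E => [y| |] //= _ _; rewrite ltry.
Qed.

Lemma W1_lpow (R : realType) (p t : R) (u : R3 R -> R) : 1 < p -> p < 3 -> p <= t < sobolev_exp p ->
  W1 p u -> (lpow t u < +oo)%E.
Proof.
move=> p1 p3 pt [Lu [G wG LG]]; have p0 : 0 < p := lt_trans ltr01 p1.
have [mu uy] := Lfun_lpow p0 Lu.
have mG i := (Lfun_lpow p0 (LG i)).1; have Gy i := (Lfun_lpow p0 (LG i)).2.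
pose K := \sum_(i < 3) fine (lpow p (G i)).
have K0 : 0 <= K by apply: sumr_ge0 => i _; apply: fine_ge0; exact: lpow_ge0.
have GK i : (lpow p (G i) <= K%:E)%E.
  rewrite -(fineK (x := lpow p (G i))) ?ge0_fin_numE ?lpow_ge0 // lee_fin /K (bigD1 i) //= lerDl.
  by apply: sumr_ge0 => j _; apply: fine_ge0; exact: lpow_ge0.
apply: (sobolev_embedding p1 p3 pt mu K0 _ uy) => i h kappa h0 k0.
apply: le_trans (GK i).
have mn : measurable_fun setT (fun x => `|G i x|) by exact: measurableT_comp.
have -> : lpow p (G i) = lpow p (fun x => `|G i x|) by apply: eq_integral => x _; rewrite normr_id.
exact: (shift_level p1 h0 k0 mu mn (fun x => normr_ge0 _) (weak_gradient_shift i wG h0)).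
Qed.

Theorem proposition2p1 (R : realType) (p q s : R)
    (hp1 : 1 < p) (hp3 : p < 3)
    (hq1 : Num.max 1 (3 * p / (5 * p - 3)) < q) (hq3 : q < 3)
    (hs1 : Num.max 1 ((sobolev_exp q - 1) * p / sobolev_exp q) < s)
    (hs2 : s < (sobolev_exp q - 1) * sobolev_exp p / sobolev_exp q)
    (u : R3 R -> R) (hu : W1 p u) :
  exists phi : R3 R -> R,
    [/\ D1 q phi,
        q_poisson_solution q (fun x => `|u x| `^ s) phi &
        forall psi : R3 R -> R, D1 q psi ->
          q_poisson_solution q (fun x => `|u x| `^ s) psi ->
          psi = phi %[ae mu3]].
Proof.
move: hq1; rewrite gt_max => /andP[q1 _]; move: hs1; rewrite gt_max => /andP[s1 ps].
have q0 : 0 < q := lt_trans ltr01 q1.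
have qs1 : 1 < sobolev_exp q := lt_trans q1 (sobolev_exp_gt q0 hq3).
have qs0 : 0 < sobolev_exp q := lt_trans ltr01 qs1.
have qs10 : 0 < sobolev_exp q - 1 by rewrite subr_gt0.
have [mu _] := Lfun_lpow (lt_trans ltr01 hp1) hu.1.
apply: poisson_well_posed => //; first exact: measurable_powR_norm.
(* The load |u|^s must lie in the dual exponent of q*, that is, u in L^t with t = s q* / (q* - 1).
   The two bounds on s say p < t < p*, the range covered by the embedding. *)
have -> : lpow (sobolev_exp q / (sobolev_exp q - 1)) (fun x => `|u x| `^ s) =
    lpow (s * (sobolev_exp q / (sobolev_exp q - 1))) u.
  by apply: eq_integral => x _; rewrite ger0_norm ?powR_ge0 // -powRrM.
apply: (W1_lpow hp1 hp3 _ hu).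
rewrite mulrA ler_pdivlMr // ltr_pdivrMr //.
move: ps hs2; rewrite ltr_pdivrMr // ltr_pdivlMr // => h1 h2.
by rewrite (mulrC p) (mulrC (sobolev_exp p)) (ltW h1).
Qed.
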